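(* Let $K$ be a field of characteristic zero, $X=K^{n+d}$ with coordinates $(x,t)=(x_1,\dots,x_n,t_1,\dots,t_d)$, $Y=K^n\times\{0\}=\{t=0\}$, and $\iota:Y\to X$ the natural embedding. Let $M$ be a finitely generated left $D_{n+d}$-module, and let $$D_{n+d}^{r_{d+1}}\xrightarrow{\psi_{d+1}}D_{n+d}^{r_d}\xrightarrow{\psi_d}\cdots\xrightarrow{\psi_2}D_{n+d}^{r_1}\xrightarrow{\psi_1}D_{n+d}^{r_0}\xrightarrow{\varphi}M\to0$$ be an exact sequence of left $D_{n+d}$-modules together with vectors $\mathbf m_j\in\mathbb Z^{r_j}$ ($0\le j\le d+1$), $\mathbf m_0=0$, such that $\psi_{j+1}(V_Y^k[\mathbf m_{j+1}](D_{n+d}^{r_{j+1}}))\subset V_Y^k[\mathbf m_j](D_{n+d}^{r_j})$ for all $0\le j\le d$, $k\in\mathbb Z$, and such that for every integer $k$ the induced sequence $$V_Y^k[\mathbf m_{d+1}](D_{n+d}^{r_{d+1}})\xrightarrow{\psi_{d+1}}V_Y^k[\mathbf m_d](D_{n+d}^{r_d})\xrightarrow{\psi_d}\cdots\xrightarrow{\psi_1}V_Y^k(D_{n+d}^{r_0})\xrightarrow{\varphi}V_Y^k(M)\to0,\quad V_Y^k(M):=\varphi(V_Y^k(D_{n+d}^{r_0})),$$ is exact. Set $u_i=\varphi(e_i)$, where $e_1,\dots,e_{r_0}$ are the unit vectors. Let $\mathfrak p$ be a prime ideal of $K[x]$ and assume that for each $i$ there exists an indicial polynomial $b_i(s,x)\in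 K[x]_{\mathfrak p}[s]$ of $u_i$ along $Y$ at $\mathfrak p$. Let $k_0\le k_1$ be integers (or $k_0=-\infty$) such that the specializations of $b_i(j,x)$ ($i=1,\dots,r_0$) to $\kappa(\mathfrak p)$ do not vanish whenever an integer $j$ satisfies $j\le k_0$ or $j>k_1$. Define the complex $V^\bullet$ by $$0\to\frac{V_Y^{k_1}[\mathbf m_{d+1}](D_{Y\to X}^{r_{d+1}})}{V_Y^{k_0}[\mathbf m_{d+1}](D_{Y\to X}^{r_{d+1}})}\xrightarrow{\overline\psi_{d+1}}\cdots\xrightarrow{\overline\psi_2}\frac{V_Y^{k_1}[\mathbf m_1](D_{Y\to X}^{r_1})}{V_Y^{k_0}[\mathbf m_1](D_{Y\to X}^{r_1})}\xrightarrow{\overline\psi_1}\frac{V_Y^{k_1}(D_{Y\to X}^{r_0})}{V_Y^{k_0}(D_{Y\to X}^{r_0})}\to0,$$ where $\overline\psi_j$ is induced by $\psi_j$, the denominators are $0$ if $k_0=-\infty$, and the rightmost nonzero term is in degree $0$. Then $K[x]_{\mathfrak p}\otimes_{K[x]}(\tau^{\ge-d}V^\bullet)$ is isomorphic to $K[x]_{\mathfrak p}\otimes_{K[x]}\mathbb L\iota^*(M)$ in $D^-(\mathrm{Mod}(K[x]_{\mathfrak p}\otimes_{K[x]}D_n))$. In particular, if the specialization of $b_i(j,x)$ to $\kappa(\mathfrak p)$ does not vanish for any $j\in\mathbb Z$ and any $i=1,\dots,r_0$, then $K[x]_{\mathfrak p}\otimes_{K[x]}\mathbb L\iota^*(M)=0$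 in $D^-(\mathrm{Mod}(K[x]_{\mathfrak p}\otimes_{K[x]}D_n))$.
   Context: $D_n$ (resp. $D_{n+d}$) is the ring of differential operators with polynomial coefficients over $K$ in the variables $x$ (resp. $(x,t)$). $V_Y^i(D_{n+d})=\{P\in D_{n+d}\mid P\langle t_1,\dots,t_d\rangle^j\subset\langle t_1,\dots,t_d\rangle^{j-i}\ (\forall j\in\mathbb Z)\}$, where $\langle t_1,\dots,t_d\rangle$ is the ideal of $K[x,t]$ generated by the $t_i$ and nonpositive powers mean $K[x,t]$. For $\mathbf m=(m_1,\dots,m_r)\in\mathbb Z^r$, $V_Y^k[\mathbf m](D_{n+d}^r)=\bigoplus_{i}V_Y^{k-m_i}(D_{n+d})$; $[\mathbf m]$ is omitted if $\mathbf m=0$. Put $\theta=\sum_it_i\partial_{t_i}$. For $u\in M$, $J_Y(u)\subset K[s,x]$ is the ideal of those $f(s,x)$ for which there is $Q\in V_Y^{-1}(D_{n+d})$ with $(f(\theta,x)+Q)u=0$. With $J_Y(u)_{\mathfrak p}=K[x]_{\mathfrak p}\otimes_{K[x]}J_Y(u)\subset K[x]_{\mathfrak p}[s]$, an indicial polynomial of $u$ along $Y$ at $\mathfrak p$ is an element $b(s,x)\in J_Y(u)_{\mathfrak p}$ monic in $s$ of smallest degree in $s$ among the monic elements of $J_Y(u)_{\mathfrak p}$. $\kappa(\mathfrak p)$ is the quotient field of $K[x]/\mathfrak p$, and specialization is the natural map $K[x]_{\mathfrak p}\to K[x]_{\mathfrak p}/\mathfrak pK[x]_{\mathfrak p}=\kappa(\mathfrak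 p)$. $D_{Y\to X}=D_{n+d}/(t_1D_{n+d}+\dots+t_dD_{n+d})\simeq\bigoplus_{\alpha\in\mathbb N^d}D_n\partial_t^\alpha$, a $(D_n,D_{n+d})$-bimodule; $V_Y^k[\mathbf m](D_{Y\to X}^r)$ is the filtration induced by $V_Y^k[\mathbf m](D_{n+d}^r)$, i.e. $\bigoplus_{i=1}^r\bigoplus_{|\alpha|\le k-m_i}D_n\partial_t^\alpha$. The inverse image is $\mathbb L\iota^*(M)=D_{Y\to X}\overset{\mathbb L}{\otimes}_{D_{n+d}}M$ in $D^-(\mathrm{Mod}(D_n))$. For a complex $C^\bullet$ with differentials $d^k:C^k\to C^{k+1}$, $\tau^{\ge k}C^\bullet$ is the complex $\cdots\to0\to\mathrm{Coker}\,d^{k-1}\to C^{k+1}\xrightarrow{d^{k+1}}C^{k+2}\to\cdots$ with $\mathrm{Coker}\,d^{k-1}$ in degree $k$. *)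

(* Defs.v *)
From HB Require Import structures.
From mathcomp Require Import all_boot all_order all_algebra.
From mathcomp Require Import boolp.
From mathcomp Require Import mpoly.
From mathcomp Require Import ring.

Set Implicit Arguments.
Unset Strict Implicit.
Unset Printing Implicit Defensive.

Import Order.TTheory GRing.Theory Num.Theory.
Local Open Scope ring_scope.
Local Open Scope quotient_scope.

Record submodule (R : pzRingType) (V : lmodType R) := Submodule {
  sm_mem :> V -> Prop;
  sm0 : sm_mem 0;
  smD : forall x y, sm_mem x -> sm_mem y -> sm_mem (x + y);
  smZ : forall (a : R) x, sm_mem x -> sm_mem (a *: x) }.

Section Submodules.
Context (R : pzRingType) (V : lmodType R) (S : submodule V).

Definition smb : {pred V} := fun x => `[< S x >].

Lemma smb_closed : submod_closed smb.
Proof.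
split; first by apply/asboolP; exact: sm0.
move=> a x y /asboolP hx /asboolP hy; apply/asboolP.
by apply: smD => //; apply: smZ.
Qed.
HB.instance Definition _ := GRing.isSubmodClosed.Build R V smb smb_closed.

Definition subm := {x : V | x \in smb}.
HB.instance Definition _ := SubChoice.on subm.
HB.instance Definition _ := [SubChoice_isSubLmodule of subm by <:].

Definition Subm (x : V) (h : S x) : subm := exist _ x (asboolT h).

Definition quom := {ideal_quot smb}.
HB.instance Definition _ := GRing.Zmodule.on quom.

Definition pim (x : V) : quom := \pi_quom x.

Lemma pim_eq x y : pim x = pim y <-> S (x - y).
Proof.
split=> [/eqP|h]; last apply/eqP.
  by rewrite /pim -Quotient.idealrBE => /asboolP.
by rewrite /pim -Quotient.idealrBE; apply/asboolP.
Qed.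

Lemma pimD x y : pim (x + y) = pim x + pim y.
Proof. by rewrite /pim !piE. Qed.

Lemma pim_repr (q : quom) : pim (repr q) = q.
Proof. exact: reprK. Qed.

Definition quom_scale (a : R) (q : quom) : quom := pim (a *: repr q).

Lemma pimZ a x : pim (a *: x) = quom_scale a (pim x).
Proof.
by apply/pim_eq; rewrite -scalerBr; apply: smZ; apply/pim_eq; rewrite pim_repr.
Qed.

Lemma quom_scaleA a b q : quom_scale a (quom_scale b q) = quom_scale (a * b) q.
Proof. by rewrite -[q]pim_repr -!pimZ scalerA. Qed.
Lemma quom_scale1 : left_id 1 quom_scale.
Proof. by move=> q; rewrite -[q]pim_repr -!pimZ scale1r. Qed.
Lemma quom_scaleDr : right_distributive quom_scale +%R.
Proof.
move=> a q q'; rewrite -[q]pim_repr -[q']pim_repr.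
by rewrite -[in LHS]pimD -!pimZ -pimD scalerDr.
Qed.
Lemma quom_scaleDl q : {morph quom_scale^~ q : a b / a + b}.
Proof. by move=> a b; rewrite -[q]pim_repr -!pimZ -pimD scalerDl. Qed.

HB.instance Definition _ := GRing.Zmodule_isLmodule.Build R quom
  quom_scaleA quom_scale1 quom_scaleDr quom_scaleDl.

Lemma pim_linear : linear pim.
Proof. by move=> a x y; rewrite pimD pimZ. Qed.
HB.instance Definition _ := GRing.isLinear.Build R V quom *:%R pim pim_linear.

End Submodules.

Section InducedMaps.
Context (R : pzRingType) (V W : lmodType R) (S : submodule V) (T : submodule W).
Context (f : {linear V -> W}).

Lemma subm_map_proof (hf : forall x, S x -> T (f x)) (x : subm S) :
  T (f (val x)).
Proof. by apply: hf; apply/asboolP; exact: (valP x). Qed.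

Definition subm_map (hf : forall x, S x -> T (f x)) (x : subm S) : subm T :=
  Subm (subm_map_proof hf x).

Lemma subm_map_linear hf : linear (subm_map hf).
Proof. by move=> a x y; apply: val_inj; rewrite /= !linearP. Qed.
HB.instance Definition _ hf :=
  GRing.isLinear.Build R (subm S) (subm T) *:%R (subm_map hf) (subm_map_linear hf).

Definition quom_map (hf : forall x, S x -> T (f x)) (q : quom S) : quom T :=
  pim T (f (repr q)).

Lemma quom_mapE hf x : quom_map hf (pim S x) = pim T (f x).
Proof. by apply/pim_eq; rewrite -raddfB; apply: hf; apply/pim_eq; rewrite pim_repr. Qed.

Lemma quom_map_linear hf : linear (quom_map hf).
Proof.
move=> a x y; rewrite -[x]pim_repr -[y]pim_repr.
by rewrite -linearP !quom_mapE !linearP.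
Qed.
HB.instance Definition _ hf :=
  GRing.isLinear.Build R (quom S) (quom T) *:%R (quom_map hf) (quom_map_linear hf).

End InducedMaps.

Section Subquotient.
Context (R : pzRingType) (V : lmodType R) (A B : submodule V).

Definition sm_trace : submodule (subm A).
Proof.
exists (fun x : subm A => B (\val x)); first by rewrite raddf0; exact: sm0.
  by move=> x y hx hy; rewrite raddfD; apply: smD.
by move=> a x hx; rewrite linearZ; apply: smZ.
Defined.

Definition subquo : lmodType R := quom sm_trace.

End Subquotient.

Section SubquotientMap.
Context (R : pzRingType) (V W : lmodType R).
Context (A B : submodule V) (A' B' : submodule W) (f : {linear V -> W}).
Context (hA : forall x, A x -> A' (f x)) (hB : forall x, B x -> B' (f x)).

Lemma subquo_map_proof (x : subm A) :
  sm_trace A B x -> sm_trace A' B' (subm_map hA x).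
Proof. exact: hB. Qed.

Definition subquo_map : {linear subquo A B -> subquo A' B'} :=
  quom_map subquo_map_proof.

End SubquotientMap.

Definition restr (R S : pzRingType) (h : {rmorphism R -> S}) (V : lmodType S)
  : Type := V.

Section Restriction.
Context (R S : pzRingType) (h : {rmorphism R -> S}) (V : lmodType S).
HB.instance Definition _ := GRing.Zmodule.on (restr h V).

Definition restr_scale (a : R) (v : restr h V) : restr h V := h a *: (v : V).
Lemma restr_scaleA a b v :
  restr_scale a (restr_scale b v) = restr_scale (a * b) v.
Proof. by rewrite /restr_scale scalerA rmorphM. Qed.
Lemma restr_scale1 : left_id 1 restr_scale.
Proof. by move=> v; rewrite /restr_scale rmorph1 scale1r. Qed.
Lemma restr_scaleDr : right_distributive restr_scale +%R.
Proof. by move=> a v w; rewrite /restr_scale scalerDr. Qed.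
Lemma restr_scaleDl v : {morph restr_scale^~ v : a b / a + b}.
Proof. by move=> a b; rewrite /restr_scale rmorphD scalerDl. Qed.
HB.instance Definition _ := GRing.Zmodule_isLmodule.Build R (restr h V)
  restr_scaleA restr_scale1 restr_scaleDr restr_scaleDl.
End Restriction.

Record bimodule (R S : pzRingType) := Bimodule {
  bim_sort :> lmodType R;
  ract : bim_sort -> S -> bim_sort;
  ractDl : forall s, {morph ract^~ s : b b' / b + b'};
  ractDr : forall b, {morph ract b : s s' / s + s'};
  ract1 : forall b, ract b 1 = b;
  ractM : forall b s s', ract b (s * s') = ract (ract b s) s';
  ractZ : forall (a : R) b s, ract (a *: b) s = a *: ract b s }.

Section Tensor.
Context (R S : pzRingType) (B : bimodule R S) (N : lmodType S).

(* Formal sums of the symbols b (x) n, up to the smallest congruence which makes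
   (b, n) |-> b (x) n biadditive and balanced. *)
Inductive tens_rel : seq (B * N) -> seq (B * N) -> Prop :=
| tens_refl s : tens_rel s s
| tens_sym s u : tens_rel s u -> tens_rel u s
| tens_trans s u w : tens_rel s u -> tens_rel u w -> tens_rel s w
| tens_cat s s' u u' :
    tens_rel s s' -> tens_rel u u' -> tens_rel (s ++ u) (s' ++ u')
| tens_comm s u : tens_rel (s ++ u) (u ++ s)
| tens_zero n : tens_rel [:: (0, n)] [::]
| tens_addl b b' n : tens_rel [:: (b + b', n)] [:: (b, n); (b', n)]
| tens_addr b n n' : tens_rel [:: (b, n + n')] [:: (b, n); (b, n')]
| tens_bal b a n : tens_rel [:: (ract b a, n)] [:: (b, a *: n)].

Definition tens_relb (s u : seq (B * N)) : bool := `[< tens_rel s u >].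

Lemma tens_rel_equiv : equiv_class_of tens_relb.
Proof.
split=> [s|s u|u s w].
- by apply/asboolP; exact: tens_refl.
- by apply/asboolP/asboolP => h; exact: tens_sym.
- by move=> /asboolP h /asboolP h'; apply/asboolP; exact: tens_trans h'.
Qed.
Canonical tens_equiv := EquivRelPack tens_rel_equiv.
Canonical tens_encModRel := defaultEncModRel tens_relb.

Definition tens := {eq_quot tens_relb}.
HB.instance Definition _ : EqQuotient _ tens_relb tens := EqQuotient.on tens.
HB.instance Definition _ := Choice.on tens.

Definition tens_pi (s : seq (B * N)) : tens := \pi_tens s.
Definition tmk (b : B) (n : N) : tens := tens_pi [:: (b, n)].

Lemma tens_piE s u : tens_pi s = tens_pi u <-> tens_rel s u.
Proof.
split=> [/eqP|h]; last apply/eqP.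
  by rewrite /tens_pi eqmodE => /asboolP.
by rewrite /tens_pi eqmodE; apply/asboolP.
Qed.
Lemma tens_repr q : tens_pi (repr q) = q.
Proof. exact: reprK. Qed.
Lemma tens_reprK s : tens_rel (repr (tens_pi s)) s.
Proof. by apply/tens_piE; rewrite tens_repr. Qed.

Definition tens_add (q q' : tens) := tens_pi (repr q ++ repr q').
Definition negs (s : seq (B * N)) := [seq (- x.1, x.2) | x <- s].
Definition tens_opp (q : tens) := tens_pi (negs (repr q)).

Lemma tens_pi_cat s u : tens_pi (s ++ u) = tens_add (tens_pi s) (tens_pi u).
Proof.
by apply/tens_piE/tens_sym; apply: tens_cat; exact: tens_reprK.
Qed.

Lemma tens_addA : associative tens_add.
Proof.
move=> x y z; rewrite -[x]tens_repr -[y]tens_repr -[z]tens_repr.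
by rewrite -!tens_pi_cat catA.
Qed.
Lemma tens_addC : commutative tens_add.
Proof. by move=> x y; apply/tens_piE; exact: tens_comm. Qed.
Lemma tens_add0 : left_id (tens_pi [::]) tens_add.
Proof. by move=> x; rewrite -[x]tens_repr -tens_pi_cat. Qed.

Lemma negs_rel s : tens_rel (negs s ++ s) [::].
Proof.
apply/tens_piE; elim: s => [//|[b n] s IH].
rewrite (_ : negs _ ++ _ = [:: (- b, n)] ++ negs s ++ [:: (b, n)] ++ s) //.
rewrite !tens_pi_cat (tens_addC (tens_pi (negs s))) -(tens_addA (tens_pi [:: (b, n)])).
rewrite (tens_addC (tens_pi s)) -(tens_pi_cat (negs s)) IH.
rewrite -!tens_pi_cat cats0; apply/tens_piE.
by apply: tens_trans (tens_sym (tens_addl _ _ _)) _; rewrite addNr; exact: tens_zero.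
Qed.

Lemma tens_addN : left_inverse (tens_pi [::]) tens_opp tens_add.
Proof.
move=> x; rewrite /tens_opp -[X in tens_add _ X]tens_repr -tens_pi_cat.
by apply/tens_piE; exact: negs_rel.
Qed.

HB.instance Definition _ :=
  GRing.isZmodule.Build tens tens_addA tens_addC tens_add0 tens_addN.

Lemma tens_piD s u : tens_pi (s ++ u) = tens_pi s + tens_pi u.
Proof. exact: tens_pi_cat. Qed.
Lemma tens_pi_sum s : tens_pi s = \sum_(x <- s) tmk x.1 x.2.
Proof.
elim: s => [|[b n] s IH]; first by rewrite big_nil.
by rewrite big_cons -IH -tens_piD.
Qed.

Definition tscal (a : R) (s : seq (B * N)) := [seq (a *: x.1, x.2) | x <- s].
Lemma tscal_rel a s u : tens_rel s u -> tens_rel (tscal a s) (tscal a u).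
Proof.
elim=> {s u} [s|s u _|s u w _ h1 _ h2|s s' u u' _ h1 _ h2|s u|n|b b' n|b n n'|b c n].
- exact: tens_refl.
- exact: tens_sym.
- exact: tens_trans h2.
- by rewrite /tscal !map_cat; exact: tens_cat.
- by rewrite /tscal !map_cat; exact: tens_comm.
- by rewrite /tscal /= scaler0; exact: tens_zero.
- by rewrite /tscal /= scalerDr; exact: tens_addl.
- by rewrite /tscal /=; exact: tens_addr.
- by rewrite /tscal /= -ractZ; exact: tens_bal.
Qed.

Definition tens_scale (a : R) (q : tens) : tens := tens_pi (tscal a (repr q)).
Lemma tens_scale_pi a s : tens_scale a (tens_pi s) = tens_pi (tscal a s).
Proof. by apply/tens_piE/tscal_rel/tens_reprK. Qed.

Lemma tens_scaleA a b q : tens_scale a (tens_scale b q) = tens_scale (a * b) q.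
Proof.
rewrite -[q]tens_repr !tens_scale_pi /tscal -map_comp; congr tens_pi.
by apply: eq_map => x /=; rewrite scalerA.
Qed.
Lemma tens_scale1 : left_id 1 tens_scale.
Proof.
move=> q; rewrite -[q]tens_repr tens_scale_pi; congr tens_pi.
by rewrite -[RHS]map_id; apply: eq_map => -[b n] /=; rewrite scale1r.
Qed.
Lemma tens_scaleDr : right_distributive tens_scale +%R.
Proof.
move=> a x y; rewrite -[x]tens_repr -[y]tens_repr -tens_piD !tens_scale_pi.
by rewrite /tscal map_cat tens_piD.
Qed.
Lemma tens_scaleDl q : {morph tens_scale^~ q : a b / a + b}.
Proof.
move=> a b; rewrite -[q]tens_repr; elim: (repr q) => [|[c n] s IH].
  by rewrite !tens_scale_pi /= -tens_piD.
rewrite -cat1s tens_piD !tens_scaleDr IH addrACA; congr (_ + _).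
rewrite !tens_scale_pi -tens_piD; apply/tens_piE.
by rewrite /tscal /= scalerDl; exact: tens_addl.
Qed.
HB.instance Definition _ := GRing.Zmodule_isLmodule.Build R tens
  tens_scaleA tens_scale1 tens_scaleDr tens_scaleDl.

Lemma tens_piZ a s : a *: tens_pi s = tens_pi (tscal a s).
Proof. exact: tens_scale_pi. Qed.

End Tensor.

Section TensorMap.
Context (R S : pzRingType) (B : bimodule R S) (N N' : lmodType S).
Context (f : {linear N -> N'}).

Definition tmaps (s : seq (B * N)) : seq (B * N') := [seq (x.1, f x.2) | x <- s].
Lemma tmaps_rel s u : tens_rel s u -> tens_rel (tmaps s) (tmaps u).
Proof.
elim=> {s u} [s|s u _|s u w _ h1 _ h2|s s' u u' _ h1 _ h2|s u|n|b b' n|b n n'|b c n].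
- exact: tens_refl.
- exact: tens_sym.
- exact: tens_trans h2.
- by rewrite /tmaps !map_cat; exact: tens_cat.
- by rewrite /tmaps !map_cat; exact: tens_comm.
- exact: tens_zero.
- exact: tens_addl.
- by rewrite /tmaps /= raddfD; exact: tens_addr.
- by rewrite /tmaps /= linearZ; exact: tens_bal.
Qed.

Definition tens_map (q : tens B N) : tens B N' := tens_pi (tmaps (repr q)).
Lemma tens_map_pi s : tens_map (tens_pi s) = tens_pi (tmaps s).
Proof. by apply/tens_piE/tmaps_rel/tens_reprK. Qed.

Lemma tens_map_linear : linear tens_map.
Proof.
move=> a x y; rewrite -[x]tens_repr -[y]tens_repr.
rewrite tens_piZ -tens_piD !tens_map_pi tens_piZ -tens_piD.
by congr tens_pi; rewrite /tmaps /tscal map_cat -!map_comp.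
Qed.
HB.instance Definition _ :=
  GRing.isLinear.Build R (tens B N) (tens B N') *:%R tens_map tens_map_linear.
End TensorMap.
Arguments tens_map {R S} B {N N'} f q.

Section RingBimodule.
Context (R S : pzRingType) (h : {rmorphism R -> S}).
Definition ring_bimodule : bimodule S R.
Proof.
exists (S^o : lmodType S) (fun b a => b * h a).
- by move=> a b b'; rewrite mulrDl.
- by move=> b a a'; rewrite rmorphD mulrDr.
- by move=> b; rewrite rmorph1 mulr1.
- by move=> b a a'; rewrite rmorphM mulrA.
- by move=> a b c; rewrite /GRing.scale /= mulrA.
Defined.
End RingBimodule.

(* The degree k + 1, by cases: dsucc (Negz n.+1) reduces to Negz n, whereas
   Negz n.+1 + 1 does not. *)
Definition dsucc (k : int) : int :=
  match k with Posz n => Posz n.+1 | Negz 0 => 0 | Negz n.+1 => Negz n end.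

Lemma dsuccE k : dsucc k = k + 1.
Proof.
case: k => [n|[|n]] //=; first by rewrite -PoszD addn1.
by rewrite !NegzE -[n.+2]addn1 PoszD opprD addrNK.
Qed.

Record complex (R : pzRingType) := Complex {
  cterm :> int -> lmodType R;
  cdiff : forall k, {linear cterm k -> cterm (dsucc k)};
  cdiffK : forall k x, cdiff (dsucc k) (cdiff k x) = 0 }.

Record cmap (R : pzRingType) (C C' : complex R) := CMap {
  cmapf : forall k, {linear C k -> C' k};
  cmapE : forall k x, cmapf (dsucc k) (cdiff C k x) = cdiff C' k (cmapf k x) }.

Section Complexes.
Context (R : pzRingType).
Implicit Types C : complex R.

Definition is_cycle C k (x : C k) : Prop := cdiff C k x = 0.

(* is_boundary C k is the image of the differential arriving in C k *)
Inductive is_boundary C : forall k, C k -> Prop :=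
| IsBoundary j (y : C j) : is_boundary (cdiff C j y).

(* f induces bijections on the cohomology groups cycles / boundaries. *)
Definition quasi_iso C C' (f : cmap C C') : Prop := forall k,
  (forall x, is_cycle x -> is_boundary (cmapf f k x) -> is_boundary x) /\
  (forall y : C' k, is_cycle y ->
     exists2 x, is_cycle x & is_boundary (y - cmapf f k x)).

Definition bounded_above C : Prop :=
  exists N : int, forall k, N <= k -> forall x : C k, x = 0.

(* Isomorphism in D^-(Mod R), the localization of the category of bounded above
   complexes at the quasi-isomorphisms: two complexes are isomorphic there if
   and only if they are joined by a zigzag of quasi-isomorphisms. *)
Inductive Dminus_iso : complex R -> complex R -> Prop :=
| Diso_refl C : bounded_above C -> Dminus_iso C C
| Diso_qis C C' (f : cmap C C') :
    bounded_above C -> bounded_above C' -> quasi_iso f -> Dminus_iso C C'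
| Diso_sym C C' : Dminus_iso C C' -> Dminus_iso C' C
| Diso_trans C C' C'' :
    Dminus_iso C C' -> Dminus_iso C' C'' -> Dminus_iso C C''.

Definition projective (P : lmodType R) : Prop :=
  forall (U V : lmodType R) (g : {linear U -> V}) (f : {linear P -> V}),
  (forall v, exists u, g u = v) ->
  exists h : {linear P -> U}, forall x, g (h x) = f x.

Definition projective_resolution (M : lmodType R) C (eps : {linear C 0 -> M}) :
  Prop :=
  [/\ forall k, projective (C k),
      forall k : int, 0 < k -> forall x : C k, x = 0,
      forall k : int, k < 0 -> forall x : C k, is_cycle x -> is_boundary x,
      forall x : C 0, eps x = 0 <-> is_boundary x
    & forall y, exists x, eps x = y].

End Complexes.

Section ZeroComplex.
Context (R : pzRingType).
Definition zero_module : lmodType R := 'rV[R]_0.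
Definition zero_complex : complex R :=
  @Complex R (fun=> zero_module) (fun=> \0) (fun _ _ => erefl).
End ZeroComplex.

(* A chain complex ... -> T 1 -> T 0 -> 0, with T j placed in degree - j. *)
Section ChainComplex.
Context (R : pzRingType) (T : nat -> lmodType R).
Context (f : forall j, {linear T j.+1 -> T j}).
Context (fK : forall j x, f j (f j.+1 x) = 0).

Definition chain_term (k : int) : lmodType R :=
  match k with
  | Posz 0 => T 0 | Posz _.+1 => zero_module R | Negz j => T j.+1
  end.

Definition chain_diff (k : int) : {linear chain_term k -> chain_term (dsucc k)} :=
  match k with
  | Posz 0 => \0 : {linear T 0 -> zero_module R}
  | Posz _.+1 => \0 : {linear zero_module R -> zero_module R}
  | Negz 0 => f 0
  | Negz j.+1 => f j.+1
  end.

Lemma chain_diffK k x : chain_diff (dsucc k) (chain_diff k x) = 0.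
Proof. by case: k x => [[|n]|[|[|n]]] x //=; rewrite ?fK. Qed.

Definition chain_complex : complex R := Complex chain_diffK.
End ChainComplex.

Section TensorComplex.
Context (R S : pzRingType) (B : bimodule R S) (C : complex S).

Lemma tens_complexK k (x : tens B (C k)) :
  tens_map B (cdiff C (dsucc k)) (tens_map B (cdiff C k) x) = 0.
Proof.
rewrite -[x]tens_repr !tens_map_pi /tmaps -map_comp.
elim: (repr x) => [//|[b n] s IH]; rewrite /= -cat1s tens_piD IH addr0 cdiffK.
apply/(tens_piE [:: (b, _)] [::]).
rewrite -(scale0r 0); apply: tens_trans (tens_sym (tens_bal b 0 0)) _.
have -> : ract b 0 = 0.
  by apply: (addrI (ract b 0)); rewrite -ractDr !addr0.
exact: tens_zero.
Qed.

Definition tens_complex : complex R :=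
  @Complex R (fun k => tens B (C k)) (fun k => tens_map B (cdiff C k))
    tens_complexK.
End TensorComplex.

(* Quotient of C by the subcomplex which is C in degrees < l, Im d^{l-1} in
   degree l, and 0 in degrees > l. *)
Section Truncation.
Context (R : pzRingType) (l : int) (C : complex R).

Lemma is_boundary0 k : is_boundary (0 : C k).
Proof.
have [j ->] : exists j, k = dsucc j by exists (k - 1); rewrite dsuccE subrK.
by rewrite -(raddf0 (cdiff C j)).
Qed.

Lemma is_boundaryP k (x : C k) : is_boundary x <->
  forall j (e : dsucc j = k), exists y, ecast k (C k) e (cdiff C j y) = x.
Proof.
split=> [[j y] i e|h].
  have eij : i = j by move: e; rewrite !dsuccE => /addIr.
  by subst i; exists y; rewrite (eq_irrelevance e erefl).
have e : dsucc (k - 1) = k by rewrite dsuccE subrK.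
have [y <-] := h _ e; move: (k - 1) e y {h} => j e y.
by case: k / e {x}.
Qed.

Lemma is_boundary_lin k a (x y : C k) :
  is_boundary x -> is_boundary y -> is_boundary (a *: x + y).
Proof.
move=> /is_boundaryP hx /is_boundaryP hy; apply/is_boundaryP => j e.
have [u <-] := hx j e; have [v <-] := hy j e; exists (a *: u + v).
by clear; case: k / e; rewrite linearP.
Qed.

Definition trunc_sub (k : int) : submodule (C k).
Proof.
exists (fun x : C k => [\/ k < l, k = l /\ is_boundary x | x = 0]).
- exact: Or33.
- move=> x y [|[kl hx]|->]; [by move=> *; apply: Or31| |by rewrite add0r].
  case=> [|[_ hy]|->]; [by move=> *; apply: Or31| |by rewrite addr0; apply: Or32].
  by apply: Or32; split=> //; rewrite -[x]scale1r; exact: is_boundary_lin.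
- move=> a x [|[kl hx]|->]; [by move=> *; apply: Or31| |by rewrite scaler0; apply: Or33].
  apply: Or32; split=> //; rewrite -[_ *: _]addr0.
  by apply: is_boundary_lin => //; exact: is_boundary0.
Defined.

Lemma trunc_subE k (x : C k) : trunc_sub k x ->
  trunc_sub (dsucc k) (cdiff C k x).
Proof.
case=> [kl|[kl h]|->]; last by rewrite raddf0; apply: Or33.
- have: dsucc k <= l by rewrite dsuccE lezD1.
  rewrite le_eqVlt => /predU1P[e|]; last exact: Or31.
  by apply: Or32; split.
- by case: h {kl} => j y; apply: Or33; rewrite cdiffK.
Qed.

Definition trunc_diff k : {linear quom (trunc_sub k) -> quom (trunc_sub (dsucc k))} :=
  quom_map (@trunc_subE k).

Lemma trunc_diffK k x : trunc_diff (dsucc k) (trunc_diff k x) = 0.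
Proof.
by rewrite -[x]pim_repr /trunc_diff /= !quom_mapE cdiffK raddf0.
Qed.

Definition trunc_ge : complex R := Complex trunc_diffK.
End Truncation.

Record endo (V : zmodType) := Endo {
  endo_fun :> V -> V;
  endo_additive : zmod_morphism endo_fun }.

Section EndoRing.
Context (V : zmodType).
Implicit Types f g h : endo V.

HB.instance Definition _ := gen_eqMixin (endo V).
HB.instance Definition _ := gen_choiceMixin (endo V).

Lemma endo_eq f g : f =1 g -> f = g.
Proof.
case: f g => [f hf] [g hg] /= /funext fg; move: hf hg; rewrite fg => hf hg.
by rewrite (Prop_irrelevance hf hg).
Qed.

HB.instance Definition _ f := GRing.isZmodMorphism.Build V V f (@endo_additive V f).

Definition endo0 : endo V := @Endo V (fun=> 0) (fun x y => esym (subr0 0)).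
Definition endo1 : endo V := @Endo V id (fun x y => erefl).
Lemma endo_opp_proof f : zmod_morphism (fun x => - f x).
Proof. by move=> x y /=; rewrite raddfB opprD. Qed.
Definition endo_opp f := Endo (endo_opp_proof f).
Lemma endo_add_proof f g : zmod_morphism (fun x => f x + g x).
Proof. by move=> x y /=; rewrite !raddfB opprD addrACA. Qed.
Definition endo_add f g := Endo (endo_add_proof f g).
Lemma endo_mul_proof f g : zmod_morphism (fun x => f (g x)).
Proof. by move=> x y /=; rewrite !raddfB. Qed.
Definition endo_mul f g := Endo (endo_mul_proof f g).

Lemma endo_addA : associative endo_add.
Proof. by move=> f g h; apply: endo_eq => x /=; rewrite addrA. Qed.
Lemma endo_addC : commutative endo_add.
Proof. by move=> f g; apply: endo_eq => x /=; rewrite addrC. Qed.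
Lemma endo_add0 : left_id endo0 endo_add.
Proof. by move=> f; apply: endo_eq => x /=; rewrite add0r. Qed.
Lemma endo_addN : left_inverse endo0 endo_opp endo_add.
Proof. by move=> f; apply: endo_eq => x /=; rewrite addNr. Qed.
HB.instance Definition _ :=
  GRing.isZmodule.Build (endo V) endo_addA endo_addC endo_add0 endo_addN.

Lemma endo_mulA : associative endo_mul.
Proof. by move=> f g h; apply: endo_eq. Qed.
Lemma endo_mul1 : left_id endo1 endo_mul.
Proof. by move=> f; apply: endo_eq. Qed.
Lemma endo_mulr1 : right_id endo1 endo_mul.
Proof. by move=> f; apply: endo_eq. Qed.
Lemma endo_mulDl : left_distributive endo_mul +%R.
Proof. by move=> f g h; apply: endo_eq. Qed.
Lemma endo_mulDr : right_distributive endo_mul +%R.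
Proof. by move=> f g h; apply: endo_eq => x /=; rewrite raddfD. Qed.
HB.instance Definition _ := GRing.Zmodule_isPzRing.Build (endo V)
  endo_mulA endo_mul1 endo_mulr1 endo_mulDl endo_mulDr.

Lemma endoME f g x : (f * g) x = f (g x). Proof. by []. Qed.
Lemma endoDE f g x : (f + g) x = f x + g x. Proof. by []. Qed.
Lemma endoBE f g x : (f - g) x = f x - g x. Proof. by []. Qed.
End EndoRing.

Section GeneratedSubring.
Context (R : pzRingType).

Inductive generated (G : R -> Prop) : R -> Prop :=
| gen_in x : G x -> generated G x
| gen_1 : generated G 1
| gen_B x y : generated G x -> generated G y -> generated G (x - y)
| gen_M x y : generated G x -> generated G y -> generated G (x * y).

Definition genb (G : R -> Prop) : {pred R} := fun x => `[< generated G x >].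

Lemma genb_closed G : subring_closed (genb G).
Proof.
split; first by apply/asboolP; exact: gen_1.
  by move=> x y /asboolP hx /asboolP hy; apply/asboolP; exact: gen_B.
by move=> x y /asboolP hx /asboolP hy; apply/asboolP; exact: gen_M.
Qed.
HB.instance Definition _ G := GRing.isSubringClosed.Build R (genb G) (genb_closed G).

Definition subring_gen (G : R -> Prop) := {x : R | x \in genb G}.
HB.instance Definition _ G := SubChoice.on (subring_gen G).
HB.instance Definition _ G := GRing.SubChoice_isSubPzRing.Build R (genb G)
  (subring_gen G) (genb_closed G).

Definition Gen G (x : R) (h : G x) : subring_gen G :=
  exist _ x (asboolT (gen_in h)).

Lemma subring_genP G (x : subring_gen G) : generated G (val x).
Proof. exact/asboolP/(valP x). Qed.

Section Inclusion.
Context (G G' : R -> Prop) (sub : forall x, G x -> G' x).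

Lemma generatedS x : generated G x -> generated G' x.
Proof.
by elim=> [*|*|*|*]; [apply/gen_in/sub|exact: gen_1|exact: gen_B|exact: gen_M].
Qed.

Definition gen_incl (x : subring_gen G) : subring_gen G' :=
  exist _ (val x) (asboolT (generatedS (subring_genP x))).

Lemma gen_incl_zmod_morphism : zmod_morphism gen_incl.
Proof. by move=> x y; apply: val_inj. Qed.
Lemma gen_incl_monoid_morphism : monoid_morphism gen_incl.
Proof. by split=> [|x y]; apply: val_inj. Qed.
HB.instance Definition _ := GRing.isZmodMorphism.Build
  (subring_gen G) (subring_gen G') gen_incl gen_incl_zmod_morphism.
HB.instance Definition _ := GRing.isMonoidMorphism.Build
  (subring_gen G) (subring_gen G') gen_incl gen_incl_monoid_morphism.
End Inclusion.
End GeneratedSubring.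

Section QuotientRule.
Context (F : fieldType).
Implicit Types p q n d : F.

Definition qrule p q p' q' : F := (p' * q - p * q') / q ^+ 2.

Lemma qrule_eq p q n d p' q' n' d' : q != 0 -> d != 0 -> p * d = n * q ->
  p' * d + p * d' = n' * q + n * q' -> qrule n d n' d' = qrule p q p' q'.
Proof.
move=> q0 d0 e e'.
have -> : n' = (p' * d + p * d' - n * q') / q by rewrite e' addrK mulfK.
have -> : n = p * d / q by rewrite e mulfK.
by rewrite /qrule; field; rewrite q0 d0.
Qed.

Lemma subf_div p q n d : q != 0 -> d != 0 ->
  p / q - n / d = (p * d - n * q) / (q * d).
Proof. by move=> q0 d0; field; rewrite q0 d0. Qed.

Lemma qruleB p q n d p' q' n' d' : q != 0 -> d != 0 ->
  qrule (p * d - n * q) (q * d)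
    (p' * d + p * d' - (n' * q + n * q')) (q' * d + q * d') =
  qrule p q p' q' - qrule n d n' d'.
Proof. by move=> q0 d0; rewrite /qrule; field; rewrite q0 d0. Qed.

Lemma qruleM p q n d p' q' n' d' : q != 0 -> d != 0 ->
  qrule (p * n) (q * d) (p' * n + p * n') (q' * d + q * d') =
  qrule p q p' q' * (n / d) + p / q * qrule n d n' d'.
Proof. by move=> q0 d0; rewrite /qrule; field; rewrite q0 d0. Qed.
End QuotientRule.

Section RationalDerivation.
Context (K : fieldType) (N : nat).
Local Notation Q := {fraction {mpoly K[N]}}.
Local Notation "p %:F" := (@FracField.tofrac {mpoly K[N]} p).

Definition fderiv (i : 'I_N) (a : Q) : Q :=
  let p := \n_(repr a) in let q := \d_(repr a) in
  qrule p%:F q%:F (mderiv i p)%:F (mderiv i q)%:F.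

Lemma fracE (a : Q) : a = (\n_(repr a))%:F / (\d_(repr a))%:F.
Proof.
have dn0 : (\d_(repr a))%:F != 0 by rewrite tofrac_eq0 denom_ratioP.
apply: (mulIf dn0); rewrite divfK //.
rewrite -{1}[a]reprK; unlock FracField.tofrac.
rewrite -[LHS]FracField.pi_mul; apply/eqmodP.
rewrite /= FracField.equivfE /FracField.mulf !numden_Ratio ?oner_neq0 //.
  by rewrite !mulr1 mulrC.
all: by rewrite mulr1 denom_ratioP.
Qed.

Lemma tofrac_neq0 (q : {mpoly K[N]}) : q != 0 -> q%:F != 0.
Proof. by rewrite tofrac_eq0. Qed.

Lemma fderiv_frac i p q : q != 0 ->
  fderiv i (p%:F / q%:F) = qrule p%:F q%:F (mderiv i p)%:F (mderiv i q)%:F.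
Proof.
move=> q0; rewrite /fderiv; set a := p%:F / q%:F.
move: (fracE a).
move: \n_(repr a) \d_(repr a) (denom_ratioP (repr a)) => n d d0 E.
have q0F := tofrac_neq0 q0; have d0F := tofrac_neq0 d0.
have e : p * d = n * q.
  apply/eqP; rewrite -tofrac_eq (tofracM p d) (tofracM n q); apply/eqP.
  by apply/eqP; rewrite -(eqr_div _ _ q0F d0F); apply/eqP.
apply: (qrule_eq q0F d0F).
  by rewrite -(tofracM p d) e tofracM.
rewrite -(tofracM _ d) -(tofracM p) -(tofracM _ q) -(tofracM n).
by rewrite -[LHS]tofracD -[RHS]tofracD -!mderivM e.
Qed.

Lemma fderiv_additive i : zmod_morphism (fderiv i).
Proof.
move=> a b; rewrite (fracE a) (fracE b).
move: \n_(repr a) \d_(repr a) (denom_ratioP (repr a)) => p q q0.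
move: \n_(repr b) \d_(repr b) (denom_ratioP (repr b)) => r s s0.
have q0F := tofrac_neq0 q0; have s0F := tofrac_neq0 s0.
rewrite (subf_div _ _ q0F s0F) -(tofracM p s) -(tofracM r q) -(tofracM q s).
rewrite -(tofracB (p * s)) (fderiv_frac _ _ (mulf_neq0 q0 s0)).
rewrite (fderiv_frac _ _ q0) (fderiv_frac _ _ s0) -(qruleB _ _ _ _ _ _ q0F s0F).
rewrite mderivB !mderivM !tofracB !tofracD.
by rewrite !(tofracM p, tofracM r, tofracM q, tofracM _ s, tofracM _ q).
Qed.

Lemma fderivM i a b : fderiv i (a * b) = fderiv i a * b + a * fderiv i b.
Proof.
rewrite (fracE a) (fracE b).
move: \n_(repr a) \d_(repr a) (denom_ratioP (repr a)) => p q q0.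
move: \n_(repr b) \d_(repr b) (denom_ratioP (repr b)) => r s s0.
have q0F := tofrac_neq0 q0; have s0F := tofrac_neq0 s0.
rewrite mulf_div -(tofracM p r) -(tofracM q s) (fderiv_frac _ _ (mulf_neq0 q0 s0)).
rewrite (fderiv_frac _ _ q0) (fderiv_frac _ _ s0) -(qruleM _ _ _ _ _ _ q0F s0F).
rewrite !mderivM !tofracD.
by rewrite !(tofracM p, tofracM q, tofracM _ r, tofracM _ s).
Qed.

Lemma fderiv_tofrac i p : fderiv i p%:F = (mderiv i p)%:F.
Proof.
have := @fderiv_frac i p 1 (oner_neq0 _).
rewrite tofrac1 divr1 => ->.
by rewrite /qrule -mpolyC1 mderivC tofrac0 mulr0 subr0 mulr1 expr1n divr1.
Qed.

Lemma mulop_additive (a : Q) : zmod_morphism (fun x => a * x).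
Proof. by move=> x y; rewrite mulrBr. Qed.

Definition mulop (a : Q) : endo Q := Endo (mulop_additive a).
Definition derop (i : 'I_N) : endo Q := Endo (fderiv_additive i).

End RationalDerivation.

Section WeylAlgebras.
Context (K : fieldType) (n d : nat).
Local Notation Kx := {mpoly K[n]}.
Local Notation Kxt := {mpoly K[n + d]}.
Local Notation Q := {fraction Kxt}.
Local Notation "f %:F" := (@FracField.tofrac _ f).

Definition x_incl (f : Kx) : Kxt := f \mPo [tuple 'X_(lshift d i) | i < n].

Definition Dxt_gen (T : endo Q) : Prop :=
  (exists f : Kxt, T = mulop f%:F) \/ (exists i : 'I_(n + d), T = derop K i).

Definition Dx_gen (T : endo Q) : Prop :=
  (exists f : Kx, T = mulop (x_incl f)%:F) \/
  (exists i : 'I_n, T = derop K (lshift d i)).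

Definition Dxp_gen (p : prime_idealr Kx) (T : endo Q) : Prop :=
  (exists f g : Kx, g \notin p /\ T = mulop ((x_incl f)%:F / (x_incl g)%:F)) \/
  (exists i : 'I_n, T = derop K (lshift d i)).

(* The rings Dxt = D_{n+d}, Dx = D_n and Dxp p = K[x]_p (x)_{K[x]} D_n (the
   differential operators with coefficients in the local ring K[x]_p) are
   realized as rings of operators on the field K(x,t), on which they act
   faithfully in characteristic zero; Dx is then literally contained in the two
   others. *)
Definition Dxt : pzRingType := subring_gen Dxt_gen.
Definition Dx : pzRingType := subring_gen Dx_gen.
Definition Dxp (p : prime_idealr Kx) : pzRingType := subring_gen (Dxp_gen p).

Lemma Dx_gen_Dxt T : Dx_gen T -> Dxt_gen T.
Proof. by case=> [[f ->]|[i ->]]; [left; eexists|right; eexists]. Qed.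

Lemma Dx_gen_Dxp p T : Dx_gen T -> Dxp_gen p T.
Proof.
case=> [[f ->]|[i ->]]; [left|by right; eexists].
exists f, 1; split; first by rewrite idealr1.
by rewrite /x_incl rmorph1 tofrac1 divr1.
Qed.

Definition Dx_Dxt : {rmorphism Dx -> Dxt} := gen_incl Dx_gen_Dxt.
Definition Dx_Dxp p : {rmorphism Dx -> Dxp p} := gen_incl (@Dx_gen_Dxp p).

Lemma polyop_subproof f : Dxt_gen (mulop f%:F).
Proof. by left; exists f. Qed.
Lemma partial_subproof i : Dxt_gen (derop K i).
Proof. by right; exists i. Qed.
Definition polyop (f : Kxt) : Dxt := Gen (polyop_subproof f).
Definition partial (i : 'I_(n + d)) : Dxt := Gen (partial_subproof i).

Definition tvar (i : 'I_d) : Kxt := 'X_(rshift n i).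
Definition t_op (i : 'I_d) : Dxt := polyop (tvar i).
Definition theta : Dxt := \sum_(i < d) t_op i * partial (rshift n i).

(* <t_1, ..., t_d>^m, by <t>^(m + 1) = \sum_i t_i <t>^m *)
Fixpoint t_pow (m : nat) (f : Kxt) : Prop :=
  if m is m'.+1 then
    exists2 g : 'I_d -> Kxt,
      forall i, t_pow m' (g i) & f = \sum_(i < d) tvar i * g i
  else True.

Definition t_powz (j : int) (f : Kxt) : Prop :=
  if j is Posz m then t_pow m f else True.

Definition inV (i : int) (P : Dxt) : Prop :=
  forall (j : int) (f : Kxt), t_powz j f ->
  exists2 g : Kxt, t_powz (j - i) g & val P f%:F = g%:F.

Definition inVr r (m : 'I_r -> int) (k : int) (v : 'rV[Dxt]_r) : Prop :=
  forall i, inV (k - m i) (v 0 i).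

Lemma t_pow0 m : t_pow m 0.
Proof.
elim: m => [//|m IH]; exists (fun=> 0) => //.
by rewrite big1 // => i _; rewrite mulr0.
Qed.
Lemma t_powB m f g : t_pow m f -> t_pow m g -> t_pow m (f - g).
Proof.
elim: m f g => [//|m IH] f g [f1 h1 ->] [g1 h2 ->].
exists (fun i => f1 i - g1 i); first by move=> i; exact: IH (h1 i) (h2 i).
by rewrite -sumrB; apply: eq_bigr => i _; rewrite mulrBr.
Qed.
Lemma t_powM m h f : t_pow m f -> t_pow m (h * f).
Proof.
elim: m f => [//|m IH] f [g hg ->]; exists (fun i => h * g i).
  by move=> i; exact: IH (hg i).
by rewrite mulr_sumr; apply: eq_bigr => i _; rewrite mulrCA.
Qed.
Lemma mderiv_tvar (i : 'I_n) (j : 'I_d) : mderiv (lshift d i) (tvar j) = 0.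
Proof.
rewrite /tvar mderivX mnm1E; case: eqP => [e|_]; last by rewrite scale0r.
by have := ltn_ord i; move/(congr1 val): e => /= <-; rewrite ltnNge leq_addr.
Qed.
Lemma t_pow_deriv m (i : 'I_n) f : t_pow m f -> t_pow m (mderiv (lshift d i) f).
Proof.
elim: m f => [//|m IH] f [g hg ->].
exists (fun j => mderiv (lshift d i) (g j)); first by move=> j; exact: IH (hg j).
rewrite raddf_sum; apply: eq_bigr => j _ /=.
by rewrite mderivM mderiv_tvar mul0r add0r.
Qed.

Lemma t_powz0 j : t_powz j 0. Proof. by case: j => // m; exact: t_pow0. Qed.
Lemma t_powzB j f g : t_powz j f -> t_powz j g -> t_powz j (f - g).
Proof. by case: j => // m; exact: t_powB. Qed.
Lemma t_powzD j f g : t_powz j f -> t_powz j g -> t_powz j (f + g).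
Proof.
move=> hf hg; rewrite -[g]opprK -[- g]sub0r; apply: t_powzB => //.
by apply: t_powzB => //; exact: t_powz0.
Qed.

Lemma Dx_t_powz (T : endo Q) j f : generated Dx_gen T -> t_powz j f ->
  exists2 g, t_powz j g & T f%:F = g%:F.
Proof.
move=> hT; elim: hT f => {T} [T [[h ->]|[i ->]]||S T _ IS _ IT|S T _ IS _ IT] f hf.
- exists (x_incl h * f); last by rewrite tofracM.
  by case: j hf => // m; exact: t_powM.
- exists (mderiv (lshift d i) f); last by rewrite -fderiv_tofrac.
  by case: j hf => // m; exact: t_pow_deriv.
- by exists f.
- have [g hg eg] := IS f hf; have [h hh eh] := IT f hf.
  by exists (g - h); [exact: t_powzB|rewrite endoBE eg eh -tofracB].
- by have [g hg eg] := IT f hf; rewrite endoME eg; exact: IS.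
Qed.

Lemma inV0 k : inV k 0.
Proof. by move=> j f _; exists 0; [exact: t_powz0|rewrite tofrac0]. Qed.
Lemma inVD k P P' : inV k P -> inV k P' -> inV k (P + P').
Proof.
move=> hP hP' j f hf; have [g hg eg] := hP j f hf; have [h hh eh] := hP' j f hf.
by exists (g + h); [exact: t_powzD|rewrite raddfD endoDE eg eh -tofracD].
Qed.
Lemma inVZ k (a : Dx) P : inV k P -> inV k (Dx_Dxt a * P).
Proof.
move=> hP j f hf; have [g hg eg] := hP j f hf.
have [h hh eh] := Dx_t_powz (subring_genP a) hg.
by exists h => //; rewrite -eh -eg.
Qed.

Section Indicial.
Context (M : lmodType Dxt) (u : M).

Definition eval_theta (f : {poly Kx}) : Dxt :=
  \sum_(k < size f) polyop (x_incl f`_k) * theta ^+ k.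

(* J_Y(u), where K[s,x] is {poly K[x]} with s the outer variable *)
Definition J_Y (f : {poly Kx}) : Prop :=
  exists2 P : Dxt, inV (-1) P & (eval_theta f + P) *: u = 0.

(* J_Y(u)_p, as a subset of K(x)[s] *)
Definition J_Yp (p : prime_idealr Kx) (b : {poly {fraction Kx}}) : Prop :=
  exists (f : {poly Kx}) (g : Kx),
    [/\ J_Y f, g \notin p & b = (g%:F)^-1 *: map_poly (@FracField.tofrac Kx) f].

Definition indicial_poly (p : prime_idealr Kx) (b : {poly {fraction Kx}}) : Prop :=
  [/\ J_Yp p b, b \is monic
    & forall c, J_Yp p c -> c \is monic -> (size b <= size c)%N].
End Indicial.

(* An element of K[x]_p specializes to 0 in kappa(p) = K[x]_p / p K[x]_p. *)
Definition specializes_to_0 (p : prime_idealr Kx) (a : {fraction Kx}) : Prop :=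
  exists f g : Kx, [/\ f \in p, g \notin p & a = f%:F / g%:F].

Lemma Dx_comm_t (T : endo Q) (i : 'I_d) : generated Dx_gen T ->
  T * mulop (tvar i)%:F = mulop (tvar i)%:F * T.
Proof.
move=> hT; elim: hT => {T} [T [[h ->]|[j ->]]||S T _ IS _ IT|S T _ IS _ IT].
- by apply: endo_eq => a; rewrite !endoME /= mulrCA.
- apply: endo_eq => a; rewrite !endoME /= fderivM fderiv_tofrac mderiv_tvar.
  by rewrite tofrac0 mul0r add0r.
- by rewrite mul1r mulr1.
- by rewrite mulrBl mulrBr IS IT.
- by rewrite -mulrA IT mulrA IS mulrA.
Qed.

Lemma Dx_t_op (a : Dx) i : Dx_Dxt a * t_op i = t_op i * Dx_Dxt a.
Proof. by apply: val_inj; exact: Dx_comm_t (subring_genP a). Qed.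

(* t_1 D_{n+d} + ... + t_d D_{n+d} *)
Definition t_ideal : submodule (restr Dx_Dxt Dxt^o).
Proof.
exists (fun P : Dxt => exists R : 'I_d -> Dxt, P = \sum_(i < d) t_op i * R i).
- by exists (fun=> 0); rewrite big1 // => i _; rewrite mulr0.
- move=> _ _ [R ->] [R' ->]; exists (fun i => R i + R' i).
  by rewrite -big_split; apply: eq_bigr => i _ /=; rewrite mulrDr.
- move=> a _ [R ->]; exists (fun i => Dx_Dxt a * R i).
  transitivity (Dx_Dxt a * \sum_(i < d) t_op i * R i); first by [].
  by rewrite mulr_sumr; apply: eq_bigr => i _; rewrite !mulrA Dx_t_op.
Defined.

Definition DYX_left : lmodType Dx := quom t_ideal.
Definition DYX_class (P : Dxt) : DYX_left := pim t_ideal P.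
Definition DYX_ract (q : DYX_left) (P : Dxt) : DYX_left :=
  DYX_class ((repr (q : quom t_ideal) : Dxt) * P).

Lemma DYX_classE P P' : DYX_class P = DYX_class P' <-> t_ideal (P - P').
Proof. exact: pim_eq. Qed.
Lemma DYX_classD P P' : DYX_class (P + P') = DYX_class P + DYX_class P'.
Proof. exact: pimD. Qed.
Lemma DYX_classZ a P : DYX_class (Dx_Dxt a * P) = a *: DYX_class P.
Proof. exact: pimZ. Qed.
Lemma DYX_class_surj q : exists P, q = DYX_class P.
Proof. by exists (repr (q : quom t_ideal)); rewrite /DYX_class pim_repr. Qed.
Lemma DYX_ractE P P' : DYX_ract (DYX_class P) P' = DYX_class (P * P').
Proof.
apply/DYX_classE; rewrite -mulrBl.
set P0 := repr _; have [R eR] : t_ideal (P0 - P) by apply/pim_eq; rewrite pim_repr.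
exists (fun i => R i * P').
rewrite (_ : (P0 : Dxt) - P = \sum_(i < d) t_op i * R i) //.
by rewrite mulr_suml; apply: eq_bigr => i _; rewrite mulrA.
Qed.

Definition DYX : bimodule Dx Dxt.
Proof.
exists DYX_left DYX_ract.
- move=> s b b'; have [P ->] := DYX_class_surj b; have [P' ->] := DYX_class_surj b'.
  by rewrite -DYX_classD !DYX_ractE -DYX_classD mulrDl.
- move=> b s s'; have [P ->] := DYX_class_surj b.
  by rewrite !DYX_ractE -DYX_classD mulrDr.
- by move=> b; have [P ->] := DYX_class_surj b; rewrite DYX_ractE mulr1.
- move=> b s s'; have [P ->] := DYX_class_surj b.
  by rewrite !DYX_ractE mulrA.
- move=> a b s; have [P ->] := DYX_class_surj b.
  by rewrite -DYX_classZ !DYX_ractE -DYX_classZ mulrA.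
Defined.

Definition DYXr (r : nat) : lmodType Dx := {ffun 'I_r -> DYX}.

(* The filtration of D_{Y -> X}^r induced by V_Y^k[m](D_{n+d}^r). *)
Definition VDYX r (m : 'I_r -> int) (k : int) : submodule (DYXr r).
Proof.
exists (fun q : {ffun 'I_r -> DYX} =>
  exists2 v : 'rV[Dxt]_r, inVr m k v & forall i, q i = DYX_class (v 0 i)).
- by exists 0 => i; rewrite !(mxE, ffunE); [exact: inV0|rewrite /DYX_class raddf0].
- move=> q q' [v hv ev] [v' hv' ev']; exists (v + v') => i; rewrite !(mxE, ffunE).
    exact: inVD.
  by rewrite ev ev' -DYX_classD.
- move=> a q [v hv ev]; exists (Dx_Dxt a *: v) => i; rewrite !(mxE, ffunE).
    exact: inVZ.
  by rewrite ev -DYX_classZ.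
Defined.

Definition sm_bot (R : pzRingType) (V : lmodType R) : submodule V.
Proof.
exists (fun x : V => x = 0) => //; first by move=> x y -> ->; rewrite addr0.
by move=> a x ->; rewrite scaler0.
Defined.

(* The map D_{Y -> X}^r -> D_{Y -> X}^r' induced by psi : D_{n+d}^r -> D_{n+d}^r',
   which is right multiplication by the matrix with rows psi(e_i). *)
Section InducedMap.
Context (r r' : nat) (psi : {linear 'rV[Dxt]_r -> 'rV[Dxt]_r'}).

Definition psibar (q : DYXr r) : DYXr r' :=
  [ffun k => \sum_(i < r) ract (q i) (psi (delta_mx 0 i) 0 k)].

Lemma psibar_linear : linear psibar.
Proof.
move=> a q q'; apply/ffunP => k; rewrite !ffunE scaler_sumr -big_split.
by apply: eq_bigr => i _; rewrite !ffunE ractDl ractZ.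
Qed.
HB.instance Definition _ :=
  GRing.isLinear.Build Dx (DYXr r) (DYXr r') *:%R psibar psibar_linear.

Lemma psibar_class (v : 'rV[Dxt]_r) (q : DYXr r) :
  (forall i, q i = DYX_class (v 0 i)) ->
  forall k, psibar q k = DYX_class ((psi v) 0 k).
Proof.
move=> e k; rewrite ffunE (row_sum_delta v) linear_sum summxE.
have -> : DYX_class (\sum_(i < r) (psi (v 0 i *: delta_mx 0 i)) 0 k) =
   \sum_(i < r) DYX_class ((psi (v 0 i *: delta_mx 0 i)) 0 k).
  by rewrite /DYX_class; exact: (raddf_sum (pim t_ideal)).
by apply: eq_bigr => i _; rewrite linearZ mxE e; exact: DYX_ractE.
Qed.
End InducedMap.

Section VComplex.
Context (r : nat -> nat) (m : forall j, 'I_(r j) -> int).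
Context (psi : forall j, {linear 'rV[Dxt]_(r j.+1) -> 'rV[Dxt]_(r j)}).
Context (psiV : forall j, (j <= d)%N -> forall k v,
  inVr (@m j.+1) k v -> inVr (@m j) k (psi j v)).
Context (psi_exact : forall j, (j < d)%N -> forall v,
  psi j v = 0 <-> exists w, v = psi j.+1 w).

(* None stands for -oo *)
Definition Vterm (k : option int) (j : nat) : submodule (DYXr (r j)) :=
  if k is Some k' then
    if (j <= d.+1)%N then VDYX (@m j) k' else sm_bot (DYXr (r j))
  else sm_bot (DYXr (r j)).

Lemma Vterm_psibar k j q : Vterm k j.+1 q -> Vterm k j (psibar (psi j) q).
Proof.
rewrite /Vterm; case: k => [k|] /=; last by move=> ->; rewrite raddf0.
rewrite ltnS; case: leqP => [jd|_]; last first.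
  by move=> ->; rewrite raddf0; exact: sm0.
rewrite (leq_trans jd (leqnSn d)) => -[v hv ev].
by exists (psi j v); [exact: psiV|exact: psibar_class].
Qed.

Lemma Vterm_psibarK k j q : Vterm k j.+2 q ->
  psibar (psi j) (psibar (psi j.+1) q) = 0.
Proof.
rewrite /Vterm; case: k => [k|] /=; last by move=> ->; rewrite !raddf0.
rewrite !ltnS; case: ifP => [jd|_]; last by move=> ->; rewrite !raddf0.
case=> v _ ev; apply/ffunP => l.
rewrite (psibar_class (psi j) (psibar_class (psi j.+1) ev)).
have -> : psi j (psi j.+1 v) = 0 by apply/(psi_exact jd); exists v.
by rewrite mxE ffunE /DYX_class raddf0.
Qed.

Context (k0 : option int) (k1 : int).

(* The term of degree - j; it is 0 for j > d + 1. *)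
Definition V_term (j : nat) : lmodType Dx :=
  subquo (Vterm (Some k1) j) (Vterm k0 j).

Definition V_diff (j : nat) : {linear V_term j.+1 -> V_term j} :=
  subquo_map (@Vterm_psibar (Some k1) j) (@Vterm_psibar k0 j).

Lemma V_diffK j x : V_diff j (V_diff j.+1 x) = 0.
Proof.
rewrite -[x]pim_repr /V_diff /subquo_map /= !quom_mapE.
rewrite -[RHS](raddf0 (pim _)); congr (pim _ _); apply: val_inj => /=.
by apply: (@Vterm_psibarK (Some k1)); apply/asboolP; exact: (valP (repr x)).
Qed.

Definition V_complex : complex Dx := chain_complex V_diffK.
End VComplex.

(* K[x]_p (x)_{K[x]} N, with its structure of module over K[x]_p (x)_{K[x]} D_n,
   is (K[x]_p (x)_{K[x]} D_n) (x)_{D_n} N. *)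
Definition localize (p : prime_idealr Kx) (C : complex Dx) : complex (Dxp p) :=
  tens_complex (ring_bimodule (Dx_Dxp p)) C.

(* The complex representing L iota^* M, for a projective resolution F of M. *)
Definition Liota (F : complex Dxt) : complex Dx := tens_complex DYX F.

End WeylAlgebras.

Definition finitely_generated (R : pzRingType) (M : lmodType R) : Prop :=
  exists (r : nat) (e : 'I_r -> M),
    forall x, exists c : 'I_r -> R, x = \sum_(i < r) c i *: e i.

(* Main.v *)
(* For a left D_{n+d}-module N, D_{Y->X} (x) N is N / tN.  The t_l form a regular
   sequence on D_{n+d}, compatibly with the V-filtration, because dividing the
   coefficients of an operator by t_l (up to a remainder free of t_l) is an
   additive operation; hence they do so on every projective module as well.

   Killing the t_l one at a time, the long exact sequences give three things.
   L iota^* M has no cohomology in degrees < -d.  The partial free resolution L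
   computes the cohomology of L iota^* M in degrees >= -d, since the cone of
   L -> F stays exact in the relevant range.  Finally, for f_i in J_Y(u_i), the
   operators f_i(theta + k, x) act on gr^k M by a locally nilpotent operator,
   because a commutator with a polynomial in x lowers the order in the
   x-derivatives; so every class in the homology of gr^k(L / tL) is killed by a
   product of powers of them.  But theta lies in the right ideal t D, hence acts
   by 0 there, and this product is a polynomial in x which is a unit at p when
   k <= k0 or k > k1.

   Since V^k of D_{Y->X} vanishes for k < 0 and the filtration is exhaustive, after
   localization V^k0 has no cohomology and V^k1 has all of it in degrees >= -d,
   whence the zigzag of quasi-isomorphisms.  Localized statements are handled
   elementwise: they hold after multiplication by some h outside p. *)
Require Import Defs.
From HB Require Import structures.
From mathcomp Require Import all_boot all_order all_algebra.
From mathcomp Require Import boolp.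
From mathcomp Require Import mpoly.
From mathcomp Require Import zify.

Set Implicit Arguments.
Unset Strict Implicit.
Unset Printing Implicit Defensive.

Import Order.TTheory GRing.Theory Num.Theory.
Local Open Scope ring_scope.

(** * Descent along a regular sequence *)

(** No quotient module gr or L / tL is formed: an assertion about it is a congruence between
    elements of L, and a long exact sequence becomes a correction of one element in two steps. One
    descent lemma serves three times, with different index sets [J]: for the graded pieces of L, for
    F, and for the cone of L -> F. The obstacle in the filtered case is that t_l mixes levels,
    sending V^(k+1) to V^k. A multiplier is therefore a polynomial g in s and x that acts on level k
    as g(theta + k, x), so that it passes through t_l with k shifted by one. Only after all t_l have
    been killed is it replaced by the polynomial g(k, x). Characteristic zero enters through the
    factorials in the division by t_l and through Euler's relation. The complexes V^k1 / V^k0 and L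
    iota^* M are not compared directly: both receive a map from V^k1, the complex with k0 = -oo. *)

Section Descent.
Context (C : nat -> zmodType) (dC : forall j, {additive C j.+1 -> C j}).
Context (t : nat -> forall j, {additive C j -> C j}).
Context (A B Z : int -> forall j, C j -> Prop) (J : nat -> nat -> Prop).
Context (G : Type) (mul : G -> G -> G).
Context (act : G -> int -> forall j, {additive C j -> C j}).

(* near i k is B k + \sum_(l < i) t_l (A (k + 1)); in the filtered case A k is
   V^k and B k is V^(k-1), so that near d k is what one divides V^k by in order
   to get gr^k of the restriction to t = 0. *)
Fixpoint near (i : nat) (k : int) (j : nat) (v : C j) : Prop :=
  if i is i'.+1 then exists2 a, A (k + 1) a & near i' k (v - t i' j a) else B k v.

Definition bnear i k j : C j -> Prop :=
  if j is j'.+1 then fun v => near i k (dC j' v) else fun=> True.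

Context (A0 : forall k j, @A k j 0) (B0 : forall k j, @B k j 0).
Context (AB : forall k j (x y : C j), A k x -> A k y -> A k (x - y)).
Context (BB : forall k j (x y : C j), B k x -> B k y -> B k (x - y)).
Context (tA : forall i k j (x : C j), A (k + 1) x -> A k (t i j x)).
Context (tB : forall i k j (x : C j), B (k + 1) x -> B k (t i j x)).
Context (tC : forall i l j (x : C j), t i j (t l j x) = t l j (t i j x)).
Context (actA : forall g k j (x : C j), A k x -> A k (act g k j x)).
Context (actB : forall g k j (x : C j), B k x -> B k (act g k j x)).
Context (actt : forall g k i j (x : C j),
  act g k j (t i j x) = t i j (act g (k + 1) j x)).
Context (actM : forall g h k j (x : C j),
  act (mul g h) k j x = act g k j (act h k j x)).
Context (actd : forall g k j (x : C j.+1), dC j (act g k j.+1 x) = act g k j (dC j x)).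
Context (J_S : forall i j, J i.+1 j -> J i j).
Context (J_SS : forall i j, J i.+1 j.+1 -> J i j).
Context (dt : forall l j (x : C j.+1), J 0 j.+1 ->
  dC j (t l j.+1 x) = t l j (dC j x)).
Context (dA : forall k j (x : C j.+1), J 0 j.+1 -> A k x -> A k (dC j x)).
Context (dB : forall k j (x : C j.+1), J 0 j.+1 -> B k x -> B k (dC j x)).
Context (ddK : forall j (x : C j.+2), J 0 j.+2 -> dC j (dC j.+1 x) = 0).
Context (Zd : forall i k j (x : C j), J i.+1 j.+1 -> Z k x ->
  exists2 w, A k w & x = dC j w).
Context (regular : forall i k j (x : C j), J i.+1 j.+2 -> A (k + 1) x ->
  near i k (t i j x) -> near i (k + 1) x).

(** Modulo [near i], every cycle becomes an element of [Z] after applying some multiplier. In the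
    filtered case [Z] consists of cycles of the complex itself, not merely modulo t. [J] records the
    positions where this is claimed after i of the t_l; [J_S] and [J_SS] are what the induction on i
    consumes. *)
Definition gexact i j := forall k (z : C j), A k z -> bnear i k z ->
  exists g x, Z k x /\ near i k (act g k j z - x).

Lemma near0 i k j : near i k (0 : C j).
Proof. by elim: i => [//|i IH] /=; exists 0 => //; rewrite raddf0 subr0. Qed.

Lemma nearB i k j (x y : C j) : near i k x -> near i k y -> near i k (x - y).
Proof.
elim: i x y => [|i IH] x y /=; first exact: BB.
case=> a ha hx [b hb hy]; exists (a - b); first exact: AB.
rewrite (_ : _ - _ = (x - t i j a) - (y - t i j b)); first exact: IH.
by rewrite raddfB !opprD !opprK addrACA.
Qed.

Lemma nearN i k j (x : C j) : near i k x -> near i k (- x).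
Proof. by rewrite -sub0r; apply: nearB; exact: near0. Qed.

Lemma nearD i k j (x y : C j) : near i k x -> near i k y -> near i k (x + y).
Proof. by move=> hx hy; rewrite -[y]opprK; apply: nearB => //; exact: nearN. Qed.

Lemma nearS i k j (x : C j) : near i k x -> near i.+1 k x.
Proof. by move=> hx /=; exists 0; [exact: A0|rewrite raddf0 subr0]. Qed.

Lemma near_tS i k j (x : C j) : A (k + 1) x -> near i.+1 k (t i j x).
Proof. by move=> hx /=; exists x => //; rewrite subrr; exact: near0. Qed.

Lemma near_t i l k j (x : C j) : near i (k + 1) x -> near i k (t l j x).
Proof.
elim: i x => [|i IH] x /=; first exact: tB.
case=> a ha hx; exists (t l j a); first exact: tA.
by rewrite tC -raddfB; exact: IH.
Qed.

Lemma near_act i g k j (x : C j) : near i k x -> near i k (act g k j x).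
Proof.
elim: i x => [|i IH] x /=; first exact: actB.
case=> a ha hx; exists (act g (k + 1) j a); first exact: actA.
by rewrite -actt -raddfB; exact: IH.
Qed.

Lemma J_0 i j : J i j -> J 0 j.
Proof. by elim: i => // i IH /J_S. Qed.

Lemma near_d i k j (x : C j.+1) : J 0 j.+1 -> near i k x ->
  near i k (dC j x).
Proof.
move=> hJ; elim: i x => [|i IH] x /=; first exact: (dB hJ).
case=> a ha hx; exists (dC j a); first exact: (dA hJ).
by rewrite -(dt _ _ hJ) -raddfB; exact: IH.
Qed.

(** The long exact sequence of multiplication by t_i, on elements. If dz = t_i y modulo [near i],
    then y is a cycle there by regularity; a multiple g y is a boundary dw, and g z - t_i w is a
    cycle to which the hypothesis for i applies. *)
Lemma gexact_step i j : J i.+1 j -> (forall j', J i j' -> gexact i j') ->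
  gexact i.+1 j.
Proof.
case: j => [|j] hJ IH k z hz.
  move=> _; have [g [x [hx hn]]] := IH _ (J_S hJ) k z hz I.
  by exists g, x; split => //; exact: nearS.
rewrite /bnear => -[y hy].
set nd := near i k => hn.
(* Since d(dz) = 0, the element t_i dy is near, and t_i can be cancelled. For y in position 0 there
   is nothing to check. *)
have [g [x [hx hg]]] : exists g x, Z (k + 1) x /\
    near i (k + 1) (act g (k + 1) j y - x).
  apply: (IH _ (J_SS hJ)) => //.
  case: j z hz y hy @nd hn hJ => [//|j] z hz y hy nd hn hJ.
  have hJ' := J_0 (J_SS hJ).
  apply: (regular hJ); first exact: dA.
  rewrite -dt //; have := near_d hJ' hn.
  by rewrite raddfB (ddK _ (J_0 hJ)) sub0r => /nearN; rewrite opprK.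
have [w hw ew] := Zd hJ hx.
have [g' [x' [hx' hn']]] : exists g' x', Z k x' /\
    near i k (act g' k j.+1 (act g k j.+1 z - t i j.+1 w) - x').
  apply: (IH _ (J_S hJ)); first by apply: AB; [exact: actA|exact: tA].
  rewrite /bnear raddfB actd (dt _ _ (J_0 hJ)) -ew.
  rewrite (_ : _ - _ = act g k j (dC j z - t i j y) +
      t i j (act g (k + 1) j y - x)).
    by apply: nearD; [exact: near_act|exact: near_t].
  by rewrite !raddfB actt addrA subrK.
(* g' g z = x' + t_i g' w modulo [near i], and the last term is absorbed on passing to i + 1. *)
exists (mul g' g), x'; split=> //.
rewrite actM (_ : _ - _ = act g' k j.+1 (act g k j.+1 z - t i j.+1 w) - x' +
    t i j.+1 (act g' (k + 1) j.+1 w)).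
  apply: nearD; first exact: nearS.
  by apply: near_tS; exact: actA.
by rewrite raddfB actt addrAC subrK.
Qed.

Lemma descent : (forall j, J 0 j -> gexact 0 j) ->
  forall i j, J i j -> gexact i j.
Proof. by move=> h0; elim=> [//|i IH] j hJ; apply: gexact_step => // j'; exact: IH. Qed.

End Descent.

(** * Commutators, polynomials and derivations *)

Section CommutatorNilpotence.
Context (R : pzRingType) (I : Type) (x : I -> R).
Implicit Types (P : R).

(** Used for three families x: one t-derivative, one polynomial, and all polynomials in x. For the
    last one the exponent l bounds the order in the x-derivatives. *)
Fixpoint comm_nil (l : nat) (P : R) : Prop :=
  if l is l'.+1 then forall i, comm_nil l' (x i * P - P * x i) else P = 0.

Lemma comm_nil0 l : comm_nil l 0.
Proof. by elim: l => [//|l IH] i; rewrite mulr0 mul0r subrr. Qed.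

Lemma comm_nilS l P : comm_nil l P -> comm_nil l.+1 P.
Proof.
elim: l P => [|l IH] P /=; first by move=> -> i; rewrite mulr0 mul0r subrr.
by move=> h i; apply: IH.
Qed.

Lemma comm_nil_leq l l' P : (l <= l')%N -> comm_nil l P -> comm_nil l' P.
Proof.
by move=> /subnK <- h; elim: (l' - l)%N => // k IH; rewrite addSn; apply: comm_nilS.
Qed.

Lemma comm_nilB l P P' : comm_nil l P -> comm_nil l P' -> comm_nil l (P - P').
Proof.
elim: l P P' => [|l IH] P P' /=; first by move=> -> ->; rewrite subrr.
move=> h h' i; rewrite (_ : _ - _ = x i * P - P * x i - (x i * P' - P' * x i)).
  exact: IH.
by rewrite mulrBr mulrBl !opprD !opprK addrACA.
Qed.

Lemma comm_nilD l P P' : comm_nil l P -> comm_nil l P' -> comm_nil l (P + P').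
Proof.
move=> h h'; rewrite -[P']opprK; apply: comm_nilB => //.
by rewrite -sub0r; apply: comm_nilB => //; exact: comm_nil0.
Qed.

(** Leibniz: [x, P P'] = [x, P] P' + P [x, P'], and the total exponent drops in both summands. *)
Lemma comm_nilM l l' P P' : comm_nil l P -> comm_nil l' P' ->
  comm_nil (l + l') (P * P').
Proof.
have [N] := ubnP (l + l'); elim: N l l' P P' => // N IH [|l] [|l'] P P' hN.
- by move=> -> _; rewrite mul0r; exact: comm_nil0.
- by move=> -> _; rewrite mul0r; exact: comm_nil0.
- by move=> _ ->; rewrite mulr0; exact: comm_nil0.
move=> h h'; rewrite addSn => i.
rewrite (_ : _ - _ = (x i * P - P * x i) * P' + P * (x i * P' - P' * x i)).
  have lN : (l + l'.+1 < N)%N by move: hN; rewrite ltnS addSn.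
  apply: (@comm_nilD (l + l'.+1)); first by apply: IH => //; exact: h.
  by rewrite -addSnnS in lN *; apply: IH => //; exact: h'.
by rewrite mulrBl mulrBr !mulrA subrKA.
Qed.

Lemma comm_nil_mulr l T P : (forall i, x i * T = T * x i) ->
  comm_nil l P -> comm_nil l (P * T).
Proof.
move=> hT; elim: l P => [|l IH] P /=; first by move=> ->; rewrite mul0r.
move=> h i; rewrite -mulrA -hT !mulrA -mulrBl; exact: IH.
Qed.

Definition comm_nilp P := exists l, comm_nil l P.

Lemma comm_nilpB P P' : comm_nilp P -> comm_nilp P' -> comm_nilp (P - P').
Proof.
move=> [l h] [l' h']; exists (maxn l l'); apply: comm_nilB.
  by apply: comm_nil_leq h; exact: leq_maxl.
by apply: comm_nil_leq h'; exact: leq_maxr.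
Qed.

Lemma comm_nilpM P P' : comm_nilp P -> comm_nilp P' -> comm_nilp (P * P').
Proof. by move=> [l h] [l' h']; exists (l + l')%N; exact: comm_nilM. Qed.

Lemma comm_nilp1 : comm_nilp 1.
Proof. by exists 1%N => i /=; rewrite mulr1 mul1r subrr. Qed.

End CommutatorNilpotence.

Lemma mpoly_ring_ind (K : fieldType) (N : nat) (P : {mpoly K[N]} -> Prop) :
  (forall c, P c%:MP) -> (forall i, P 'X_i) ->
  (forall f g, P f -> P g -> P (f + g)) -> (forall f g, P f -> P g -> P (f * g)) ->
  forall f, P f.
Proof.
move=> PC PX PD PM; elim/mpolyind => [|c m f _ _ Pf]; first exact: PC.
(* Composing a monomial with the identity substitution turns it into a product of powers of
   variables. *)
apply: PD => //; rewrite -mul_mpolyC -[X in _ * X]comp_mpoly_id comp_mpolyX.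
apply: (PM) => //; elim/big_rec: _ => [|i x _ Px]; first exact: PC.
apply: (PM) => //; rewrite tnth_mktuple; elim: (m i) => [|e IH]; first exact: PC.
by rewrite exprS; apply: PM.
Qed.

(** * Degree bounds on polynomials *)

Section PolynomialDegree.
Context (K : fieldType) (N : nat).
Implicit Types f g : {mpoly K[N]}.

Definition deg_lt (m : nat) f := forall k, (m <= mdeg k)%N -> f@_k = 0.
Definition deg_ge (m : nat) f := forall k, (mdeg k < m)%N -> f@_k = 0.

Lemma deg_lt_msize f : deg_lt (msize f) f.
Proof. by move=> k /msize_mdeg_ge; exact: memN_msupp_eq0. Qed.

Lemma deg_lt0 f : deg_lt 0 f -> f = 0.
Proof. by move=> h; apply/mpolyP => k; rewrite mcoeff0 h. Qed.

Lemma deg_lt_mderiv m f i : deg_lt m.+1 f -> deg_lt m (mderiv i f).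
Proof.
by move=> h k hk; rewrite mcoeff_deriv h ?mul0rn // mdegD mdeg1 addn1.
Qed.

Lemma deg_geM m f i : deg_ge m f -> deg_ge m.+1 ('X_i * f).
Proof.
move=> h k hk; rewrite mcoeffM big1 // => -[k1 k2] /= /eqP ek.
rewrite mcoeffX; case: eqP => [e|_]; last by rewrite mul0r.
rewrite h ?mulr0 //; move/(congr1 mdeg): ek; rewrite mdegD -e mdeg1 add1n.
by move=> ek; rewrite -ltnS -ek.
Qed.

Lemma deg_geD m f g : deg_ge m f -> deg_ge m g -> deg_ge m (f + g).
Proof. by move=> hf hg k hk; rewrite mcoeffD hf // hg // addr0. Qed.

Lemma deg_ge_eq0 f : (forall m, deg_ge m f) -> f = 0.
Proof. by move=> h; apply/mpolyP => k; rewrite mcoeff0 (h (mdeg k).+1). Qed.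

End PolynomialDegree.

(** The commutator of two derivations is a derivation; vanishing at q and at q b, it satisfies q
    [D1, D2] b = 0. With q a denominator of b this extends commutation from polynomials to
    fractions. *)
Lemma commuting_derivations (F : fieldType) (D1 D2 : F -> F) (q b : F) :
  {morph D1 : x y / x + y} -> {morph D2 : x y / x + y} ->
  (forall x y, D1 (x * y) = D1 x * y + x * D1 y) ->
  (forall x y, D2 (x * y) = D2 x * y + x * D2 y) ->
  q != 0 -> D1 (D2 q) = D2 (D1 q) ->
  D1 (D2 (q * b)) = D2 (D1 (q * b)) -> D1 (D2 b) = D2 (D1 b).
Proof.
move=> D1D D2D D1M D2M q0 eq eqb; apply: (mulfI q0); move: eqb.
rewrite D1M D2M D1D D2D !D1M !D2M eq => e.
apply: (addrI (D2 (D1 q) * b + D2 q * D1 b + D1 q * D2 b)).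
rewrite -addrA e -!addrA; congr (_ + _).
by rewrite addrCA.
Qed.

Section FractionDerivations.
Context (K : fieldType) (N : nat).
Local Notation Q := {fraction {mpoly K[N]}}.
Local Notation "f %:F" := (@FracField.tofrac {mpoly K[N]} f).

Lemma fderivD i : {morph @fderiv K N i : a b / a + b}.
Proof. by move=> a b; exact: (raddfD (derop K i)). Qed.

Lemma fderivC i j (a : Q) : fderiv i (fderiv j a) = fderiv j (fderiv i a).
Proof.
rewrite (fracE a); move: \n_(repr a) \d_(repr a) (denom_ratioP (repr a)) => p q q0.
have q0F := tofrac_neq0 q0.
apply: (commuting_derivations (fderivD i) (fderivD j) (fderivM i) (fderivM j) q0F).
  by rewrite !fderiv_tofrac mderiv_comm.
by rewrite mulrC divfK // !fderiv_tofrac mderiv_comm.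
Qed.
End FractionDerivations.

(** * Division by t_l in the Weyl algebra *)

Section WeylAlgebra.
Context (K : fieldType) (charK : [pchar K] =i pred0) (n d : nat).
Local Notation Kx := {mpoly K[n]}.
Local Notation Kxt := {mpoly K[n + d]}.
Local Notation D := (Dxt K n d).
Local Notation Q := {fraction Kxt}.
Local Notation "f %:F" := (@FracField.tofrac _ f).
Implicit Types (P : D) (f g : Kxt) (l : 'I_d) (k : int).

(** The induction runs over [generated], which speaks of bare operators, so the elements of the
    subring type are reassembled at each node. *)
Lemma Dxt_ind (T : D -> Prop) :
  (forall f, T (polyop f)) -> (forall i, T (partial K i)) -> T 1 ->
  (forall P P', T P -> T P' -> T (P - P')) ->
  (forall P P', T P -> T P' -> T (P * P')) -> forall P, T P.
Proof.
move=> Tf Td T1 TB TM [E hE]; have := asboolW hE.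
move=> gE; elim: gE hE => {E} [E [[f ->]|[i ->]]||E E' gE IE gE' IE'|E E' gE IE gE' IE'] hE.
- by rewrite (_ : exist _ _ _ = polyop f) //; exact: val_inj.
- by rewrite (_ : exist _ _ _ = partial K i) //; exact: val_inj.
- by rewrite (_ : exist _ _ _ = (1 : D)) //; exact: val_inj.
- pose P1 : D := exist (fun x => x \in genb (@Dxt_gen K n d)) E (asboolT gE).
  pose P2 : D := exist (fun x => x \in genb (@Dxt_gen K n d)) E' (asboolT gE').
  rewrite (_ : exist _ _ _ = P1 - P2); first by apply: TB; [exact: IE|exact: IE'].
  exact: val_inj.
- pose P1 : D := exist (fun x => x \in genb (@Dxt_gen K n d)) E (asboolT gE).
  pose P2 : D := exist (fun x => x \in genb (@Dxt_gen K n d)) E' (asboolT gE').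
  rewrite (_ : exist _ _ _ = P1 * P2); first by apply: TM; [exact: IE|exact: IE'].
  exact: val_inj.
Qed.

Lemma polyopM f g : polyop (f * g) = polyop f * polyop g :> D.
Proof. by apply/val_inj/endo_eq => a /=; rewrite tofracM mulrA. Qed.

Lemma polyopC f g : polyop f * polyop g = polyop g * polyop f :> D.
Proof. by rewrite -!polyopM mulrC. Qed.

Lemma polyopB f g : polyop (f - g) = polyop f - polyop g :> D.
Proof.
apply/val_inj/endo_eq => a.
by transitivity (f%:F * a - g%:F * a); first by rewrite /= tofracB mulrBl.
Qed.

Lemma polyop0 : polyop 0 = 0 :> D.
Proof. by rewrite -[X in polyop X](subrr 0) polyopB subrr. Qed.

Lemma polyopD f g : polyop (f + g) = polyop f + polyop g :> D.
Proof. by rewrite -[g in LHS]opprK polyopB -[- g]sub0r polyopB polyop0 sub0r opprK. Qed.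

Lemma polyop1 : polyop 1 = 1 :> D.
Proof. by apply/val_inj/endo_eq => a /=; rewrite tofrac1 mul1r. Qed.

Lemma partial_polyop i f :
  partial K i * polyop f = polyop f * partial K i + polyop (mderiv i f) :> D.
Proof.
apply/val_inj/endo_eq => a.
transitivity (f%:F * fderiv i a + (mderiv i f)%:F * a); last by [].
by rewrite /= fderivM fderiv_tofrac addrC.
Qed.

Lemma partialC i j : partial K i * partial K j = partial K j * partial K i :> D.
Proof. by apply/val_inj/endo_eq => a; exact: fderivC. Qed.

Definition scal (c : K) : D := polyop c%:MP.

Lemma scalC c P : scal c * P = P * scal c.
Proof.
elim/Dxt_ind: P => [f|i||P P' h h'|P P' h h'].
- exact: polyopC.
- by rewrite partial_polyop mderivC polyop0 addr0.
- by rewrite mulr1 mul1r.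
- by rewrite mulrBl mulrBr h h'.
- by rewrite mulrA h -!mulrA h'.
Qed.

Lemma scalM c c' : scal (c * c') = scal c * scal c'.
Proof. by rewrite /scal mpolyCM polyopM. Qed.

Lemma scalN c : scal (- c) = - scal c.
Proof. by rewrite /scal -[- c]sub0r mpolyCB polyopB polyop0 sub0r. Qed.

Lemma scal1 : scal 1 = 1.
Proof. by rewrite /scal mpolyC1 polyop1. Qed.

Lemma scaln m : scal m%:R = m%:R.
Proof.
elim: m => [|m IH]; first by rewrite /scal mpolyC0 polyop0.
by rewrite !mulrS /scal mpolyCD polyopD -/(scal 1) scal1 -IH.
Qed.

Lemma natK_neq0 m : (m.+1%:R : K) != 0.
Proof. by have /pcharf0P -> := charK. Qed.

Definition pd l : D := partial K (rshift n l).
Definition ad l P : D := pd l * P - P * pd l.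

Lemma t_opC l l' : t_op K n l * t_op K n l' = t_op K n l' * t_op K n l :> D.
Proof. exact: polyopC. Qed.

Lemma pd_t l l' : pd l * t_op K n l' = t_op K n l' * pd l + (l == l')%:R.
Proof.
rewrite /pd partial_polyop; congr (_ + _).
rewrite /tvar mderivX mnm1E (inj_eq (@rshift_inj _ _)) eq_sym.
case: eqP => [->|_]; last by rewrite scale0r polyop0.
by rewrite -[X in (X - _)%MM]add0m addmK scale1r mpolyX0 polyop1.
Qed.

Lemma ad_is_additive l : zmod_morphism (ad l).
Proof.
move=> P P'; rewrite /ad mulrBr mulrBl !opprB !addrA [LHS]addrAC [RHS]addrAC.
by congr (_ + _); rewrite -!addrA; congr (_ + _); rewrite addrC.
Qed.
HB.instance Definition _ l := GRing.isZmodMorphism.Build D D (ad l) (ad_is_additive l).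

Lemma adD l P P' : ad l (P + P') = ad l P + ad l P'.
Proof. exact: raddfD. Qed.

Lemma ad_natl l j P : ad l (j%:R * P) = j%:R * ad l P.
Proof. by rewrite !mulr_natl; exact: raddfMn. Qed.

Lemma iter_adB j l P P' : iter j (ad l) (P - P') = iter j (ad l) P - iter j (ad l) P'.
Proof. by elim: j => [//|j IH]; rewrite !iterS IH raddfB. Qed.

Lemma iter_ad0 j l : iter j (ad l) 0 = 0.
Proof. by elim: j => [//|j IH]; rewrite iterS IH raddf0. Qed.

Lemma ad_t l l' P :
  ad l (t_op K n l' * P) = t_op K n l' * ad l P + (l == l')%:R * P.
Proof. by rewrite /ad mulrA pd_t mulrBr mulrDl !mulrA addrAC. Qed.

Lemma iter_ad_t j l P :
  iter j.+1 (ad l) (t_op K n l * P) =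
  t_op K n l * iter j.+1 (ad l) P + j.+1%:R * iter j (ad l) P.
Proof.
elim: j => [|j IH]; first by rewrite /= ad_t eqxx.
rewrite iterS IH adD ad_natl ad_t eqxx mul1r -!iterS.
by rewrite -addrA; congr (_ + _); rewrite [in RHS]mulrS mulrDl mul1r.
Qed.

Lemma iter_ad_t_neq j l l' P : l != l' ->
  iter j (ad l) (t_op K n l' * P) = t_op K n l' * iter j (ad l) P.
Proof.
move=> /negbTE ll'; elim: j => [//|j IH].
by rewrite iterS IH ad_t ll' mul0r addr0.
Qed.

(** On a polynomial each commutator is a derivative and lowers the degree, the derivations commute
    with one another, and the Leibniz bound covers products. *)
Lemma ad_nilp l P : exists N, iter N (ad l) P = 0.
Proof.
suff [N hN] : comm_nilp (fun _ : unit => pd l) P.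
  exists N; elim: N P hN => [//|N IH] P /= h.
  by rewrite -iterS iterSr; apply: IH; exact: (h tt).
elim/Dxt_ind: P => [f|i||P P'|P P'].
- exists (msize f).
  move: (msize f) (@deg_lt_msize _ _ f) => m; elim: m f => [|m IH] f hf.
    by rewrite (deg_lt0 hf) polyop0.
  move=> i /=; rewrite partial_polyop addrC addKr.
  by apply: IH; exact: deg_lt_mderiv.
- by exists 1%N => i' /=; rewrite partialC subrr.
- exact: comm_nilp1.
- exact: comm_nilpB.
- exact: comm_nilpM.
Qed.

(** The Taylor coefficients of the shift by - t_l, which evaluates at t_l = 0. The recursion
    [tcoefS] makes the sums below telescope. *)
Definition tcoef (j : nat) : D := scal ((-1) ^+ j / (j`!)%:R).

Lemma tcoefS j : j.+1%:R * tcoef j.+1 = - tcoef j.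
Proof.
rewrite -scaln -scalM -scalN; congr scal.
rewrite factS natrM exprS mulN1r mulNr mulrN mulrCA invfM mulVKf //.
exact: natK_neq0.
Qed.

Lemma tcoef0 : tcoef 0 = 1.
Proof. by rewrite /tcoef expr0 fact0 divr1 scal1. Qed.

Lemma tcoefC j P : tcoef j * P = P * tcoef j.
Proof. exact: scalC. Qed.

(* ad l differentiates the coefficients of P with respect to t_l, so that by
   Taylor's formula tconst_sum sets t_l = 0 in the coefficients and tquot_sum
   divides the rest by t_l. *)
Definition tquot_sum N l P : D :=
  \sum_(j < N) - tcoef j.+1 * t_op K n l ^+ j * iter j.+1 (ad l) P.

Definition tconst_sum N l P : D :=
  \sum_(j < N) tcoef j * t_op K n l ^+ j * iter j (ad l) P.

(** By [iter_ad_t] each summand splits in two and consecutive halves cancel; only P and the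
    remainder of order N survive. *)
Lemma tquot_sum_t N l P : tquot_sum N l (t_op K n l * P) =
  P - tcoef N * t_op K n l ^+ N * iter N (ad l) P.
Proof.
elim: N => [|N IH]; first by rewrite /tquot_sum big_ord0 tcoef0 expr0 !mul1r subrr.
rewrite /tquot_sum big_ord_recr /= -/(tquot_sum N l _) IH -iterS iter_ad_t.
rewrite mulrDr [X in _ + (_ + X)](_ : _ = tcoef N * t_op K n l ^+ N * iter N (ad l) P).
  rewrite -addrA; congr (_ + _).
  by rewrite addrA addrAC addNr add0r exprSr !mulNr !mulrA.
rewrite -[tcoef N]opprK -(tcoefS N) !mulNr -!mulrA; congr (- _).
by rewrite !mulr_natl !mulrnAr -!mulrnAl.
Qed.

Lemma t_tquot_sum N l P :
  t_op K n l * tquot_sum N l P + tconst_sum N.+1 l P = P.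
Proof.
rewrite /tconst_sum big_ord_recl /= tcoef0 expr0 !mul1r addrCA.
rewrite /tquot_sum mulr_sumr -big_split big1 ?addr0 // => j _ /=.
rewrite /bump add1n !mulNr mulrN !mulrA -tcoefC -[_ * _ ^+ _]mulrA -exprS.
by rewrite addNr.
Qed.

Lemma ad_tX j l P : ad l (t_op K n l ^+ j * P) =
  t_op K n l ^+ j * ad l P + j%:R * (t_op K n l ^+ j.-1 * P).
Proof.
elim: j => [|j IH] /=; first by rewrite !expr0 !mul1r mul0r addr0.
rewrite exprS -mulrA ad_t eqxx IH mulrDr mul1r -!mulrA -addrA; congr (_ + _).
rewrite mulrS mulrDl mul1r addrC; congr (_ + _).
case: j {IH} => [|j] /=; first by rewrite !mulr0n !mul0r mulr0.
by rewrite !mulr_natl mulrnAr mulrA -exprS.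
Qed.

Lemma ad_tX_neq j l l' P : l != l' ->
  ad l (t_op K n l' ^+ j * P) = t_op K n l' ^+ j * ad l P.
Proof.
move=> /negbTE ll'; elim: j => [|j IH]; first by rewrite !expr0 !mul1r.
by rewrite !exprS -!mulrA ad_t ll' mul0r addr0 IH.
Qed.

Lemma ad_scal l c P : ad l (scal c * P) = scal c * ad l P.
Proof. by rewrite /ad mulrBr mulrA -(scalC c (pd l)) -!mulrA. Qed.

(** Telescoping again: differentiating the Taylor polynomial leaves only the top term, which
    vanishes once N exceeds the nilpotency exponent. *)
Lemma ad_tconst_sum N l P : ad l (tconst_sum N.+1 l P) =
  tcoef N * t_op K n l ^+ N * iter N.+1 (ad l) P.
Proof.
rewrite /tconst_sum; elim: N => [|N IH].
  by rewrite big_ord_recr big_ord0 /= add0r -mulrA ad_scal ad_tX mul0r addr0 mulrA.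
rewrite big_ord_recr /= adD IH -[tcoef N.+1 * _ * _]mulrA ad_scal ad_tX -/(tcoef N.+1).
rewrite [X in _ + X]mulrDr [X in _ + (_ + X)](_ : _ =
  - (tcoef N * t_op K n l ^+ N * iter N.+1 (ad l) P)) /=.
  by rewrite addrCA subrr addr0 mulrA.
by rewrite mulr_natl mulrnAr -mulrnAl -mulr_natl tcoefS !mulNr mulrA.
Qed.

Lemma tquot_sum_leq N N' l P : (N <= N')%N -> iter N (ad l) P = 0 ->
  tquot_sum N' l P = tquot_sum N l P.
Proof.
move=> /subnK <- h; elim: (N' - N)%N => [//|m IH]; rewrite addSn.
rewrite /tquot_sum big_ord_recr /= -/(tquot_sum _ l P) IH -iterS -addSn iterD h.
by rewrite iter_ad0 mulr0 addr0.
Qed.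

(** [cid] picks some N; by [tquotE] every admissible N gives the same value, so a common N can be
    used for two operators, whence additivity. *)
Definition tquot l P : D := tquot_sum (projT1 (cid (ad_nilp l P))) l P.

Lemma tquotE N l P : iter N (ad l) P = 0 -> tquot l P = tquot_sum N l P.
Proof.
rewrite /tquot; case: cid => N' /= h' h.
have [NN|/ltnW NN] := leqP N N'; first exact: tquot_sum_leq.
by rewrite (tquot_sum_leq NN).
Qed.

Lemma iter_ad_leq N N' l P : (N <= N')%N -> iter N (ad l) P = 0 ->
  iter N' (ad l) P = 0.
Proof. by move=> /subnK <- h; rewrite iterD h iter_ad0. Qed.

Lemma tquotB l : zmod_morphism (tquot l).
Proof.
move=> P P'; have [N h] := ad_nilp l P; have [N' h'] := ad_nilp l P'.
have {}h := iter_ad_leq (leq_maxl N N') h.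
have {}h' := iter_ad_leq (leq_maxr N N') h'.
rewrite (tquotE h) (tquotE h') (@tquotE (maxn N N')); last first.
  by rewrite iter_adB h h' subrr.
by rewrite -sumrB; apply: eq_bigr => j _; rewrite iter_adB mulrBr.
Qed.
HB.instance Definition _ l := GRing.isZmodMorphism.Build D D (tquot l) (tquotB l).

Lemma tquot_t l P : tquot l (t_op K n l * P) = P.
Proof.
have [N h] := ad_nilp l P.
rewrite (@tquotE N.+1); last by rewrite iter_ad_t iterS h raddf0 !mulr0 addr0.
by rewrite tquot_sum_t iterS h raddf0 mulr0 subr0.
Qed.

Lemma tquot_t_neq l l' P : l != l' ->
  tquot l (t_op K n l' * P) = t_op K n l' * tquot l P.
Proof.
move=> ll'; have [N h] := ad_nilp l P.
rewrite (@tquotE N); last by rewrite iter_ad_t_neq // h mulr0.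
rewrite (tquotE h) /tquot_sum mulr_sumr; apply: eq_bigr => j _.
rewrite iter_ad_t_neq // !mulrA; congr (_ * _).
rewrite /tcoef -scalN -(scalC _ (t_op K n l')) -!mulrA; congr (_ * _).
by apply/esym/commrX; exact: t_opC.
Qed.

Definition tconst l P : D := P - t_op K n l * tquot l P.

Lemma ad_tconst l P : ad l (tconst l P) = 0.
Proof.
have [N h] := ad_nilp l P; rewrite /tconst (tquotE h).
rewrite -[X in X - _](t_tquot_sum N l P) addrC addKr.
by rewrite ad_tconst_sum iterS h raddf0 mulr0.
Qed.

Lemma adC l l' P : ad l (ad l' P) = ad l' (ad l P).
Proof.
have e : pd l * pd l' = pd l' * pd l by exact: partialC.
rewrite /ad !mulrBr !mulrBl !mulrA e -[P * pd l' * pd l]mulrA -e mulrA.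
by rewrite !opprB [LHS]addrACA [RHS]addrACA; congr (_ + _); exact: addrC.
Qed.

Lemma tquot_ad_neq l l' P : l != l' -> tquot l (ad l' P) = ad l' (tquot l P).
Proof.
move=> ll'; have [N h] := ad_nilp l P.
have iC j : iter j (ad l) (ad l' P) = ad l' (iter j (ad l) P).
  by elim: j => [//|j IH]; rewrite !iterS IH adC.
rewrite (@tquotE N); last by rewrite iC h raddf0.
rewrite (tquotE h) /tquot_sum raddf_sum; apply: eq_bigr => j _.
transitivity (ad l' (- tcoef j.+1 * (t_op K n l ^+ j * iter j.+1 (ad l) P))).
  by rewrite /tcoef -scalN ad_scal ad_tX_neq // 1?eq_sym // iC mulrA.
by rewrite mulrA.
Qed.

(** Removing t_l from the coefficients does not bring back a variable removed before, so the
    variables can be treated one after another. *)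
Lemma ad_tconst_neq l l' P : l != l' -> ad l' P = 0 -> ad l' (tconst l P) = 0.
Proof.
move=> ll' h; rewrite /tconst ad_is_additive h ad_t eq_sym (negbTE ll') mul0r addr0.
by rewrite -tquot_ad_neq // h raddf0 mulr0 subr0.
Qed.

End WeylAlgebra.

(** * The V-filtration *)

Section VFiltration.
Context (K : fieldType) (charK : [pchar K] =i pred0) (n d : nat).
Local Notation Kx := {mpoly K[n]}.
Local Notation Kxt := {mpoly K[n + d]}.
Local Notation D := (Dxt K n d).
Local Notation Q := {fraction Kxt}.
Local Notation "f %:F" := (@FracField.tofrac _ f).
Implicit Types (P R : D) (f g : Kxt) (l : 'I_d) (k : int).
Local Arguments t_pow : simpl never.

Lemma t_powS m f : t_pow m.+1 f -> t_pow m f.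
Proof.
elim: m f => [//|m IH] f [g hg ->]; exists g => // i.
exact: IH (hg i).
Qed.

Lemma t_pow_leq m m' f : (m <= m')%N -> t_pow m' f -> t_pow m f.
Proof.
by move=> /subnK <-; elim: (m' - m)%N => [//|k IH]; rewrite addSn => /t_powS.
Qed.

Lemma t_powz_leq k k' f : k <= k' -> t_powz k' f -> t_powz k f.
Proof.
case: k k' => [m|m] [m'|m'] //; rewrite lez_nat; exact: t_pow_leq.
Qed.

Lemma t_powN m f : t_pow m f -> t_pow m (- f).
Proof. by move=> h; rewrite -sub0r; apply: t_powB => //; exact: t_pow0. Qed.

Lemma t_powD m f g : t_pow m f -> t_pow m g -> t_pow m (f + g).
Proof. by move=> hf hg; rewrite -[g]opprK; apply: t_powB => //; exact: t_powN. Qed.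

Lemma t_pow_sum m (I : finType) (F : I -> Kxt) :
  (forall i, t_pow m (F i)) -> t_pow m (\sum_i F i).
Proof.
by move=> h; elim/big_rec: _ => [|i x _ hx]; [exact: t_pow0|exact: t_powD].
Qed.

Lemma t_pow_tvar m l f : t_pow m f -> t_pow m.+1 (tvar K n l * f).
Proof.
move=> h; exists (fun i => if i == l then f else 0).
  by move=> i; case: ifP => _ //; exact: t_pow0.
rewrite (bigD1 l) //= eqxx big1 ?addr0 // => i /negbTE ->.
by rewrite mulr0.
Qed.

Lemma mderiv_t (i l : 'I_d) : mderiv (rshift n i) (tvar K n l) = (i == l)%:R.
Proof.
rewrite /tvar mderivX mnm1E (inj_eq (@rshift_inj _ _)) eq_sym.
case: eqP => [->|_]; last by rewrite scale0r.
by rewrite -[X in (X - _)%MM]add0m addmK scale1r mpolyX0.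
Qed.

Lemma t_pow_mderiv m l f : t_pow m.+1 f -> t_pow m (mderiv (rshift n l) f).
Proof.
elim: m f => [//|m IH] f [g hg ->]; rewrite raddf_sum /=; apply: t_pow_sum => i.
rewrite mderivM mderiv_t; apply: t_powD.
  by case: eqP => _; rewrite ?mul1r ?mul0r; [exact: hg|exact: t_pow0].
by apply: t_pow_tvar; exact: IH.
Qed.

(** With E the Euler operator, E(t_i g) - (m + 1) t_i g = t_i (E g - m g), so each factor t_i
    reduces the claim for m + 1 to the claim for m. *)
Lemma t_pow_euler m f : t_pow m f ->
  t_pow m.+1 (\sum_(l < d) tvar K n l * mderiv (rshift n l) f - m%:R * f).
Proof.
elim: m f => [|m IH] f.
  move=> _; rewrite mul0r subr0; apply: t_pow_sum => l.
  exact: t_pow_tvar.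
move=> [g hg ->].
rewrite (_ : _ - _ = \sum_(i < d) tvar K n i *
  (\sum_(l < d) tvar K n l * mderiv (rshift n l) (g i) - m%:R * g i)).
  by apply: t_pow_sum => i; apply: t_pow_tvar; apply: IH; exact: (hg i).
under [in RHS]eq_bigr do rewrite mulrBr.
rewrite sumrB mulrSr mulrDl mul1r opprD addrA addrAC; congr (_ - _); last first.
  by rewrite mulr_sumr; apply: eq_bigr => i _; rewrite mulrCA.
apply/eqP; rewrite subr_eq -big_split /=; apply/eqP.
under eq_bigr do rewrite raddf_sum mulr_sumr.
rewrite exchange_big; apply: eq_bigr => i _ /=.
under eq_bigr do rewrite mderivM mderiv_t mulrDr.
rewrite big_split addrC; congr (_ + _); last first.
  by rewrite mulr_sumr; apply: eq_bigr => l _; rewrite mulrCA.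
rewrite (bigD1 i) //= eqxx mul1r big1 ?addr0 // => l /negbTE ->.
by rewrite mul0r mulr0.
Qed.

(** A comparison of total degrees is enough to see that the powers of <t> intersect in 0. *)
Lemma t_pow_deg_ge m f : t_pow m f -> deg_ge m f.
Proof.
elim: m f => [//|m IH] f [g hg ->].
elim/big_ind: _ => [k _|x y|i _]; [exact: mcoeff0|exact: deg_geD|].
by apply: deg_geM; apply: IH; exact: (hg i).
Qed.

Lemma inV_leq k k' P : k <= k' -> inV k P -> inV k' P.
Proof.
move=> kk h j f /h [g hg e]; exists g => //.
by apply: t_powz_leq hg; rewrite lerD2l lerN2.
Qed.

Lemma inVM k k' P P' : inV k P -> inV k' P' -> inV (k + k') (P * P').
Proof.
move=> h h' j f /h' [g /h [g' hg' e'] e]; exists g'.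
  by move: hg'; rewrite -addrA -opprD [k' + k]addrC.
by rewrite -e' -e.
Qed.

Lemma inVN k P : inV k P -> inV k (- P).
Proof.
move=> h j f /h [g hg e]; exists (0 - g).
  by apply: t_powzB => //; exact: t_powz0.
by rewrite sub0r tofracN -e.
Qed.

Lemma inVB k P P' : inV k P -> inV k P' -> inV k (P - P').
Proof. by move=> h h'; apply: inVD => //; exact: inVN. Qed.

Lemma inV_sum k (I : Type) (r : seq I) (p : pred I) (F : I -> D) :
  (forall i, p i -> inV k (F i)) -> inV k (\sum_(i <- r | p i) F i).
Proof. by move=> h; elim/big_ind: _ => //; [exact: inV0|move=> x y; exact: inVD]. Qed.

Lemma inV_polyop f : inV 0 (polyop f : D).
Proof.
move=> j g hg; exists (f * g); last by rewrite tofracM.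
by rewrite subr0; case: j hg => // m; exact: t_powM.
Qed.

Lemma inV1 : inV 0 (1 : D).
Proof. by rewrite -polyop1; exact: inV_polyop. Qed.

Lemma inV_x_partial (i : 'I_n) : inV 0 (partial K (lshift d i) : D).
Proof.
move=> j f hf; exists (mderiv (lshift d i) f); last by rewrite -fderiv_tofrac.
by rewrite subr0; case: j hf => // m; exact: t_pow_deriv.
Qed.

Lemma inV_t l : inV (-1) (t_op K n l : D).
Proof.
move=> j f hf; exists (tvar K n l * f); last by rewrite tofracM.
rewrite opprK; case: j hf => [m|[|m]] //; rewrite -PoszD addn1; exact: t_pow_tvar.
Qed.

Lemma inV_pd l : inV 1 (pd K n l : D).
Proof.
move=> j f hf; exists (mderiv (rshift n l) f); last by rewrite -fderiv_tofrac.
case: j hf => [[|m]|m] // hf.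
rewrite (_ : m.+1%:Z - 1 = m%:Z); first exact: t_pow_mderiv.
by rewrite -[m.+1]addn1 PoszD addrK.
Qed.

Lemma inV_mulr k P R : inV 0 R -> inV k P -> inV k (R * P).
Proof. by move=> hR hP; rewrite -[k]add0r; exact: inVM. Qed.

Lemma inV_tM k l P : inV (k + 1) P -> inV k (t_op K n l * P).
Proof.
by move=> h; rewrite -[k](addrK 1) addrC; apply: inVM => //; exact: inV_t.
Qed.

Lemma inV_ad k l P : inV k P -> inV (k + 1) (ad l P).
Proof.
move=> h; apply: inVB; last by apply: inVM => //; exact: inV_pd.
by rewrite addrC; apply: inVM => //; exact: inV_pd.
Qed.

Lemma inV_tX j k l P : inV (k + j%:Z) P -> inV k (t_op K n l ^+ j * P).
Proof.
elim: j P => [|j IH] P h; first by rewrite expr0 mul1r -[k]addr0.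
rewrite exprSr -mulrA; apply/IH/inV_tM.
by rewrite -addrA [_ + 1]addrC -intS.
Qed.

Lemma inV_iter_ad j k l P : inV k P -> inV (k + j%:Z) (iter j (ad l) P).
Proof.
move=> h; elim: j => [|j IH]; first by rewrite [k + _]addr0.
by rewrite iterS intS [1 + _]addrC addrA; exact: inV_ad.
Qed.

(** In the j-th summand t_l^j lowers the order by j, while [ad l] taken j + 1 times raises it by j +
    1: a net gain of one, whatever j. *)
Lemma inV_tquot k l P : inV k P -> inV (k + 1) (tquot l P).
Proof.
move=> h; rewrite /tquot; case: cid => N /= _; apply: inV_sum => j _.
rewrite -mulrA mulNr; apply/inVN/inV_mulr; first exact: inV_polyop.
by apply: inV_tX; rewrite -addrA -intS; exact: (inV_iter_ad j.+1).
Qed.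

Lemma inV_exhaustive P : exists k : nat, inV k P.
Proof.
elim/Dxt_ind: P => [f|i||P P' [k h] [k' h']|P P' [k h] [k' h']].
- by exists 0%N; exact: inV_polyop.
- exists 1%N; rewrite -(splitK i); case: (split i) => l /=; last exact: inV_pd.
  by apply: inV_leq (inV_x_partial l).
- by exists 0%N; exact: inV1.
- exists (maxn k k'); apply: inVB.
    by apply: inV_leq h; rewrite lez_nat leq_maxl.
  by apply: inV_leq h'; rewrite lez_nat leq_maxr.
- by exists (k + k')%N; rewrite PoszD; exact: inVM.
Qed.

Definition Dxt_act P (a : Q) : Q := val P a.

Lemma act_polyop f a : Dxt_act (polyop f) a = f%:F * a.
Proof. by []. Qed.

Lemma Dxt_actM P P' a : Dxt_act (P * P') a = Dxt_act P (Dxt_act P' a).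
Proof. by []. Qed.

Lemma Dxt_actB P P' a : Dxt_act (P - P') a = Dxt_act P a - Dxt_act P' a.
Proof. by []. Qed.

Lemma act_pd l a : Dxt_act (pd K n l) a = fderiv (rshift n l) a.
Proof. by []. Qed.

Lemma Dxt_poly P f : exists g, Dxt_act P f%:F = g%:F.
Proof.
have [k h] := inV_exhaustive P.
by have [g _ e] := h (Negz 0) f I; exists g.
Qed.

(** The operators act on fractions, so the vanishing must be extended from polynomials to f / g. The
    commutator of P with g also kills polynomials and has a smaller nilpotency exponent; moreover (g
    P - P g)(f / g) = g P(f / g), because P f = 0. *)
Lemma Dxt_eq0 P : (forall f, Dxt_act P f%:F = 0) -> P = 0.
Proof.
move=> h; apply/val_inj/endo_eq => a; change (Dxt_act P a = 0).
rewrite (fracE a); move: \n_(repr a) \d_(repr a) (denom_ratioP (repr a)) => f g g0.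
have [N] : comm_nilp (fun _ : unit => polyop g : D) P.
  elim/Dxt_ind: P {h} => [h|i||P P'|P P'].
  - by exists 1%N => _ /=; rewrite polyopC subrr.
  - exists 2%N => _ _ /=; rewrite partial_polyop opprD addrA subrr sub0r.
    by rewrite mulrN mulNr polyopC subrr.
  - exact: comm_nilp1.
  - exact: comm_nilpB.
  - exact: comm_nilpM.
have g0F := tofrac_neq0 g0.
elim: N P h => [|N IH] P h /=; first by move=> ->.
move=> /(_ tt) /IH {}IH; apply: (mulfI g0F); rewrite mulr0.
have e : Dxt_act (polyop g * P - P * polyop g) (f%:F / g%:F) = 0.
  apply: IH => f'; rewrite Dxt_actB !Dxt_actM !act_polyop h -tofracM h.
  by rewrite mulr0 subr0.
move/eqP: e; rewrite Dxt_actB !Dxt_actM !act_polyop [g%:F * (_ / _)]mulrC divfK // h.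
by rewrite subr0 => /eqP.
Qed.

Lemma ad_eq0_commute l R f : ad l R = 0 ->
  fderiv (rshift n l) (Dxt_act R f%:F) = Dxt_act R (mderiv (rshift n l) f)%:F.
Proof.
move=> h; rewrite -fderiv_tofrac -!act_pd -!Dxt_actM; apply/eqP.
by rewrite -subr_eq0 -Dxt_actB -/(ad l R) h.
Qed.

(* By Euler's relation such an R maps K[x,t] into every power of <t>. *)
Lemma const_eq0 R : (forall f, exists2 g, t_pow 1 g & Dxt_act R f%:F = g%:F) ->
  (forall l, ad l R = 0) -> R = 0.
Proof.
move=> hR hc; apply: Dxt_eq0 => f.
suff h m f' : exists2 g, t_pow m g & Dxt_act R f'%:F = g%:F.
  have [g _ e] := h 0%N f; rewrite e (@deg_ge_eq0 _ _ g) ?tofrac0 // => m.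
  apply: t_pow_deg_ge; have [g' hg' e'] := h m f.
  by move: e; rewrite e' => /eqP; rewrite tofrac_eq => /eqP <-.
elim: m f' => [|m IH] f'; first by have [g e] := Dxt_poly R f'; exists g.
case: m IH => [|m] IH; first exact: hR.
have [g hg e] := IH f'; exists g => //.
(* R commutes with d/dt_l, so the t-derivatives of the value g of R are again values of R and lie in
   <t>^(m+1). *)
have hd l : t_pow m.+1 (mderiv (rshift n l) g).
  have [g' hg' e'] := IH (mderiv (rshift n l) f').
  move: e'; rewrite -ad_eq0_commute // e fderiv_tofrac.
  by move=> /eqP; rewrite tofrac_eq => /eqP ->.
(* Euler's relation then puts (m + 1) g into <t>^(m+2), and m + 1 is invertible. *)
have : t_pow m.+2 (m.+1%:R * g).
  set s := \sum_(l < d) tvar K n l * mderiv (rshift n l) g.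
  rewrite -[X in t_pow _ X](subKr s); apply: t_powB; last exact: t_pow_euler.
  by apply: t_pow_sum => l; exact: t_pow_tvar.
move=> /(t_powM (m.+1%:R^-1)%:MP).
rewrite mulrA -mpolyC_nat -mpolyCM mulVf ?mul1r //; exact: natK_neq0.
Qed.

End VFiltration.

(** * The right ideal t D and the V-filtration *)

Section TIdeal.
Context (K : fieldType) (charK : [pchar K] =i pred0) (n d : nat).
Local Notation Kx := {mpoly K[n]}.
Local Notation Kxt := {mpoly K[n + d]}.
Local Notation D := (Dxt K n d).
Local Notation "f %:F" := (@FracField.tofrac _ f).
Local Notation t_op := (t_op K n).
Implicit Types (P R : D) (l : 'I_d) (k : int).

(** A test for membership in t_1 D + ... + t_d D on polynomials only; [maps_into_t_sum] and
    [inV_t_ideal] are its two directions. *)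
Definition maps_into_t P := forall f : Kxt,
  exists2 g, t_pow 1 g & Dxt_act P f%:F = g%:F.

Lemma maps_into_tB P P' : maps_into_t P -> maps_into_t P' -> maps_into_t (P - P').
Proof.
move=> h h' f; have [g hg e] := h f; have [g' hg' e'] := h' f.
by exists (g - g'); [exact: t_powB|rewrite Dxt_actB e e' tofracB].
Qed.

Lemma maps_into_tD P P' : maps_into_t P -> maps_into_t P' -> maps_into_t (P + P').
Proof.
move=> h h'; rewrite -[P']opprK; apply: maps_into_tB => //.
rewrite -sub0r; apply: maps_into_tB => // f; exists 0; first exact: t_pow0.
by rewrite tofrac0.
Qed.

Lemma maps_into_t_sum (F : 'I_d -> D) : maps_into_t (\sum_l t_op l * F l).
Proof.
elim/big_rec: _ => [f|l P _ h]; first by exists 0; [exact: t_pow0|rewrite tofrac0].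
apply: maps_into_tD => // f; have [g e] := Dxt_poly (F l) f.
exists (tvar K n l * g); first exact: t_pow_tvar.
by rewrite Dxt_actM e tofracM.
Qed.

(** Division by the t_l of the list, one at a time. The alternative [ad l P = 0] serves the
    induction: the recursive call gets [tconst l P], and its remainder must keep the constancy in
    t_l just gained. *)
Lemma inV_split (s : seq 'I_d) k P : uniq s -> inV k P ->
  exists R (a : 'I_d -> D), [/\ inV k R, forall l, inV (k + 1) (a l),
    P = R + \sum_l t_op l * a l &
    forall l, l \in s \/ ad l P = 0 -> ad l R = 0].
Proof.
elim: s P => [|l s IH] P /=.
  move=> _ hP; exists P, (fun=> 0); split=> // [l||l []] //; first exact: inV0.
  by rewrite big1 ?addr0 // => l _; rewrite mulr0.
case/andP=> ls us hP.
have hq : inV (k + 1) (tquot l P) by exact: inV_tquot.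
have [|R [a [hR ha e hc]]] := IH (tconst l P) us.
  by apply: inVB => //; exact: inV_tM.
exists R, (fun l' => a l' + (if l' == l then tquot l P else 0)); split=> //.
- by move=> l'; apply: inVD => //; case: eqP => // _; exact: inV0.
- under eq_bigr do rewrite mulrDr.
  rewrite big_split addrA -e /= (bigD1 l) //= eqxx big1 ?addr0 ?subrK //.
  by move=> l' /negbTE ->; rewrite mulr0.
move=> l'; rewrite inE => h; apply: hc.
have [-> | ll'] := eqVneq l' l; first by right; exact: ad_tconst.
case: h => [|h]; first by rewrite (negbTE ll'); left.
by right; apply: ad_tconst_neq => //; rewrite eq_sym.
Qed.

(** Strictness of the filtration on t D. The remainder R of the splitting is constant in every t_l
    and maps into <t>, so [const_eq0] kills it. *)
Lemma inV_t_ideal k P : inV k P -> maps_into_t P ->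
  exists2 a : 'I_d -> D, forall l, inV (k + 1) (a l) & P = \sum_l t_op l * a l.
Proof.
move=> hP ht.
have [R [a [hR ha e hc]]] := inV_split (enum_uniq 'I_d) hP.
exists a => //; rewrite e (_ : R = 0) ?add0r //; apply: const_eq0 => //.
  have -> : R = P - \sum_l t_op l * a l by rewrite e addrK.
  by apply: maps_into_tB => //; exact: maps_into_t_sum.
by move=> l; apply: hc; left; rewrite mem_enum.
Qed.

(** The image of a polynomial lies in <t>^(-k), and -k is at least 1. *)
Lemma inV_neg_t k P : k < 0 -> inV k P -> maps_into_t P.
Proof.
move=> k0 hP f; have [g hg e] := hP 0 f I; exists g => //.
by move: k0 hg; clear; case: k => [//|m] _; rewrite sub0r; exact: t_pow_leq.
Qed.
End TIdeal.

(** * The Euler operator *)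

Section Theta.
Context (K : fieldType) (n d : nat).
Local Notation Kx := {mpoly K[n]}.
Local Notation Kxt := {mpoly K[n + d]}.
Local Notation D := (Dxt K n d).
Local Notation "f %:F" := (@FracField.tofrac _ f).
Local Notation t_op := (t_op K n).
Local Notation theta := (theta K n d).
Implicit Types (P R T : D) (l : 'I_d) (k : int) (f g : {poly Kx}).

Lemma x_inclD (h h' : Kx) : x_incl d (h + h') = x_incl d h + x_incl d h'.
Proof. exact: comp_mpolyD. Qed.

Lemma x_inclM (h h' : Kx) : x_incl d (h * h') = x_incl d h * x_incl d h'.
Proof. exact: rmorphM. Qed.

Lemma x_inclC c : x_incl d (c%:MP : Kx) = c%:MP.
Proof. exact: comp_mpolyC. Qed.

Lemma x_inclX i : x_incl d ('X_i : Kx) = 'X_(lshift d i).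
Proof. by rewrite /x_incl comp_mpolyXU -tnth_nth tnth_mktuple. Qed.

Lemma mderiv_x_incl l (h : Kx) : mderiv (rshift n l) (x_incl d h) = 0.
Proof.
elim/mpoly_ring_ind: h => [c|i|f g hf hg|f g hf hg].
- by rewrite x_inclC mderivC.
- rewrite x_inclX mderivX mnm1E; case: eqP => [e|_]; last by rewrite scale0r.
  by have := ltn_ord i; have /= -> := congr1 val e; rewrite ltnNge leq_addr.
- by rewrite x_inclD mderivD hf hg addr0.
- by rewrite x_inclM mderivM hf hg mul0r mulr0 addr0.
Qed.

Definition xop (h : Kx) : D := polyop (x_incl d h).

Lemma xopD h h' : xop (h + h') = xop h + xop h'.
Proof. by rewrite /xop /x_incl raddfD polyopD. Qed.

Lemma xopM h h' : xop (h * h') = xop h * xop h'.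
Proof. by rewrite /xop /x_incl rmorphM polyopM. Qed.

Lemma xop0 : xop 0 = 0.
Proof. by rewrite /xop /x_incl raddf0 polyop0. Qed.

Lemma xop1 : xop 1 = 1.
Proof. by rewrite /xop /x_incl rmorph1 polyop1. Qed.

Lemma xopB h h' : xop (h - h') = xop h - xop h'.
Proof. by rewrite /xop /x_incl raddfB polyopB. Qed.

Lemma xopC h h' : xop h * xop h' = xop h' * xop h.
Proof. exact: polyopC. Qed.

Lemma xop_t h l : xop h * t_op l = t_op l * xop h.
Proof. exact: polyopC. Qed.

Lemma xop_int k : xop k%:~R = k%:~R.
Proof.
have xn (m : nat) : xop m%:R = m%:R.
  by elim: m => [|m IH]; [exact: xop0|rewrite !mulrS xopD IH xop1].
case: k => m; first exact: xn.
by rewrite NegzE !mulrNz -sub0r xopB xn xop0 sub0r.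
Qed.

Lemma xop_pd h l : xop h * pd K n l = pd K n l * xop h.
Proof. by rewrite /pd partial_polyop mderiv_x_incl polyop0 addr0. Qed.

Lemma xop_theta h : xop h * theta = theta * xop h.
Proof.
rewrite /theta mulr_sumr mulr_suml; apply: eq_bigr => l _.
by rewrite mulrA xop_t -!mulrA xop_pd.
Qed.

Lemma theta_t l : theta * t_op l = t_op l * (theta + 1).
Proof.
rewrite mulrDr mulr1 /theta mulr_suml mulr_sumr.
under eq_bigr do rewrite -mulrA -/(pd K n _) pd_t mulrDr.
rewrite big_split; congr (_ + _).
  by apply: eq_bigr => i _; rewrite !mulrA t_opC.
rewrite (bigD1 l) //= eqxx mulr1 big1 ?addr0 // => i /negbTE ->.
by rewrite mulr0.
Qed.

Definition theta_shift k : D := theta + k%:~R.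

Lemma int_comm k P : k%:~R * P = P * k%:~R.
Proof. by rewrite mulrzl mulrzr. Qed.

Lemma xop_theta_shift h k : xop h * theta_shift k = theta_shift k * xop h.
Proof. by rewrite /theta_shift mulrDr mulrDl xop_theta int_comm. Qed.

Lemma theta_shift_t k l : theta_shift k * t_op l = t_op l * theta_shift (k + 1).
Proof.
rewrite /theta_shift mulrDl theta_t int_comm -mulrDr; congr (_ * _).
by rewrite -addrA [1 + _]addrC intrD.
Qed.

(** For T = theta this is [eval_theta]. The values T = theta + k arise when f(theta, x) is moved to
    the other side of an operator of order k. *)
Definition evt T f : D := \sum_(c < size f) xop f`_c * T ^+ c.

Lemma evt_bound N T f : (size f <= N)%N ->
  evt T f = \sum_(c < N) xop f`_c * T ^+ c.
Proof.
move=> hN; rewrite /evt (big_ord_widen N (fun c => xop f`_c * T ^+ c)) //.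
rewrite big_mkcond; apply: eq_bigr => c _; case: ltnP => // hc.
by rewrite nth_default // xop0 mul0r.
Qed.

Lemma evtD T f g : evt T (f + g) = evt T f + evt T g.
Proof.
pose N := maxn (size f) (size g).
rewrite (@evt_bound N T (f + g)) ?size_polyD // (@evt_bound N T f) ?leq_maxl //.
rewrite (@evt_bound N T g) ?leq_maxr // -big_split; apply: eq_bigr => c _.
by rewrite coefD xopD mulrDl.
Qed.

Lemma evtC T h : evt T h%:P = xop h.
Proof.
rewrite (@evt_bound 1) ?size_polyC_leq1 // big_ord_recr big_ord0 [LHS]add0r.
by rewrite coefC eqxx mulr1.
Qed.

Lemma evtMX T f : evt T (f * 'X) = evt T f * T.
Proof.
rewrite (@evt_bound (size f).+1); last first.
  by apply: leq_trans (size_polyMleq _ _) _; rewrite size_polyX addn2.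
rewrite big_ord_recl coefMX /= xop0 mul0r add0r /evt mulr_suml.
by apply: eq_bigr => c _; rewrite coefMX /= exprSr mulrA.
Qed.

Lemma evtZ T h f : evt T (h *: f) = xop h * evt T f.
Proof.
rewrite (@evt_bound (size f)) ?size_scale_leq // mulr_sumr.
by apply: eq_bigr => c _; rewrite coefZ xopM mulrA.
Qed.

Section Commuting.
Context (T : D) (xT : forall h, xop h * T = T * xop h).

Lemma xop_evt h f : xop h * evt T f = evt T f * xop h.
Proof.
rewrite mulr_sumr mulr_suml; apply: eq_bigr => c _.
rewrite mulrA xopC -!mulrA; congr (_ * _).
by apply: commrX; exact: xT.
Qed.

Lemma evtM f g : evt T (f * g) = evt T f * evt T g.
Proof.
elim/poly_ind: g => [|g h IH].
  have evt0 : evt T 0 = 0 by rewrite -[0 in LHS]polyC0 evtC xop0.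
  by rewrite mulr0 evt0 mulr0.
rewrite mulrDr mulrA !evtD !evtMX IH mulrDr mulrA; congr (_ + _).
by rewrite evtC mulrC mul_polyC evtZ xop_evt.
Qed.

Lemma evt1 : evt T 1 = 1.
Proof. by rewrite -[1 in LHS]polyC1 evtC xop1. Qed.

Lemma evtXn f e : evt T (f ^+ e) = evt T f ^+ e.
Proof. by elim: e => [|e IH]; [rewrite !expr0 evt1|rewrite !exprS evtM IH]. Qed.
End Commuting.

Lemma evt_conj T T' R f : T * R = R * T' -> (forall h, xop h * R = R * xop h) ->
  evt T f * R = R * evt T' f.
Proof.
move=> hT hx; rewrite mulr_suml mulr_sumr; apply: eq_bigr => c _.
rewrite mulrA -hx -!mulrA; congr (_ * _).
elim: (c : nat) => [|i IH]; first by rewrite !expr0 mul1r mulr1.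
by rewrite exprSr -mulrA hT mulrA IH -mulrA -exprSr.
Qed.

Definition evk k f := evt (theta_shift k) f.

Lemma evkM k f g : evk k (f * g) = evk k f * evk k g.
Proof. by apply: evtM => h; exact: xop_theta_shift. Qed.

Lemma evk_t k l f : evk k f * t_op l = t_op l * evk (k + 1) f.
Proof. by apply: evt_conj => [|h]; [exact: theta_shift_t|exact: xop_t]. Qed.

Lemma evk_theta k f : evk k f * theta = theta * evk k f.
Proof.
apply: evt_conj => [|h]; last exact: xop_theta.
by rewrite /theta_shift mulrDr mulrDl int_comm.
Qed.

(** Factor theorem: f(s) - f(k) is divisible by s - k, and s - k becomes theta at s = theta + k. *)
Lemma evk_const k f : exists g, evk k f = xop f.[k%:~R] + theta * evk k g.
Proof.
have /factor_theorem [g e] : root (f - (f.[k%:~R])%:P) k%:~R.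
  by rewrite /root !hornerE subrr.
exists g; rewrite -evk_theta -[f in LHS](subrK (f.[k%:~R])%:P) /evk evtD addrC.
rewrite evtC e -/(evk k _) evkM; congr (_ + _ * _).
rewrite /evk -polyCN -[- _]opprK opprK evtD evtC -[X in evt _ X]mul1r evtMX.
have -> : evt (theta_shift k) 1 = 1 by rewrite -[1 in LHS]polyC1 evtC xop1.
by rewrite mul1r -sub0r xopB xop0 sub0r xop_int /theta_shift addrK.
Qed.

Lemma inV_theta : inV 0 theta.
Proof. by apply: inV_sum => l _; apply: inV_tM; exact: inV_pd. Qed.

Lemma inV_int k : inV 0 (k%:~R : D).
Proof. by rewrite -xop_int; exact: inV_polyop. Qed.

Lemma inV_theta_shift k : inV 0 (theta_shift k).
Proof. by apply: inVD; [exact: inV_theta|exact: inV_int]. Qed.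

Lemma inV_exp P e : inV 0 P -> inV 0 (P ^+ e).
Proof.
move=> h; elim: e => [|e IH]; first by rewrite expr0; exact: inV1.
by rewrite exprS; exact: inV_mulr.
Qed.

Lemma inV_evk k f : inV 0 (evk k f).
Proof.
apply: inV_sum => c _; apply: inV_mulr; first exact: inV_polyop.
exact/inV_exp/inV_theta_shift.
Qed.

Lemma t_powz_euler j (f : Kxt) : t_powz j f ->
  exists2 g, t_powz (j + 1) g & Dxt_act (theta - j%:~R) f%:F = g%:F.
Proof.
move=> h; exists (\sum_(l < d) tvar K n l * mderiv (rshift n l) f - j%:~R * f).
  case: j h => [m|[|m]] h //.
  by rewrite -PoszD addn1; exact: t_pow_euler.
have aD P P' a : Dxt_act (P + P') a = Dxt_act P a + Dxt_act P' a by [].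
have asum (F : 'I_d -> D) a : Dxt_act (\sum_l F l) a = \sum_l Dxt_act (F l) a.
  by elim/big_rec2: _ => // l P Q _ <-.
rewrite Dxt_actB asum tofracB; congr (_ - _); last first.
  rewrite -xop_int act_polyop -tofracM; congr (_ * _)%:F.
  by rewrite /x_incl rmorph_int.
rewrite rmorph_sum; apply: eq_bigr => l _.
rewrite Dxt_actM -/(pd K n l) act_pd fderiv_tofrac act_polyop.
by apply/esym; exact: tofracM.
Qed.

(** theta acts as j on <t>^j / <t>^(j+1) and as j - k on the quotient at j - k, where P arrives; in
    (theta + k) P - P theta the two values cancel. *)
Lemma inV_theta_comm k P : inV k P -> inV (k - 1) (theta_shift k * P - P * theta).
Proof.
move=> hP j f hf.
have [g hg eg] := hP j f hf.
have [g1 hg1 e1] := t_powz_euler hg.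
have [f1 hf1 ef1] := t_powz_euler hf.
have [g2 hg2 e2] := hP _ _ hf1.
exists (g1 - g2).
  rewrite opprB [_ + (1 - k)]addrA; apply: t_powzB; first by rewrite addrAC.
  exact: hg2.
have eg' : Dxt_act P f%:F = g%:F := eg.
have e2' : Dxt_act P f1%:F = g2%:F := e2.
rewrite tofracB -e1 -e2' -ef1 -eg' -!Dxt_actM -Dxt_actB.
transitivity (Dxt_act (theta_shift k * P - P * theta) f%:F); first by [].
congr (Dxt_act _ _); rewrite rmorphB /= opprB [X in _ = _ - X]mulrBr -int_comm.
by rewrite [in RHS]mulrDl mulrBl opprB -[RHS]addrA subrKA addrA -mulrDl.
Qed.

End Theta.

(** * The action of J_Y(u) on graded pieces *)

Section Torsion.
Context (K : fieldType) (n d : nat).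
Local Notation Kx := {mpoly K[n]}.
Local Notation D := (Dxt K n d).
Local Notation theta := (theta K n d).
Local Notation xop := (@xop K n d).
Local Notation theta_shift := (@theta_shift K n d).
Local Notation evk := (@evk K n d).
Implicit Types (P R T : D) (k : int) (f g : {poly Kx}).

Lemma x_nilp P : comm_nilp xop P.
Proof.
elim/Dxt_ind: P => [h|i||P P'|P P'].
- by exists 1%N => g /=; rewrite polyopC subrr.
- exists 2%N => g g' /=; rewrite partial_polyop opprD addrA subrr sub0r.
  by rewrite mulrN mulNr polyopC subrr.
- exact: comm_nilp1.
- exact: comm_nilpB.
- exact: comm_nilpM.
Qed.

Lemma theta_shift_exp_comm e k P : inV k P ->
  inV (k - 1) (theta_shift k ^+ e * P - P * theta ^+ e).
Proof.
move=> h; elim: e => [|e IH]; first by rewrite !expr0 mul1r mulr1 subrr; exact: inV0.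
have -> : theta_shift k ^+ e.+1 * P - P * theta ^+ e.+1 =
  theta_shift k * (theta_shift k ^+ e * P - P * theta ^+ e) +
  (theta_shift k * P - P * theta) * theta ^+ e.
  by rewrite mulrBr mulrBl !exprS !mulrA subrKA.
apply: inVD; first by apply: inV_mulr => //; exact: inV_theta_shift.
rewrite -[k - 1]addr0; apply: inVM; first exact: inV_theta_comm.
exact/inV_exp/inV_theta.
Qed.

(* The commutator with a polynomial in x lowers the order in the x-derivatives. *)
Lemma evk_exp_comm l k P f : inV k P -> comm_nil xop l P ->
  exists P' P'', [/\ inV k P', inV (k - 1) P'' &
    evk k f ^+ l * P = P' * evt theta f + P''].
Proof.
elim: l P => [|l IH] P hP.
  move=> -> ; exists 0, 0; split; [exact: inV0|exact: inV0|].
  by rewrite mulr0 mul0r addr0.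
move=> hn.
(* [W1] collects the commutators with the coefficients of f, which have a smaller exponent; [W2] is
   the error of moving powers of theta across P, of order k - 1. *)
pose W1 := \sum_(c < size f) (xop f`_c * P - P * xop f`_c) * theta ^+ c.
pose W2 := \sum_(c < size f) xop f`_c * (theta_shift k ^+ c * P - P * theta ^+ c).
have e : evk k f * P = P * evt theta f + (W1 + W2).
  rewrite /W1 /W2 -big_split /= mulr_suml mulr_sumr -big_split /=.
  apply: eq_bigr => c _; rewrite mulrBl mulrBr !mulrA.
  by rewrite [X in _ = _ + X]addrC subrKA addrCA subrr addr0.
have hW1 : inV k W1.
  apply: inV_sum => c _; rewrite -[k]addr0; apply: inVM; last exact/inV_exp/inV_theta.
  apply: inVB; first by apply: inV_mulr => //; exact: inV_polyop.
  by rewrite -[k]addr0; apply: inVM => //; exact: inV_polyop.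
have hW2 : inV (k - 1) W2.
  apply: inV_sum => c _; apply: inV_mulr; first exact: inV_polyop.
  exact: theta_shift_exp_comm.
have nW1 : comm_nil xop l W1.
  rewrite /W1; elim/big_ind: _ => [|x y|c _]; [exact: comm_nil0|exact: comm_nilD|].
  apply: comm_nil_mulr; last exact: hn.
  by move=> h; apply: commrX; exact: xop_theta.
have [P' [P'' [hP' hP'' e']]] := IH W1 hW1 nW1.
have hE : inV 0 (evk k f ^+ l) by exact/inV_exp/inV_evk.
exists (evk k f ^+ l * P + P'), (P'' + evk k f ^+ l * W2); split.
- by apply: inVD => //; exact: inV_mulr.
- by apply: inVD => //; exact: inV_mulr.
by rewrite exprSr -mulrA e !mulrDr e' mulrDl mulrA !addrA.
Qed.

(** On u the operator f(theta, x) equals -R with R of order -1, so the term P' f(theta, x) u of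
    [evk_exp_comm] becomes -P' R u, of order k - 1. *)
Lemma J_Y_torsion (M : lmodType D) (u : M) f k P : J_Y u f -> inV k P ->
  exists l P'', inV (k - 1) P'' /\ evk k (f ^+ l) *: (P *: u) = P'' *: u.
Proof.
case=> R hR hu hP; have [l hl] := x_nilp P.
have [P' [P'' [hP' hP'' e]]] := evk_exp_comm f hP hl.
exists l, (P'' - P' * R); split; first by apply: inVB => //; exact: inVM.
rewrite scalerA /evk evtXn => [|h]; last exact: xop_theta_shift.
rewrite -/(evk k f) e; apply/eqP; rewrite -subr_eq0 -scalerBl; apply/eqP.
by rewrite opprB addrACA subrr addr0 -mulrDr -scalerA hu scaler0.
Qed.

End Torsion.

(** * Filtered free resolutions *)

Section TMultiples.
Context (K : fieldType) (n d : nat).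
Local Notation D := (Dxt K n d).
Local Notation t_op := (t_op K n).
Local Notation xop := (@xop K n d).
Context (N : lmodType D).
Implicit Types (x y : N).

(** The subgroup t N, in general not a D-submodule: it is stable under operators that commute with
    the t_l, such as polynomials in x. *)
Definition tmod x := exists a : 'I_d -> N, x = \sum_l t_op l *: a l.

Lemma tmod0 : tmod 0.
Proof. by exists (fun=> 0); rewrite big1 // => l _; rewrite scaler0. Qed.

Lemma tmodB x y : tmod x -> tmod y -> tmod (x - y).
Proof.
move=> [a ->] [b ->]; exists (fun l => a l - b l).
by rewrite -sumrB; apply: eq_bigr => l _; rewrite scalerBr.
Qed.

Lemma tmodN x : tmod x -> tmod (- x).
Proof. by move=> h; rewrite -sub0r; apply: tmodB => //; exact: tmod0. Qed.

Lemma tmodD x y : tmod x -> tmod y -> tmod (x + y).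
Proof. by move=> hx hy; rewrite -[y]opprK; apply: tmodB => //; exact: tmodN. Qed.

Lemma tmodZ (P : D) x : (forall l, P * t_op l = t_op l * P) -> tmod x -> tmod (P *: x).
Proof.
move=> hP [a ->]; exists (fun l => P *: a l).
by rewrite scaler_sumr; apply: eq_bigr => l _; rewrite !scalerA hP.
Qed.

Lemma tmod_xop h x : tmod x -> tmod (xop h *: x).
Proof. by apply: tmodZ => l; exact: xop_t. Qed.

Lemma tmod_theta x : tmod (theta K n d *: x).
Proof.
exists (fun l => pd K n l *: x); rewrite /theta scaler_suml.
by apply: eq_bigr => l _; rewrite scalerA.
Qed.

Lemma tmod_t l x : tmod (t_op l *: x).
Proof.
exists (fun i => if i == l then x else 0).
rewrite (bigD1 l) //= eqxx big1 ?addr0 // => i /negbTE ->.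
by rewrite scaler0.
Qed.

(** Chains two congruences modulo t, each valid after multiplication by a denominator; the
    denominators multiply. *)
Lemma tmod_trans h h' (z x b y : N) : tmod (xop h *: z - x - b) ->
  tmod (xop h' *: b - y) -> tmod (xop (h' * h) *: z - (xop h' *: x + y)).
Proof.
move=> /(tmod_xop h') hz hb; have := tmodD hz hb.
by rewrite !scalerBr scalerA -xopM addrA subrK opprD addrA.
Qed.

(** The descent indexes the t_l by natural numbers; the default 0 beyond d keeps all commutation
    rules valid. *)
Definition tnat (i : nat) : D := if insub i is Some l then t_op l else 0.

Lemma tnatE (l : 'I_d) : tnat l = t_op l.
Proof. by rewrite /tnat valK. Qed.

Lemma tnatP i : tnat i = 0 \/ exists l, tnat i = t_op l.
Proof. by rewrite /tnat; case: insub => [l|]; [right; exists l|left]. Qed.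

Lemma tnatC i j : tnat i * tnat j = tnat j * tnat i.
Proof.
case: (tnatP i) => [->|[l ->]]; first by rewrite mulr0 mul0r.
case: (tnatP j) => [->|[l' ->]]; first by rewrite mulr0 mul0r.
exact: t_opC.
Qed.

Lemma tmod_tnat i x : tmod (tnat i *: x).
Proof.
by case: (tnatP i) => [->|[l ->]]; [rewrite scale0r; exact: tmod0|exact: tmod_t].
Qed.
End TMultiples.

Lemma tmod_linear K n d (N N' : lmodType (Dxt K n d)) (f : {linear N -> N'}) x :
  tmod x -> tmod (f x).
Proof.
move=> [a ->]; exists (fun l => f (a l)); rewrite linear_sum.
by apply: eq_bigr => l _; rewrite linearZ.
Qed.

(** * The descent lemma for D-modules *)

Section Near.
Context (K : fieldType) (n d : nat).
Local Notation D := (Dxt K n d).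
Context (C : nat -> lmodType D).
Definition tscale i j : {additive C j -> C j} := GRing.scale (tnat K n d i).

Context (A B : int -> forall j, C j -> Prop).

Lemma near_tmod i k j (x : C j) : near tscale A B i k x ->
  exists2 b, B k b & tmod (x - b).
Proof.
elim: i x => [|i IH] x /=; first by exists x => //; rewrite subrr; exact: tmod0.
case=> a _ /IH [b hb h]; exists b => //.
rewrite -(subrK (tnat K n d i *: a) x) addrAC; apply: tmodD => //.
exact: tmod_tnat.
Qed.

Lemma near_sum k j (b : C j) (a : 'I_d -> C j) : B k b ->
  (forall l, A (k + 1) (a l)) -> near tscale A B d k (b + \sum_l t_op K n l *: a l).
Proof.
move=> hb ha.
pose a' (i : nat) : C j := if insub i is Some l then a l else 0.
have -> : \sum_l t_op K n l *: a l = \sum_(i < d) tnat K n d i *: a' i.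
  by apply: eq_bigr => l _; rewrite tnatE /a' valK.
suff h i : (i <= d)%N -> near tscale A B i k (b + \sum_(i' < i) tnat K n d i' *: a' i').
  exact: h.
elim: i => [|i IH] hi /=; first by rewrite big_ord0 addr0.
exists (a' i); first by rewrite /a' insubT.
by rewrite big_ord_recr /= addrA addrK; apply: IH; exact: ltnW.
Qed.

Context (dC : forall j, {linear C j.+1 -> C j}).
Context (Z : int -> forall j, C j -> Prop) (J : nat -> nat -> Prop).
Context (G : Type) (mul : G -> G -> G) (e : G -> int -> D).

Definition dC_add j : {additive C j.+1 -> C j} := dC j.
Definition scale_act (g : G) k j : {additive C j -> C j} := GRing.scale (e g k).
Definition lgexact := @gexact (fun j => C j : zmodType) dC_add tscale A B Z G scale_act.

Context (A0 : forall k j, @A k j 0) (B0 : forall k j, @B k j 0).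
Context (AB : forall k j (x y : C j), A k x -> A k y -> A k (x - y)).
Context (BB : forall k j (x y : C j), B k x -> B k y -> B k (x - y)).
Context (tA : forall i k j (x : C j), A (k + 1) x -> A k (tnat K n d i *: x)).
Context (tB : forall i k j (x : C j), B (k + 1) x -> B k (tnat K n d i *: x)).
Context (eA : forall g k j (x : C j), A k x -> A k (e g k *: x)).
Context (eB : forall g k j (x : C j), B k x -> B k (e g k *: x)).
Context (e_t : forall g k l, e g k * t_op K n l = t_op K n l * e g (k + 1)).
Context (eM : forall g h k, e (mul g h) k = e g k * e h k).
Context (J_S : forall i j, J i.+1 j -> J i j).
Context (J_SS : forall i j, J i.+1 j.+1 -> J i j).
Context (dA : forall k j (x : C j.+1), J 0 j.+1 -> A k x -> A k (dC j x)).
Context (dB : forall k j (x : C j.+1), J 0 j.+1 -> B k x -> B k (dC j x)).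
Context (ddK : forall j (x : C j.+2), J 0 j.+2 -> dC j (dC j.+1 x) = 0).
Context (Zd : forall i k j (x : C j), J i.+1 j.+1 -> Z k x ->
  exists2 w, A k w & x = dC j w).
Context (regular : forall i k j (x : C j), J i.+1 j.+2 -> A (k + 1) x ->
  near tscale A B i k (tnat K n d i *: x) -> near tscale A B i (k + 1) x).

Lemma lmod_descent : (forall j, J 0 j -> lgexact 0 j) ->
  forall i j, J i j -> lgexact i j.
Proof.
move=> h0; apply: (@descent (fun j => C j : zmodType) dC_add tscale A B Z J G mul
  scale_act A0 B0 AB BB tA tB _ eA eB _ _ _ J_S J_SS _ dA dB ddK Zd regular h0).
- by move=> i l j x; rewrite /= !scalerA tnatC.
- move=> g k i j x; rewrite /= !scalerA.
  case: (tnatP K n d i) => [->|[l ->]]; first by rewrite mulr0 mul0r.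
  by rewrite e_t.
- by move=> g h k j x; rewrite /= scalerA eM.
- by move=> g k j x; rewrite /= linearZ.
- by move=> l j x _; rewrite /= linearZ.
Qed.
End Near.

(** * The shifted V-filtration on free modules *)

Section FilteredVectors.
Context (K : fieldType) (charK : [pchar K] =i pred0) (n d r : nat) (m : 'I_r -> int).
Local Notation D := (Dxt K n d).
Local Notation t_op := (t_op K n).
Implicit Types (v w : 'rV[D]_r) (k : int).

Lemma inVr0 k : inVr m k (0 : 'rV[D]_r).
Proof. by move=> i; rewrite mxE; exact: inV0. Qed.

Lemma inVrB k v w : inVr m k v -> inVr m k w -> inVr m k (v - w).
Proof. by move=> hv hw i; rewrite !mxE; exact: inVB. Qed.

Lemma inVrD k v w : inVr m k v -> inVr m k w -> inVr m k (v + w).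
Proof. by move=> hv hw i; rewrite !mxE; exact: inVD. Qed.

Lemma inVr_leq k k' v : k <= k' -> inVr m k v -> inVr m k' v.
Proof. by move=> kk hv i; apply: inV_leq (hv i); rewrite lerD2r. Qed.

Lemma inVrZ k (P : D) v : inV 0 P -> inVr m k v -> inVr m k (P *: v).
Proof. by move=> hP hv i; rewrite mxE; exact: inV_mulr. Qed.

Lemma inVr_tnat k i v : inVr m (k + 1) v -> inVr m k (tnat K n d i *: v).
Proof.
move=> hv; case: (tnatP K n d i) => [->|[l ->]]; first by rewrite scale0r; exact: inVr0.
by move=> c; rewrite mxE; apply: inV_tM; rewrite addrAC; exact: hv.
Qed.

Lemma inVr_exhaustive v : exists k, inVr m k v.
Proof.
have /fin_all_exists [c hc] : forall i, exists k : nat, inV k (v 0 i).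
  by move=> i; exact: inV_exhaustive.
(* A sum of absolute values dominates every c i + m i at once. *)
exists (\sum_i (c i + `|m i|)%N)%:Z => i; apply: inV_leq (hc i).
rewrite (bigD1 i) //=; set s := (\sum_(_ < _ | _) _)%N; lia.
Qed.

Lemma inVr_t_ideal k v : inVr m k v -> tmod v ->
  exists2 a : 'I_d -> 'rV[D]_r, forall l, inVr m (k + 1) (a l) &
    v = \sum_l t_op l *: a l.
Proof.
move=> hv [b eb].
have /fin_all_exists2 [c hc ec] : forall i, exists2 a : 'I_d -> D,
    forall l, inV (k - m i + 1) (a l) & v 0 i = \sum_l t_op l * a l.
  move=> i; apply: (inV_t_ideal charK (hv i)); rewrite eb summxE.
  by under eq_bigr do rewrite mxE; exact: maps_into_t_sum.
exists (fun l => \row_i c i l); first by move=> l i; rewrite mxE addrAC; exact: hc.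
apply/rowP => i; rewrite ec summxE; apply: eq_bigr => l _; by rewrite !mxE.
Qed.

Lemma inVr_neg_tmod k v : (forall i, k - m i < 0) -> inVr m k v -> tmod v.
Proof.
move=> hk hv.
have /fin_all_exists2 [c hc ec] : forall i, exists2 a : 'I_d -> D,
    forall l, inV (k - m i + 1) (a l) & v 0 i = \sum_l t_op l * a l.
  by move=> i; apply: (inV_t_ideal charK (hv i)); exact: inV_neg_t (hk i) (hv i).
exists (fun l => \row_i c i l).
by apply/rowP => i; rewrite ec summxE; apply: eq_bigr => l _; rewrite !mxE.
Qed.
End FilteredVectors.

(** * Homology of the graded pieces of L / tL *)

Section FilteredResolution.
Context (K : fieldType) (charK : [pchar K] =i pred0) (n d : nat).
Local Notation Kx := {mpoly K[n]}.
Local Notation D := (Dxt K n d).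
Local Notation t_op := (t_op K n).
Local Notation xop := (@xop K n d).
Local Notation evk := (@evk K n d).
Context (M : lmodType D) (r : nat -> nat) (m : forall j, 'I_(r j) -> int).
Context (psi : forall j, {linear 'rV[D]_(r j.+1) -> 'rV[D]_(r j)}).
Context (phi : {linear 'rV[D]_(r 0) -> M}).
Context (m0 : forall i, @m 0 i = 0).
Context (psi_exact : forall j, (j < d)%N -> forall v,
       psi j v = 0 <-> exists w, v = psi j.+1 w).
Context (psiV : forall j, (j <= d)%N -> forall k v,
       inVr (@m j.+1) k v -> inVr (@m j) k (psi j v)).
Context (phiV_exact : forall k v, inVr (@m 0) k v ->
       (phi v = 0 <-> exists2 w, inVr (@m 1) k w & v = psi 0 w)).
Context (psiV_exact : forall j, (j < d)%N -> forall k v, inVr (@m j.+1) k v ->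
       (psi j v = 0 <-> exists2 w, inVr (@m j.+2) k w & v = psi j.+1 w)).
Context (p : prime_idealr Kx) (f : 'I_(r 0) -> {poly Kx}).
Context (f_J : forall i, J_Y (phi (delta_mx 0 i)) (f i)).

Definition freeD j : lmodType D := 'rV[D]_(r j).
Definition inVm k j (v : freeD j) : Prop := inVr (@m j) k v.
(** Cycles of the complex augmented by M, hence the kernel of [phi] in position 0. *)
Definition cyc j : freeD j -> Prop :=
  if j is j'.+1 then fun v => psi j' v = 0 else fun v => phi v = 0.

Lemma cyc_V k j (v : freeD j) : (j <= d)%N -> inVm k v -> cyc v ->
  exists2 w : freeD j.+1, inVm k w & v = psi j w.
Proof.
case: j v => [|j] v hj hv; first by move/(phiV_exact hv).
by move/(psiV_exact hj hv).
Qed.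

Definition nonvanishing k := forall i, (f i).[k%:~R] \notin p.

Section OneStep.
Context (k : int) (k_good : nonvanishing k).

(** The multiplier is tested at the fixed k, although the descent also visits higher levels k':
    there it acts as g(theta + k', x), and moving it through the t_l back to level k turns it into
    g(theta + k, x). *)
Definition sigma := {g : {poly Kx} | g.[k%:~R] \notin p}.

Lemma sigma_mul_subproof (g h : sigma) : (sval g * sval h).[k%:~R] \notin p.
Proof. by rewrite hornerM prime_idealrM negb_or (svalP g) (svalP h). Qed.
Definition Sigma g (hg : g.[k%:~R] \notin p) : sigma :=
  exist (fun g : {poly Kx} => g.[k%:~R] \notin p) g hg.
Definition sigma_mul (g h : sigma) : sigma := Sigma (sigma_mul_subproof g h).

Definition sigma_act (g : sigma) k' : D := evk k' (sval g).
Definition Zcyc k' j (v : freeD j) := inVm k' v /\ cyc v.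
Definition Jdesc i j := ((i <= d) && (j <= d.+1))%N.
Definition Vpred k' j (v : freeD j) := inVm (k' - 1) v.

Local Notation nearL := (near (@tscale K n d freeD) inVm Vpred).
Local Notation gexactL :=
  (lgexact inVm Vpred psi Zcyc sigma_act).

(** Division by t_i recovers x from t_i x, raises the order by one and commutes with the earlier
    t_l; applied to an expression that shows t_i x to be near, it gives one for x. *)
Lemma regularL i k' j (x : freeD j) : (i < d)%N -> inVm (k' + 1) x ->
  nearL i k' (tnat K n d i *: x) -> nearL i (k' + 1) x.
Proof.
move=> id hx.
pose l := Ordinal id; have tl : tnat K n d i = t_op l by rewrite -tnatE.
pose q (v : freeD j) : freeD j := map_mx (tquot l) v.
have qB v w : q (v - w) = q v - q w.
  by apply/rowP => c; rewrite !mxE; exact: tquotB.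
have qV k'' v : inVm k'' v -> inVm (k'' + 1) (q v).
  by move=> hv c; rewrite mxE addrAC; exact: inV_tquot.
have -> : nearL i (k' + 1) x = nearL i (k' + 1) (q (tnat K n d i *: x)).
  congr nearL; apply/rowP => c; rewrite !mxE tl tquot_t //.
move: (tnat K n d i *: x) => y {x hx}.
suff h i' : (i' <= i)%N -> forall y, nearL i' k' y -> nearL i' (k' + 1) (q y).
  exact: h.
elim: i' => [|i' IH] hi {}y /=.
  by rewrite /Vpred => /qV; rewrite addrAC.
case=> a ha hn; exists (q a); first exact: qV.
have -> : tscale freeD i' j (q a) = q (tscale freeD i' j a).
  have hi' : (i' < d)%N := ltn_trans hi id.
  apply/rowP => c; rewrite !mxE (_ : tnat K n d i' = t_op (Ordinal hi')) -?tnatE //.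
  by rewrite tnatE tquot_t_neq // -val_eqE /= neq_ltn hi orbT.
by rewrite -qB; apply: IH => //; exact: ltnW.
Qed.

(** Each generator contributes a power of f_i that lowers the order of its term in M. The product of
    these powers sends phi z to phi w with w of lower order, and g z - w is a cycle. *)
Lemma gexact_base0 k' (z : freeD 0) : inVm k' z -> exists (g : sigma) x, Zcyc k' x /\
  nearL 0 k' (sigma_act g k' *: z - x).
Proof.
move=> hz; pose u i := phi (delta_mx 0 i).
have ephi v : phi v = \sum_i v 0 i *: u i.
  by rewrite {1}(row_sum_delta v) linear_sum; apply: eq_bigr => i _; rewrite linearZ.
have /fin_all_exists [e] : forall i, exists e, exists P, inV (k' - 1) P /\
    evk k' (f i ^+ e) *: (z 0 i *: u i) = P *: u i.
  by move=> i; apply: J_Y_torsion (f_J i) _; have := hz i; rewrite m0 subr0.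
move=> /fin_all_exists [P hP].
have hg : (\prod_i f i ^+ e i).[k%:~R] \notin p.
  elim/big_ind: _ => [|g h hg hh|i _].
  - by rewrite hornerC idealr1.
  - by rewrite hornerM prime_idealrM negb_or hg.
  rewrite horner_exp; elim: (e i) => [|c IH]; first by rewrite expr0 idealr1.
  by rewrite exprS prime_idealrM negb_or k_good.
pose g := Sigma hg.
(* In the i-th term of phi (g z) the factor f_i^(e_i) turns z_i u_i into P_i u_i and the other
   factors remain. *)
pose w : freeD 0 := \row_i (evk k' (\prod_(i' | i' != i) f i' ^+ e i') * P i).
have hw : inVm (k' - 1) w.
  by move=> i; rewrite mxE m0 subr0; apply: inV_mulr; [exact: inV_evk|case: (hP i)].
exists g, (evk k' (sval g) *: z - w); split; last first.
  by rewrite /= /Vpred subKr.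
split; last first.
  apply/eqP; rewrite /= linearB subr_eq0 linearZ /= !ephi scaler_sumr; apply/eqP.
  apply: eq_bigr => i _; rewrite mxE (bigD1 i) //= mulrC evkM -!scalerA.
  by case: (hP i) => _ ->.
apply: inVrB; first by apply: inVrZ => //; exact: inV_evk.
by apply: inVr_leq hw; rewrite gerBl.
Qed.

(** Filtered exactness suffices, with multiplier 1: psi z is a cycle of order k' - 1, hence psi w
    with w of the same order, and z - w is a cycle. *)
Lemma gexact_baseS k' j (z : freeD j.+1) : (j <= d)%N -> inVm k' z -> inVm (k' - 1) (psi j z) ->
  exists (g : sigma) x, Zcyc k' x /\ nearL 0 k' (sigma_act g k' *: z - x).
Proof.
move=> jd hz hdz.
have hs : (1 : {poly Kx}).[k%:~R] \notin p by rewrite hornerC idealr1.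
have hc : cyc (psi j z).
  case: j z jd hz hdz => [|j] z jd hz hdz /=.
    by have [_] := phiV_exact (psiV jd hz); apply; exists z.
  by have [_] := psi_exact jd (psi j.+1 z); apply; exists z.
have [w hw ew] := cyc_V jd hdz hc.
have e1 : evk k' 1 = 1 by apply: evt1.
exists (Sigma hs), (z - w); split; last by rewrite /= /Vpred /sigma_act e1 scale1r subKr.
split; last by rewrite /= raddfB /= ew subrr.
by apply: inVrB => //; apply: inVr_leq hw; rewrite gerBl.
Qed.

Lemma gexact_all j : (j <= d.+1)%N -> gexactL d j.
Proof.
move=> jd; apply: (@lmod_descent K n d freeD inVm Vpred psi Zcyc Jdesc sigma sigma_mul
  sigma_act); rewrite /Jdesc ?leqnn //.
- by move=> *; exact: inVr0.
- by move=> *; exact: inVr0.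
- by move=> *; exact: inVrB.
- by move=> *; exact: inVrB.
- by move=> *; exact: inVr_tnat.
- by move=> i k' j' x; rewrite /Vpred addrAC => h; exact: inVr_tnat.
- by move=> g k' j' x h; apply: inVrZ => //; exact: inV_evk.
- by move=> g k' j' x h; apply: inVrZ => //; exact: inV_evk.
- by move=> g k' l; exact: evk_t.
- by move=> g h k'; exact: evkM.
- by move=> i j' /andP [h ->]; rewrite (ltnW h).
- by move=> i j' /andP [h h']; rewrite (ltnW h) (ltnW h').
- by move=> k' j' x /andP [_ h]; exact: psiV.
- by move=> k' j' x /andP [_ h]; exact: psiV.
- move=> j' x /andP [_ h]; have [_] := psi_exact h (psi j'.+1 x).
  by apply; exists x.
- by move=> i k' j' x /andP [_ h] [hx hc]; exact: cyc_V.
- by move=> i k' j' x /andP [h _]; exact: regularL.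
- move=> [|j'] /andP [_ h] k' z hz; first by move=> _; exact: gexact_base0.
  by rewrite /bnear /= => hn; exact: gexact_baseS.
Qed.

Definition bd_near j : freeD j -> Prop :=
  if j is j'.+1 then fun z => exists2 b : freeD j', inVm (k - 1) b & tmod (psi j' z - b)
  else fun=> True.

(** The denominator h is g(k, x): modulo t it agrees with the multiplier g(theta + k, x) of the
    descent, and membership in [sigma] keeps it outside p. *)
Lemma graded_exact j (z : freeD j) : (j <= d.+1)%N -> inVm k z -> bd_near z ->
  exists h (x b : freeD j), [/\ h \notin p, inVm k x, cyc x, inVm (k - 1) b &
    tmod (xop h *: z - x - b)].
Proof.
move=> jd hz hb.
have [|g [x [[hx hc] hn]]] := gexact_all jd hz.
  case: j z jd hz hb => [//|j] z jd hz [b hb ht]; rewrite /bnear /=.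
  have hzb : inVm k (psi j z - b).
    by apply: inVrB; [exact: psiV|apply: inVr_leq hb; rewrite gerBl].
  (* By strictness the coefficients of the t_l can be taken in V^(k+1), as [near] demands. *)
  have [a ha ea] := inVr_t_ideal charK hzb ht.
  rewrite -(subrK b (psi j z)) addrC ea.
  exact: near_sum.
have {hb} [b hb ht] := near_tmod hn.
exists (sval g).[k%:~R], x, b.
split; [exact: (svalP g)|exact: hx|exact: hc|exact: hb|].
have [g' eg] := @evk_const K n d k (sval g).
have : tmod (evk k (sval g) *: z - x - b) := ht.
rewrite eg scalerDl -scalerA => {}ht.
rewrite -(addrK (theta K n d *: (evk k g' *: z)) (xop _ *: z)) -!addrA.
rewrite [- _ + _]addrC !addrA; apply: tmodB => //; exact: tmod_theta.
Qed.
End OneStep.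

Lemma xop_mem h h' : h \notin p -> h' \notin p -> h' * h \notin p.
Proof. by move=> hh hh'; rewrite prime_idealrM negb_or hh'. Qed.

Lemma V_xop k j h (v : freeD j) : inVm k v -> inVm k (xop h *: v).
Proof. by move=> hv; apply: inVrZ => //; exact: inV_polyop. Qed.

Definition bd_t j : freeD j -> Prop :=
  if j is j'.+1 then fun z => tmod (psi j' z) else fun=> True.

Lemma bd_t_near k j (z : freeD j) : bd_t z -> bd_near k z.
Proof.
case: j z => [//|j] z hz; exists 0; [exact: inVr0|by rewrite subr0].
Qed.

Lemma bd_t_rest j h (z x b : freeD j) : bd_t z -> cyc x ->
  tmod (xop h *: z - x - b) -> bd_t b.
Proof.
case: j z x b => [//|j] z x b hz /= hx /(tmod_linear (psi j)).
rewrite !raddfB /= hx subr0 linearZ /= => ht.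
rewrite -[psi j b](subKr (xop h *: psi j z)); apply: tmodB => //.
exact: tmod_xop.
Qed.

(** Each use of [graded_exact] splits off a boundary and lowers the order by one; once every k - m_i
    is negative, the rest is a multiple of t. *)
Lemma V_acyclic k0 : (forall k, k <= k0 -> nonvanishing k) ->
  forall j (z : freeD j), (j <= d)%N -> forall k, k <= k0 -> inVm k z -> bd_t z ->
  exists h (w : freeD j.+1), [/\ h \notin p, inVm k w & tmod (xop h *: z - psi j w)].
Proof.
move=> hgood j z jd k; have [N] : exists N : nat, forall i, k - N%:Z - @m j i < 0.
  exists (\sum_i `|k - @m j i|).+1 => i.
  rewrite addrAC subr_lt0; apply: le_lt_trans (ler_norm _) _.
  by rewrite -abszE ltz_nat ltnS (bigD1 i) //= leq_addr.
elim: N k z => [|N IH] k z hk kk0 hz hdz.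
  exists 1, 0; split; [by rewrite idealr1|exact: inVr0|].
  rewrite xop1 scale1r raddf0 subr0; apply: (inVr_neg_tmod charK _ hz) => i.
  by have := hk i; rewrite subr0.
have [h [x [b [hh hx hc hb ht]]]] :=
  graded_exact (hgood k kk0) (leqW jd) hz (bd_t_near k hdz).
have [||h' [w [hh' hw ht']]] := IH (k - 1) b _ _ hb (bd_t_rest hdz hc ht).
- by move=> i; have := hk i; rewrite intS opprD addrA.
- by apply: le_trans kk0; rewrite gerBl.
have [w' hw' ew'] := cyc_V jd hx hc.
exists (h' * h), (xop h' *: w' + w); split; first exact: xop_mem.
  by apply: inVrD; [exact: V_xop|apply: inVr_leq hw; rewrite gerBl].
have -> : psi j (xop h' *: w' + w) = xop h' *: x + psi j w by rewrite linearP -ew'.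
exact: tmod_trans ht ht'.
Qed.

(** The same reduction from the order of z down to k1. The part split off is only called a cycle,
    because the last position j = d + 1 is allowed. *)
Lemma V_cycles_lift k1 : (forall k, k1 < k -> nonvanishing k) ->
  forall j (z : freeD j), (j <= d.+1)%N -> bd_t z ->
  exists h (x b : freeD j), [/\ h \notin p, cyc x, inVm k1 b & tmod (xop h *: z - x - b)].
Proof.
move=> hgood j z jd.
have [N hz] : exists N : nat, inVm (k1 + N%:Z) z.
  have [k hk] := inVr_exhaustive (@m j) z; exists `|k - k1|%N.
  by apply: inVr_leq hk; rewrite -lerBlDl abszE ler_norm.
elim: N z hz => [|N IH] z hz hdz.
  exists 1, 0, z; split; [by rewrite idealr1| | |].
  - by case: (j) => [|j'] /=; exact: raddf0.
  - by rewrite -[k1]addr0.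
  by rewrite xop1 scale1r subr0 subrr; exact: tmod0.
have kN : k1 < k1 + N.+1%:Z by rewrite ltrDl.
have [h [x [b [hh hx hc hb ht]]]] :=
  graded_exact (hgood _ kN) jd hz (bd_t_near _ hdz).
have hb' : inVm (k1 + N%:Z) b by move: hb; rewrite intS [1 + _]addrC addrA addrK.
have [h' [x' [b' [hh' hc' hv' ht']]]] := IH b hb' (bd_t_rest hdz hc ht).
exists (h' * h), (xop h' *: x + x'), b'; split; [exact: xop_mem| |exact: hv'|].
  case: (j) x x' hc hc' {ht ht' hx} => [|j'] x x' /=; rewrite linearD linearZ /= => -> ->.
    by rewrite scaler0 addr0.
  by rewrite scaler0 addr0.
rewrite -addrA -opprD -addrA; apply: (tmod_trans ht).
by rewrite opprD addrA.
Qed.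

(** Now the order of the preimage w is lowered. As psi w is congruent to z in V^k1, w is a cycle in
    its graded piece, and removing a cycle of L from h w does not change the image. *)
Lemma V_boundary_lift k1 : (forall k, k1 < k -> nonvanishing k) ->
  forall j (z : freeD j) (w : freeD j.+1), (j <= d)%N -> inVm k1 z -> tmod (z - psi j w) ->
  exists h (w' : freeD j.+1), [/\ h \notin p, inVm k1 w' & tmod (xop h *: z - psi j w')].
Proof.
move=> hgood j z w jd.
have [N hw] : exists N : nat, inVm (k1 + N%:Z) w.
  have [k hk] := inVr_exhaustive (@m j.+1) w; exists `|k - k1|%N.
  by apply: inVr_leq hk; rewrite -lerBlDl abszE ler_norm.
elim: N z w hw => [|N IH] z w hw hz ht.
  exists 1, w; rewrite idealr1 xop1 scale1r; split=> //.
  by rewrite -[k1]addr0.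
have kN : k1 < k1 + N.+1%:Z by rewrite ltrDl.
have eN : k1 + N.+1%:Z - 1 = k1 + N%:Z by rewrite intS [1 + _]addrC addrA addrK.
have [|h [x [b [hh hx hc hb ht']]]] := graded_exact (hgood _ kN) (jd : (j.+1 <= d.+1)%N) hw.
  exists z; first by apply: inVr_leq hz; rewrite eN lerDl.
  by rewrite -opprB; exact: tmodN.
rewrite eN in hb.
have [|h' [w' [hh' hw' ht'']]] := IH (xop h *: z) b hb (V_xop h hz).
  move: ht' => /(tmod_linear (psi j)); rewrite !raddfB /= (hc : psi j x = 0) subr0.
  rewrite linearZ /= => h1; have := tmodD (tmod_xop h ht) h1.
  by rewrite scalerBr addrA subrK.
exists (h' * h), w'; split; [exact: xop_mem|exact: hw'|].
by move: ht''; rewrite scalerA -xopM.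
Qed.

End FilteredResolution.

(** * Regularity of projective modules *)

Section TensorElimination.
Context (R S : pzRingType) (B : bimodule R S) (N : lmodType S).

Lemma tmkDl b b' n : tmk (b + b') n = tmk b n + tmk b' n :> tens B N.
Proof. by rewrite /tmk -tens_piD; apply/tens_piE; exact: tens_addl. Qed.

Lemma tmkDr b n n' : tmk b (n + n') = tmk b n + tmk b n' :> tens B N.
Proof. by rewrite /tmk -tens_piD; apply/tens_piE; exact: tens_addr. Qed.

Lemma tmk_bal b s n : tmk (ract b s) n = tmk b (s *: n) :> tens B N.
Proof. by apply/tens_piE; exact: tens_bal. Qed.

Lemma tmkZ a b n : a *: tmk b n = tmk (a *: b) n :> tens B N.
Proof. by rewrite /tmk tens_piZ. Qed.

Lemma tmk0l n : tmk 0 n = 0 :> tens B N.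
Proof. by apply: (addrI (tmk 0 n)); rewrite -tmkDl !addr0. Qed.

Lemma tmk0r b : tmk b 0 = 0 :> tens B N.
Proof. by apply: (addrI (tmk b 0)); rewrite -tmkDr !addr0. Qed.

Lemma tens_ind (P : tens B N -> Prop) : P 0 ->
  (forall x y, P x -> P y -> P (x + y)) -> (forall b n, P (tmk b n)) ->
  forall x, P x.
Proof.
move=> P0 PD Pm x; rewrite -[x]tens_repr tens_pi_sum.
by elim: (repr x) => [|[b n] s IH]; rewrite ?big_nil // big_cons; apply: PD.
Qed.

Context (Z : zmodType) (phi : B -> N -> Z).
Context (phiDl : forall b b' n, phi (b + b') n = phi b n + phi b' n).
Context (phiDr : forall b n n', phi b (n + n') = phi b n + phi b n').
Context (phi_bal : forall b s n, phi (ract b s) n = phi b (s *: n)).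

Lemma tens_rel_sum s u : tens_rel s u ->
  \sum_(x <- s) phi x.1 x.2 = \sum_(x <- u) phi x.1 x.2.
Proof.
elim=> {s u} [s|s u _ ->|s u w _ -> _ ->|s s' u u' _ e _ e'|s u|n|b b' n|b n n'|b c n] //.
- by rewrite !big_cat e e'.
- by rewrite !big_cat /= addrC.
- rewrite big_seq1 big_nil /=.
  by apply: (addrI (phi 0 n)); rewrite -phiDl !addr0.
- by rewrite big_seq1 big_cons big_seq1 phiDl.
- by rewrite big_seq1 big_cons big_seq1 phiDr.
- by rewrite !big_seq1 /= phi_bal.
Qed.

Definition tens_elim (q : tens B N) : Z := \sum_(x <- repr q) phi x.1 x.2.

Lemma tens_elim_pi s : tens_elim (tens_pi s) = \sum_(x <- s) phi x.1 x.2.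
Proof. by apply: tens_rel_sum; exact: tens_reprK. Qed.

Lemma tens_elim_mk b n : tens_elim (tmk b n) = phi b n.
Proof. by rewrite tens_elim_pi big_seq1. Qed.

Lemma tens_elimD : {morph tens_elim : x y / x + y}.
Proof.
move=> x y; rewrite -[x]tens_repr -[y]tens_repr -tens_piD.
by rewrite !tens_elim_pi big_cat.
Qed.

Lemma tens_elim0 : tens_elim 0 = 0.
Proof. by apply: (addrI (tens_elim 0)); rewrite -tens_elimD !addr0. Qed.

End TensorElimination.

Section ProjectiveRegular.
Context (K : fieldType) (charK : [pchar K] =i pred0) (n d : nat).
Local Notation D := (Dxt K n d).
Local Notation t_op := (t_op K n).
Local Notation tnat := (tnat K n d).

Definition tspan (N : lmodType D) (i : nat) (x : N) : Prop :=
  exists a : nat -> N, x = \sum_(l < i) tnat l *: a l.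

Definition tregular (N : lmodType D) : Prop :=
  forall i (x : N), (i < d)%N -> tspan i (tnat i *: x) -> tspan i x.

(** Dividing t_i x = sum_(l < i) t_l a_l by t_i gives x = sum_(l < i) t_l q(a_l). *)
Lemma tregular_quotients (N : lmodType D) (q : 'I_d -> N -> N) :
  (forall l, zmod_morphism (q l)) -> (forall l x, q l (t_op l *: x) = x) ->
  (forall l l' x, l != l' -> q l (t_op l' *: x) = t_op l' *: q l x) ->
  tregular N.
Proof.
move=> qB qt qt' i x hi [a e].
have q0 l : q l 0 = 0 by rewrite -[0 in LHS](subrr 0) qB subrr.
have qD l y z : q l (y + z) = q l y + q l z.
  by rewrite -[z in LHS]opprK qB -[- z]sub0r qB q0 sub0r opprK.
pose l0 := Ordinal hi; exists (fun l => q l0 (a l)).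
rewrite -(qt l0 x) -(tnatE K n l0) e (big_morph _ (qD l0) (q0 l0)).
apply: eq_bigr => l _; have hl : (l < d)%N := ltn_trans (ltn_ord l) hi.
rewrite -[l : nat]/(val (Ordinal hl)) tnatE qt' // -val_eqE /=.
by rewrite neq_ltn ltn_ord orbT.
Qed.

Lemma tregular_retract (N E : lmodType D) (s : {linear N -> E}) (g : {linear E -> N}) :
  (forall x, g (s x) = x) -> tregular E -> tregular N.
Proof.
move=> gs hE i x hi [a e]; have [|b eb] := hE i (s x) hi.
  exists (fun l => s (a l)); rewrite -linearZ e linear_sum.
  by apply: eq_bigr => l _; exact: linearZ.
exists (fun l => g (b l)); rewrite -(gs x) eb linear_sum.
by apply: eq_bigr => l _; exact: linearZ.
Qed.

(** The terms of the cone of L -> F are such products. *)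
Lemma tregular_prod (N N' : lmodType D) :
  tregular N -> tregular N' -> tregular (N * N')%type.
Proof.
move=> hN hN' i [x x'] hi [a e].
have sum1 (b : nat -> N * N') : (\sum_(l < i) tnat l *: b l).1 =
    \sum_(l < i) tnat l *: (b l).1 by rewrite raddf_sum.
have sum2 (b : nat -> N * N') : (\sum_(l < i) tnat l *: b l).2 =
    \sum_(l < i) tnat l *: (b l).2 by rewrite raddf_sum.
have [|b eb] := hN i x hi; first by exists (fun l => (a l).1); rewrite -(sum1 a) -e.
have [|b' eb'] := hN' i x' hi; first by exists (fun l => (a l).2); rewrite -(sum2 a) -e.
pose c l : N * N' := (b l, b' l).
by exists c; rewrite [RHS]surjective_pairing (sum1 c) (sum2 c) /= -eb -eb'.
Qed.

Lemma tregular_rV r : tregular 'rV[D]_r.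
Proof.
apply: (tregular_quotients (q := fun l v => map_mx (tquot l) v)).
- by move=> l v w; apply/rowP => c; rewrite !mxE tquotB.
- by move=> l v; apply/rowP => c; rewrite !mxE tquot_t.
- by move=> l l' v ll'; apply/rowP => c; rewrite !mxE tquot_t_neq.
Qed.

Section FreeCover.
Context (N : lmodType D).

Definition int_D : {rmorphism int -> D} := intmul 1.
Definition int_bim : bimodule D int := ring_bimodule int_D.
(* D (x)_Z N maps onto N, and the divisions by t_l act on its left factor *)
Definition cover : lmodType D := tens int_bim (restr int_D N : lmodType int).

Definition cover_phi (a : int_bim) (x : restr int_D N) : N := (a : D) *: (x : N).

Lemma cover_eval_subproof :
  [/\ forall b b' x, cover_phi (b + b') x = cover_phi b x + cover_phi b' x,
    forall b x x', cover_phi b (x + x') = cover_phi b x + cover_phi b x' &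
    forall b s x, cover_phi (ract b s) x = cover_phi b (s *: x)].
Proof.
split=> [b b' x|b x x'|b s x]; first exact: scalerDl.
  exact: scalerDr.
by apply: esym; exact: (scalerA (b : D) (int_D s) (x : N)).
Qed.

Definition cover_eval : cover -> N := tens_elim cover_phi.

Lemma cover_eval_mk a x : cover_eval (tmk a x) = cover_phi a x.
Proof. by case: cover_eval_subproof => *; exact: tens_elim_mk. Qed.

Lemma cover_evalD x y : cover_eval (x + y) = cover_eval x + cover_eval y.
Proof. by case: cover_eval_subproof => *; exact: tens_elimD. Qed.

Lemma cover_eval0 : cover_eval 0 = 0.
Proof. by apply: (addrI (cover_eval 0)); rewrite -cover_evalD !addr0. Qed.

Lemma cover_eval_linear : linear cover_eval.
Proof.
move=> a x y; rewrite cover_evalD; congr (_ + _).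
elim/tens_ind: x => [|x x' h h'|b x].
- by rewrite scaler0 cover_eval0 scaler0.
- by rewrite scalerDr !cover_evalD h h' scalerDr.
- by rewrite tmkZ !cover_eval_mk /cover_phi scalerA.
Qed.
HB.instance Definition _ :=
  GRing.isLinear.Build D cover N *:%R cover_eval cover_eval_linear.

Lemma cover_eval_surj x : exists y, cover_eval y = x.
Proof.
exists (tmk ((1 : D) : int_bim) (x : restr int_D N)).
by rewrite cover_eval_mk /cover_phi scale1r.
Qed.

Definition cover_q_phi l (a : int_bim) (x : restr int_D N) : cover :=
  tmk (tquot l (a : D) : int_bim) x.

Definition cover_q l : cover -> cover := tens_elim (cover_q_phi l).

Lemma cover_q_subproof l :
  [/\ forall b b' x, cover_q_phi l (b + b') x = cover_q_phi l b x + cover_q_phi l b' x,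
    forall b x x', cover_q_phi l b (x + x') = cover_q_phi l b x + cover_q_phi l b x' &
    forall b s x, cover_q_phi l (ract b s) x = cover_q_phi l b (s *: x)].
Proof.
split=> [b b' x|b x x'|b s x]; rewrite /cover_q_phi.
- by rewrite -tmkDl; congr tmk; exact: raddfD.
- exact: tmkDr.
rewrite -tmk_bal; congr tmk.
by rewrite /= !mulrzr; exact: raddfMz.
Qed.

Lemma cover_q_mk l a x : cover_q l (tmk a x) = tmk (tquot l (a : D) : int_bim) x.
Proof. by case: (cover_q_subproof l) => *; exact: tens_elim_mk. Qed.

Lemma cover_qD l x y : cover_q l (x + y) = cover_q l x + cover_q l y.
Proof. by case: (cover_q_subproof l) => *; exact: tens_elimD. Qed.

Lemma cover_q0 l : cover_q l 0 = 0.
Proof. by apply: (addrI (cover_q l 0)); rewrite -cover_qD !addr0. Qed.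

Lemma tregular_cover : tregular cover.
Proof.
apply: (tregular_quotients (q := cover_q)) => [l x y|l x|l l' x ll'].
- apply/eqP; rewrite eq_sym subr_eq -cover_qD subrK; exact/eqP.
- elim/tens_ind: x => [|x x' h h'|b x]; first by rewrite scaler0 cover_q0.
    by rewrite scalerDr cover_qD h h'.
  by rewrite tmkZ cover_q_mk; congr tmk; exact: tquot_t.
- elim/tens_ind: x => [|x x' h h'|b x]; first by rewrite scaler0 cover_q0 scaler0.
    by rewrite scalerDr !cover_qD h h' scalerDr.
  by rewrite tmkZ !cover_q_mk tmkZ; congr tmk; exact: tquot_t_neq.
Qed.

(** The terms of a projective resolution may be infinitely generated, so row vectors do not suffice
    as covers; N is a retract of its tensor product with D over the integers, and regularity passes
    to retracts. *)
Lemma tregular_projective : projective N -> tregular N.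
Proof.
move=> /(_ cover N cover_eval idfun cover_eval_surj) [s hs].
exact: (tregular_retract (s := s) (g := cover_eval)) tregular_cover.
Qed.
End FreeCover.

End ProjectiveRegular.

(** * Comparison of resolutions *)

Section UnfilteredDescent.
Context (K : fieldType) (n d : nat).
Local Notation D := (Dxt K n d).
Local Notation tnat := (tnat K n d).
Context (C : nat -> lmodType D) (dC : forall j, {linear C j.+1 -> C j}).
Context (C_regular : forall j, tregular (C j)).

(** The descent with trivial filtration and trivial multipliers: [near i] becomes the span of
    multiples of the first i of the t_l. *)
Definition allA (k : int) j (x : C j) := True.
Definition zeroB (k : int) j (x : C j) := x = 0.
Definition bdZ (k : int) j (x : C j) := exists w, x = dC j w.

Local Notation near0 := (near (@tscale K n d C) allA zeroB).

Lemma near_tspan i k j (x : C j) : near0 i k x <-> tspan i x.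
Proof.
elim: i x => [|i IH] x /=.
  split=> [->|[a ->]]; last by rewrite big_ord0.
  by exists (fun=> 0); rewrite big_ord0.
split=> [[a _ /IH [b eb]]|[a ->]].
  exists (fun l => if l == i then a else b l); rewrite big_ord_recr /= eqxx.
  rewrite -(subrK (tnat i *: a) x) eb; congr (_ + _).
  by apply: eq_bigr => l _; rewrite (ltn_eqF (ltn_ord l)).
exists (a i) => //; apply/IH; exists a.
by rewrite big_ord_recr /= addrK.
Qed.

Lemma tspan_tmod j (x : C j) : tspan d x <-> tmod x.
Proof.
split=> [[a ->]|[a ->]].
  exists (fun l : 'I_d => a l); apply: eq_bigr => l _.
  by rewrite tnatE.
exists (fun i => if insub i is Some l then a l else 0).
by apply: eq_bigr => l _; rewrite tnatE valK.
Qed.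

Definition bdt j : C j -> Prop :=
  if j is j'.+1 then fun z => tmod (dC j' z) else fun=> True.

Context (J : nat -> nat -> Prop) (Jd : forall i j, J i j -> (i <= d)%N).
Context (J_S : forall i j, J i.+1 j -> J i j).
Context (J_SS : forall i j, J i.+1 j.+1 -> J i j).
Context (ddK : forall j (x : C j.+2), J 0 j.+2 -> dC j (dC j.+1 x) = 0).

(** Exactness at j modulo one more t_l uses exactness at j and at j - 1 before it, whence the two
    closure properties of [J]. *)
Lemma reduction_exact :
  (forall x : C 0, J 0 0 -> exists w, x = dC 0 w) ->
  (forall j (x : C j.+1), J 0 j.+1 -> dC j x = 0 -> exists w, x = dC j.+1 w) ->
  forall j (x : C j), J d j -> bdt x -> exists w, tmod (x - dC j w).
Proof.
move=> h0 hS j x hJ hx.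
have : lgexact allA zeroB dC bdZ (fun (_ : unit) (_ : int) => 1) d j.
  apply: (@lmod_descent K n d C allA zeroB dC bdZ J unit (fun _ _ => tt)) => //.
  - by move=> k j' x' y; rewrite /zeroB => -> ->; rewrite subrr.
  - by move=> i k j' x'; rewrite /zeroB => ->; rewrite scaler0.
  - by move=> g k j' x'; rewrite /zeroB => ->; rewrite scaler0.
  - by move=> g k l; rewrite mul1r mulr1.
  - by move=> g h k; rewrite mulr1.
  - by move=> k j' x' _; rewrite /zeroB => ->; rewrite raddf0.
  - by move=> i k j' x' _ [w ->]; exists w.
  - move=> i k j' x' hJ' _ /near_tspan h; apply/near_tspan.
    exact: C_regular (Jd hJ') h.
  move=> [|j'] hJ' k z _.
    move=> _; have [w ->] := h0 z hJ'; exists tt, (dC 0 w); split; first by exists w.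
    by rewrite /= scale1r subrr.
  rewrite /bnear /= => /(hS _ _ hJ') [w ->].
  exists tt, (dC j'.+1 w); split; first by exists w.
  by rewrite /= /zeroB scale1r subrr.
move=> /(_ 0 x I) [|g [y [[w ->] /near_tspan /tspan_tmod h]]].
  case: j x hJ hx => [//|j] x hJ hx.
  by rewrite /bnear; apply/near_tspan/tspan_tmod.
by exists w; move: h; rewrite /= scale1r.
Qed.
End UnfilteredDescent.

(** * The cone of the comparison map L -> F *)

Section Comparison.
Context (K : fieldType) (charK : [pchar K] =i pred0) (n d : nat).
Local Notation D := (Dxt K n d).
Context (M : lmodType D) (T : nat -> lmodType D).
Context (dT : forall j, {linear T j.+1 -> T j}) (eps : {linear T 0 -> M}).
Context (T_regular : forall j, tregular (T j)).
Context (T_ddK : forall j (x : T j.+2), dT j (dT j.+1 x) = 0).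
Context (T_eps : forall x, eps x = 0 <-> exists w, x = dT 0 w).
Context (T_exact : forall j (x : T j.+1), dT j x = 0 -> exists w, x = dT j.+1 w).
Context (eps_surj : forall y, exists x, eps x = y).

Lemma T_acyclic j (x : T j.+1) : (d < j.+1)%N -> tmod (dT j x) ->
  exists w, tmod (x - dT j.+1 w).
Proof.
move=> hj hx.
(* Without the augmentation the complex is not exact at position 0, so each t_l costs one position;
   hence i < j. *)
apply: (@reduction_exact K n d T dT T_regular (fun i j => (i <= d) && (i < j))%N) => //.
- by move=> i j' /andP [].
- by move=> i j' /andP [h h']; rewrite (ltnW h) (ltnW h').
- by move=> i j' /andP [h h']; rewrite (ltnW h).
- by move=> j' x' _; exact: T_exact.
- by rewrite leqnn.
Qed.

Context (r : nat -> nat).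
Local Notation L j := ('rV[D]_(r j) : lmodType D).
Context (psi : forall j, {linear 'rV[D]_(r j.+1) -> 'rV[D]_(r j)}).
Context (phi : {linear 'rV[D]_(r 0) -> M}).
Context (phi_exact : forall v, phi v = 0 <-> exists w, v = psi 0 w).
Context (psi_exact : forall j, (j < d)%N -> forall v,
       psi j v = 0 <-> exists w, v = psi j.+1 w).

Lemma lift_row (N N' : lmodType D) (g : {linear N -> N'}) s
    (f : {linear 'rV[D]_s -> N'}) :
  (forall v, exists y, g y = f v) ->
  exists h : {linear 'rV[D]_s -> N}, forall v, g (h v) = f v.
Proof.
move=> hf; have /fin_all_exists [a ha] : forall i, exists y, g y = f (delta_mx 0 i).
  by move=> i; exact: hf.
pose h (v : 'rV[D]_s) : N := \sum_i v 0 i *: a i.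
have hl : linear h.
  move=> c v w; rewrite /h scaler_sumr -big_split; apply: eq_bigr => i _ /=.
  by rewrite !mxE scalerDl scalerA.
pose hL : {linear 'rV[D]_s -> N} := HB.pack h (GRing.isLinear.Build _ _ _ _ h hl).
exists hL => v; rewrite /= /h linear_sum [in RHS](row_sum_delta v) linear_sum.
by apply: eq_bigr => i _; rewrite !linearZ ha.
Qed.

Lemma lift_chain : exists lam : forall j, {linear L j -> T j},
  (forall v, eps (lam 0 v) = phi v) /\
  (forall j, (j <= d)%N -> forall v, dT j (lam j.+1 v) = lam j (psi j v)).
Proof.
have [lam0 h0] : exists h : {linear L 0 -> T 0}, forall v, eps (h v) = phi v.
  by apply: lift_row => v; exact: eps_surj.
(* Beyond position d + 1 no lift is guaranteed; the default 0 makes the recursion total. *)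
pose step j (l : {linear L j -> T j}) : {linear L j.+1 -> T j.+1} :=
  if pselect (exists h : {linear L j.+1 -> T j.+1}, forall v, dT j (h v) = l (psi j v))
  is left e then projT1 (cid e) else \0.
pose lam := nat_rect (fun j => {linear L j -> T j}) lam0 step.
exists lam; split=> // j.
have stepP i : (exists h : {linear L i.+1 -> T i.+1}, forall v,
     dT i (h v) = lam i (psi i v)) ->
   forall v, dT i (lam i.+1 v) = lam i (psi i v).
  by move=> e v; rewrite /= {1}/step; case: pselect => // e'; case: cid.
elim: j => [|j IH] jd; apply: stepP.
  apply: (lift_row (g := dT 0) (f := lam 0 \o psi 0)) => v.
  have /T_eps [w ew] : eps (lam 0 (psi 0 v)) = 0; last by exists w; rewrite -ew.
  by rewrite h0; apply/phi_exact; exists v.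
apply: (lift_row (g := dT j.+1) (f := lam j.+1 \o psi j.+1)) => v.
have /T_exact [w ew] : dT j (lam j.+1 (psi j.+1 v)) = 0; last by exists w; rewrite -ew.
rewrite IH; last exact: ltnW.
have -> : psi j (psi j.+1 v) = 0 by apply/(psi_exact jd); exists v.
by rewrite raddf0.
Qed.

Context (lam : forall j, {linear L j -> T j}).
Context (lam0 : forall v, eps (lam 0 v) = phi v).
Context (lamE : forall j, (j <= d)%N ->
  forall v, dT j (lam j.+1 v) = lam j (psi j v)).
Context (phi_surj : forall y, exists v, phi v = y).

(** Mapping cone of [lam] with L shifted by one position; the minus sign in [cone_fun] makes
    consecutive maps compose to zero. *)
Definition cone (j : nat) : lmodType D :=
  if j is j'.+1 then (L j' * T j)%type else T 0.

Definition cone_fun j : cone j.+1 -> cone j :=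
  match j with
  | 0 => fun x => lam 0 x.1 - dT 0 x.2
  | j'.+1 => fun x => (psi j' x.1, lam j'.+1 x.1 - dT j'.+1 x.2)
  end.

Lemma cone_linear j : linear (@cone_fun j).
Proof.
have sub (N N' : lmodType D) (s : nat) (l : {linear 'rV[D]_s -> N'}) (g : {linear N -> N'})
  a v w (x y : N) : l (a *: v + w) - g (a *: x + y) = a *: (l v - g x) + (l w - g y).
  by rewrite (linearP l) (linearP g) scalerBr opprD addrACA.
case: j => [|j] a x y /=; first exact: sub.
by congr pair; [exact: linearP|exact: sub].
Qed.
HB.instance Definition _ j :=
  GRing.isLinear.Build D (cone j.+1) (cone j) *:%R (@cone_fun j) (@cone_linear j).

(** L and T both resolve M in this range, so the cone is exact, position 0 included, and reduction
    modulo t costs no position. *)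
Lemma cone_exact j (x : cone j) : (j <= d.+1)%N ->
  bdt (fun j => @cone_fun j : {linear _ -> _}) x -> exists w, tmod (x - cone_fun w).
Proof.
move=> hj hx.
apply: (@reduction_exact K n d cone (fun j => @cone_fun j) _
  (fun i j => (i <= d) && (j <= d.+1))%N) => //.
- move=> [|i]; first exact: T_regular.
  exact: (tregular_prod (@tregular_rV K charK n d (r i)) (@T_regular i.+1)).
- by move=> i j' /andP [].
- by move=> i j' /andP [h h']; rewrite (ltnW h).
- by move=> i j' /andP [h h']; rewrite (ltnW h) (ltnW h').
- move=> [|i] [v y] /andP [_ hi] /=; rewrite ltnS in hi.
    rewrite raddfB /= T_ddK subr0 lamE ?subrr //; exact: ltnW.
  have -> : psi i (psi i.+1 v) = 0 by apply/(psi_exact (ltnW hi)); exists v.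
  rewrite raddfB /= T_ddK subr0 lamE ?subrr //; exact: ltnW.
(* Position 0: [phi] is onto, so y differs from some lam v by an element of the kernel of [eps]. *)
- move=> y _; have [v hv] := phi_surj (eps y).
  have /T_eps [w hw] : eps (lam 0 v - y) = 0 by rewrite raddfB /= lam0 hv subrr.
  by exists (v, w); rewrite /= -hw subKr.
- move=> i [v y] /andP [_ hi] hv.
  have [w ew] : exists w, v = psi i w.
    case: i v y hi hv => [|i] v y hi /= hv.
      apply/phi_exact; rewrite -lam0 (_ : lam 0 v = dT 0 y).
        by apply/T_eps; exists y.
      by apply/eqP; rewrite -subr_eq0 hv.
    by case: hv => hv _; apply/(psi_exact hi).
  have hz : dT i y = lam i v.
    apply/eqP; rewrite eq_sym -subr_eq0; apply/eqP.
    by case: i v y hi hv {w ew} => [|i] v y hi /= hv //; case: hv.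
  have /T_exact [u eu] : dT i (lam i.+1 w - y) = 0.
    by rewrite raddfB /= lamE // -ew hz subrr.
  by exists (w, u); rewrite /= -ew -eu subKr.
- by rewrite leqnn.
Qed.

(** (v, y) is a cycle of the cone modulo t; the first component of a preimage is w. *)
Lemma comparison_inj j (v : L j) (y : T j.+1) : (j <= d)%N ->
  (if j is j'.+1 return L j -> Prop then fun v => tmod (psi j' v) else fun=> True) v ->
  tmod (lam j v - dT j y) -> exists w : L j.+1, tmod (v - psi j w).
Proof.
move=> jd hv hy.
have [|[w u] [a ea]] := @cone_exact j.+1 (v, y) jd.
  case: j v y jd hv hy => [|j] v y jd hv hy //=.
  case: hv hy => [a ea] [b eb]; exists (fun l => (a l, b l)).
  rewrite ea eb [RHS]surjective_pairing !raddf_sum /=.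
  by congr pair; apply: eq_bigr.
exists w, (fun l => (a l).1).
by have := congr1 fst ea; rewrite raddf_sum /=.
Qed.

(** Apply exactness to the cycle (0, y): it is congruent to the image of some (v, u), so that psi v
    is 0 and y is lam v - dT u modulo t. *)
Lemma comparison_surj j (y : T j) : (j <= d)%N ->
  (if j is j'.+1 return T j -> Prop then fun y => tmod (dT j' y) else fun=> True) y ->
  exists (v : L j) (u : T j.+1),
  (if j is j'.+1 return L j -> Prop then fun v => tmod (psi j' v) else fun=> True) v /\
  tmod (y - lam j v - dT j u).
Proof.
case: j y => [|j] y jd hy.
  have [|[v u] h] := @cone_exact 0 y isT; first by [].
  exists v, (- u); split=> //; move: h.
  by rewrite /= raddfN opprB opprK addrA addrAC.
have [|[v u] [a ea]] := @cone_exact j.+1 (0, y) (leqW jd).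
  case: j y jd hy => [|j] y jd [a ea] /=.
    exists (fun l => - a l); rewrite raddf0 sub0r ea -sumrN.
    by apply: eq_bigr => l _; rewrite scalerN.
  exists (fun l => (0, - a l)); rewrite !raddf0 sub0r ea -sumrN.
  rewrite [RHS]surjective_pairing !raddf_sum /=; congr pair.
    by rewrite big1 // => l _; rewrite scaler0.
  by apply: eq_bigr => l _; rewrite scalerN.
exists v, (- u); split.
  exists (fun l => - (a l).1); have := congr1 fst ea; rewrite raddf_sum /= sub0r.
  move=> /(congr1 -%R); rewrite opprK => ->; rewrite -sumrN.
  by apply: eq_bigr => l _; rewrite scalerN.
exists (fun l => (a l).2); have := congr1 snd ea; rewrite raddf_sum /= => <-.
by rewrite raddfN opprB opprK addrA addrAC.
Qed.

End Comparison.

(** * Truncation and localization of complexes *)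

Section Complexes.
Context (R : pzRingType).
Implicit Types C : complex R.

Lemma dsucc_surj k : exists j, k = dsucc j.
Proof. by exists (k - 1); rewrite dsuccE subrK. Qed.

Lemma boundaryE C j (x : C (dsucc j)) :
  is_boundary x <-> exists y, cdiff C j y = x.
Proof.
split=> [/is_boundaryP /(_ j erefl) //|[y <-]]; exact: IsBoundary.
Qed.

Lemma boundaryZ C k a (x : C k) : is_boundary x -> is_boundary (a *: x).
Proof.
by move=> h; rewrite -[_ *: _]addr0; apply: is_boundary_lin => //; exact: is_boundary0.
Qed.

Lemma boundaryD C k (x y : C k) : is_boundary x -> is_boundary y -> is_boundary (x + y).
Proof. by move=> h h'; rewrite -[x]scale1r; exact: is_boundary_lin. Qed.

Lemma boundaryN C k (x : C k) : is_boundary x -> is_boundary (- x).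
Proof. by rewrite -scaleN1r; exact: boundaryZ. Qed.

Context (den : R -> Prop) (den1 : den 1).

(** Isomorphism on the k-th cohomology after inverting [den], phrased without fractions. *)
Definition den_iso_at C C' (f : cmap C C') k : Prop :=
  (forall x, is_cycle x -> is_boundary (cmapf f k x) ->
     exists2 a, den a & is_boundary (a *: x)) /\
  (forall y, is_cycle y -> exists a x,
     [/\ den a, is_cycle x & is_boundary (a *: y - cmapf f k x)]).

Definition den_iso C C' (f : cmap C C') : Prop := forall k, den_iso_at f k.

Lemma den_iso_at0 C C' (f : cmap C C') k :
  (forall x : C k, x = 0) -> (forall y : C' k, y = 0) -> den_iso_at f k.
Proof.
move=> h h'; split=> [x _ _|y _].
  by exists 1 => //; rewrite (h (1 *: x)); exact: is_boundary0.
exists 1, 0; split=> //; first by rewrite /is_cycle raddf0.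
by rewrite (h' (_ - _)); exact: is_boundary0.
Qed.

Section TruncationMaps.
Context (l : int).

(** Above degree l the subcomplex divided out is zero, so the differential of x is not altered. *)
Lemma trunc_cycle C k (x : C k) : l <= k ->
  @is_cycle _ (trunc_ge l C) k (pim (trunc_sub l _ k) x) <-> is_cycle x.
Proof.
move=> lk; rewrite /is_cycle /= /trunc_diff /= quom_mapE.
split=> [h|->]; last by rewrite raddf0.
have : trunc_sub l _ (dsucc k) (cdiff C k x - 0).
  by apply/pim_eq; rewrite h raddf0.
have lk' : l < dsucc k by rewrite dsuccE ltzD1.
rewrite subr0; case=> [kl|[e _]|//].
  by have := lt_trans lk' kl; rewrite ltxx.
by move: lk'; rewrite {1}e ltxx.
Qed.

(** In degree l what is divided out consists of boundaries of C, and in higher degrees it is zero;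
    either way being a boundary is unaffected. *)
Lemma trunc_boundary C k (x : C k) : l <= k ->
  @is_boundary _ (trunc_ge l C) k (pim (trunc_sub l _ k) x) <-> is_boundary x.
Proof.
have [j ej] := dsucc_surj k; subst k => lk.
split=> [/boundaryE [y]|/boundaryE [y <-]]; last first.
  by apply/boundaryE; exists (pim _ y); rewrite /= /trunc_diff /= quom_mapE.
rewrite -[y]pim_repr /= /trunc_diff /= quom_mapE => /pim_eq.
set z := cdiff C j _; case=> [|[_ h]|/eqP].
- by rewrite ltNge lk.
- rewrite -[x](subKr z); apply: boundaryD; first exact: IsBoundary.
  exact: boundaryN.
- by rewrite subr_eq0 => /eqP <-; exact: IsBoundary.
Qed.

Lemma trunc_zero C k (x : trunc_ge l C k) : k < l -> x = 0.
Proof.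
move=> kl; rewrite -[x]pim_repr -[0](raddf0 (pim (trunc_sub l _ k))).
by apply/pim_eq; apply: Or31.
Qed.

Section Map.
Context (C C' : complex R) (f : cmap C C').

Lemma trunc_map_subproof k (x : C k) :
  trunc_sub l _ k x -> trunc_sub l _ k (cmapf f k x).
Proof.
case=> [kl|[kl h]|->]; first exact: Or31; last by rewrite raddf0; exact: Or33.
apply: Or32; split=> //; case: h {kl} => j y.
by rewrite cmapE; exact: IsBoundary.
Qed.

Definition trunc_map_fun k : {linear trunc_ge l C k -> trunc_ge l C' k} :=
  quom_map (@trunc_map_subproof k).

Lemma trunc_mapE k x : trunc_map_fun (dsucc k) (cdiff (trunc_ge l C) k x) =
  cdiff (trunc_ge l C') k (trunc_map_fun k x).
Proof. by rewrite -[x]pim_repr /= /trunc_diff /= !quom_mapE cmapE. Qed.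

Definition trunc_map : cmap (trunc_ge l C) (trunc_ge l C') := CMap trunc_mapE.

Lemma trunc_map_iso : (forall k, l <= k -> den_iso_at f k) -> den_iso trunc_map.
Proof.
move=> hf k; have [kl|lk] := ltP k l.
  by apply: den_iso_at0 => x; exact: trunc_zero.
have [inj surj] := hf k lk; split=> x; rewrite -[x]pim_repr.
  move=> /(trunc_cycle _ lk) hx; rewrite /= /trunc_map_fun /= quom_mapE.
  move=> /(trunc_boundary _ lk) hfx; have [a ha hax] := inj _ hx hfx.
  by exists a => //; rewrite -linearZ; apply/(trunc_boundary _ lk).
move=> /(trunc_cycle _ lk) hx; have [a [y [ha hy hb]]] := surj _ hx.
exists a, (pim _ y); split=> //; first exact/(trunc_cycle _ lk).
rewrite /= /trunc_map_fun /= quom_mapE -linearZ -raddfB.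
exact/(trunc_boundary _ lk).
Qed.
End Map.

Section Projection.
Context (C : complex R).

Lemma trunc_projE k (x : C k) : pim (trunc_sub l _ (dsucc k)) (cdiff C k x) =
  cdiff (trunc_ge l C) k (pim (trunc_sub l _ k) x).
Proof. by rewrite /= /trunc_diff /= quom_mapE. Qed.

Definition trunc_proj : cmap C (trunc_ge l C) :=
  @CMap R C (trunc_ge l C) (fun k => pim (trunc_sub l _ k)) trunc_projE.

Lemma trunc_proj_iso :
  (forall k, k < l -> forall x : C k, is_cycle x -> is_boundary x) ->
  den_iso trunc_proj.
Proof.
move=> hC k; have [kl|lk] := ltP k l; split=> x.
- by move=> hx _; exists 1 => //; rewrite scale1r; exact: hC hx.
- move=> _; exists 1, 0; split=> //; first by rewrite /is_cycle raddf0.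
  by rewrite (trunc_zero (_ - _)) //; exact: is_boundary0.
- by move=> _ /(trunc_boundary _ lk) h; exists 1 => //; rewrite scale1r.
rewrite -[x]pim_repr => /(trunc_cycle _ lk) hx; exists 1, (repr x); split=> //.
by rewrite scale1r subrr; exact: is_boundary0.
Qed.
End Projection.
End TruncationMaps.
End Complexes.

(** * Localization of modules and complexes at commuting denominators *)

Section OreLocalization.
Context (R S : pzRingType) (h : {rmorphism R -> S}) (h_inj : injective h).
Context (den : R -> Prop) (den1 : den 1).
Context (denM : forall a b, den a -> den b -> den (a * b)).
Context (denC : forall a b, den a -> den b -> a * b = b * a).
Context (den_inv : forall a, den a -> exists s, s * h a = 1).
Context (den_clear : forall s, exists2 a, den a & exists b, h b = h a * s).
Local Notation B := (ring_bimodule h).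

Section Module.
Context (N : lmodType R).
Implicit Types (s u : seq (B * N)).

(** [a] is a common left denominator of the coefficients in the formal sum, and y is the value of a
    times that sum in N. It replaces a normal form for tensors. *)
Fixpoint clears (a : R) (s : seq (B * N)) (y : N) : Prop :=
  if s is (b, x) :: s' then exists c y', [/\ h c = h a * (b : S), clears a s' y' &
    y = c *: x + y'] else y = 0.

Lemma clears_uniq a s y y' : clears a s y -> clears a s y' -> y = y'.
Proof.
elim: s y y' => [|[b x] s IH] y y' /=; first by move=> -> ->.
move=> [c [z [ec hz ->]]] [c' [z' [ec' hz' ->]]].
by rewrite (IH _ _ hz hz') (h_inj (etrans ec (esym ec'))).
Qed.

Lemma clears_scale b a s y : clears a s y -> clears (b * a) s (b *: y).
Proof.
elim: s y => [|[c x] s IH] y /=; first by move=> ->; rewrite scaler0.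
move=> [e [z [ee hz ->]]]; exists (b * e), (b *: z); split; last first.
- by rewrite scalerDr scalerA.
- exact: IH.
by rewrite !rmorphM ee mulrA.
Qed.

Lemma clears_cat a s u y z : clears a s y -> clears a u z -> clears a (s ++ u) (y + z).
Proof.
elim: s y => [|[c x] s IH] y /=; first by move=> ->; rewrite add0r.
move=> [e [w [ee hw ->]]] hz; exists e, (w + z); split=> //; last by rewrite addrA.
exact: IH.
Qed.

Lemma clears_ex s : exists a y, den a /\ clears a s y.
Proof.
elim: s => [|[b x] s [a [y [ha hy]]]]; first by exists 1, 0.
have [c hc [e ee]] := den_clear b.
exists (a * c), (a * e *: x + c *: y); split; first exact: denM.
exists (a * e), (c *: y); split=> //; first by rewrite !rmorphM ee mulrA.
by rewrite (denC ha hc); exact: clears_scale.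
Qed.

Lemma clears_common s u : exists a y z, [/\ den a, clears a s y & clears a u z].
Proof.
have [a [y [ha hy]]] := clears_ex s; have [b [z [hb hz]]] := clears_ex u.
exists (b * a), (b *: y), (a *: z); split; [exact: denM|exact: clears_scale|].
by rewrite (denC hb ha); exact: clears_scale.
Qed.

(** By induction over the rules of the congruence. The point is [loc_eq0]: an element of N that dies
    in the localization is killed by a denominator. *)
Lemma tens_rel_clears s u : tens_rel s u ->
  exists a y, [/\ den a, clears a s y & clears a u y].
Proof.
elim=> {s u} [s|s u _ [a [y [? ? ?]]]|s u w _ [a [y [ha h1 h2]]] _ [b [z [hb h3 h4]]]
  |s s' u u' _ [a [y [ha h1 h2]]] _ [b [z [hb h3 h4]]]|s u|x|b b' x|b x x'|b c x].
- by have [a [y [ha hy]]] := clears_ex s; exists a, y.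
- by exists a, y.
(* Transitivity: both denominators are enlarged to a b = b a, and [clears_uniq] identifies the two
   values of the middle sum. *)
- exists (b * a), (b *: y); split; [exact: denM|exact: clears_scale|].
  have h2' := clears_scale b h2; have h3' := clears_scale a h3.
  rewrite (denC ha hb) in h3'; rewrite (clears_uniq h2' h3') (denC hb ha).
  exact: clears_scale.
- exists (b * a), (b *: y + a *: z); split; first exact: denM.
    by apply: clears_cat; [|rewrite (denC hb ha)]; exact: clears_scale.
  by apply: clears_cat; [|rewrite (denC hb ha)]; exact: clears_scale.
- have [a [y [z [ha hy hz]]]] := clears_common s u.
  exists a, (y + z); split=> //; first exact: clears_cat.
  by rewrite addrC; exact: clears_cat.
- exists 1, 0; split=> //=; exists 0, 0; split=> //; first by rewrite rmorph0 mulr0.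
  by rewrite scale0r add0r.
- have [a [y [z [ha [c [_ [ec -> ey]]] [c' [_ [ec' -> ez]]]]]]] :=
    clears_common [:: (b, x)] [:: (b', x)].
  exists a, (c *: x + c' *: x); split=> //.
    exists (c + c'), 0; split=> //; first by rewrite rmorphD ec ec' mulrDr.
    by rewrite scalerDl addr0.
  exists c, (c' *: x); split=> //; exists c', 0; split=> //.
  by rewrite addr0.
- have [a [_ [ha [c [_ [ec -> _]]]]]] := clears_ex [:: (b, x)].
  exists a, (c *: x + c *: x'); split=> //.
    by exists c, 0; split=> //; rewrite scalerDr addr0.
  exists c, (c *: x'); split=> //; exists c, 0; split=> //.
  by rewrite addr0.
- have [a [_ [ha [e [_ [ee -> _]]]]]] := clears_ex [:: (b, x)].
  exists a, (e *: (c *: x)); split=> //.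
    exists (e * c), 0; split=> //; first by rewrite rmorphM ee mulrA.
    by rewrite scalerA addr0.
  by exists e, 0; split=> //; rewrite addr0.
Qed.

Definition loc (x : N) : tens B N := @tmk _ _ B N (1 : S) x.

Lemma locZ a x : loc (a *: x) = h a *: loc x.
Proof.
by rewrite /loc tmkZ -tmk_bal; congr tmk; rewrite /= /GRing.scale /= mul1r mulr1.
Qed.

Lemma locD x y : loc (x + y) = loc x + loc y.
Proof. exact: tmkDr. Qed.

Lemma locB x y : loc (x - y) = loc x - loc y.
Proof.
by apply/eqP; rewrite eq_sym subr_eq /loc -tmkDr subrK; exact/eqP.
Qed.

Lemma loc_eq0 x : loc x = 0 -> exists2 a, den a & a *: x = 0.
Proof.
move=> /(tens_piE [:: (_, x)] [::]) /tens_rel_clears.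
move=> [a [_ [ha [c [_ [ec -> ->]]] /= e]]]; exists a => //.
by move: ec e; rewrite mulr1 => /h_inj ->; rewrite addr0.
Qed.

Lemma loc_form (z : tens B N) : exists2 a, den a & exists x, h a *: z = loc x.
Proof.
elim/tens_ind: z => [|z z' [a ha [x ex]] [b hb [y ey]]|s x].
- by exists 1 => //; exists 0; rewrite scaler0 /loc tmk0r.
- exists (a * b); first exact: denM.
  exists (b *: x + a *: y); rewrite scalerDr {1}(denC ha hb) !rmorphM -!scalerA ex ey.
  by rewrite locD !locZ.
have [a ha [b eb]] := den_clear s; exists a => //; exists (b *: x).
by rewrite locZ /loc !tmkZ /GRing.scale /= -eb mulr1.
Qed.

Lemma den_cancel a (z : tens B N) : den a -> exists s : S, s *: (h a *: z) = z.
Proof. by move=> /den_inv [s e]; exists s; rewrite scalerA e scale1r. Qed.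
End Module.

Section Map.
Context (N N' : lmodType R) (f : {linear N -> N'}).
Lemma tens_map_loc x : tens_map B f (loc x) = loc (f x).
Proof. by rewrite /loc /tmk tens_map_pi. Qed.
End Map.

Section ComplexMap.
Context (C C' : complex R) (f : cmap C C').

Lemma loc_cmapE k (x : tens_complex B C k) :
  tens_map B (cmapf f (dsucc k)) (cdiff (tens_complex B C) k x) =
  cdiff (tens_complex B C') k (tens_map B (cmapf f k) x).
Proof.
rewrite /=; elim/tens_ind: x => [|x y hx hy|b x]; first by rewrite !raddf0.
  by rewrite !raddfD /= hx hy.
by rewrite /tmk !tens_map_pi /= cmapE.
Qed.

Definition loc_cmap : cmap (tens_complex B C) (tens_complex B C') :=
  @CMap S (tens_complex B C) (tens_complex B C') (fun k => tens_map B (cmapf f k))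
    loc_cmapE.

(** Classes and witnesses are fractions: they are cleared of denominators, compared in C and C', and
    the denominators are divided out at the end by [den_cancel]. *)
Lemma loc_quasi_iso : den_iso den f -> quasi_iso loc_cmap.
Proof.
move=> hf k; have [j ej] := dsucc_surj k; subst k.
have [inj surj] := hf (dsucc j); split=> z.
  move=> hz /boundaryE [w hw].
  have [a ha [x ex]] := loc_form z; have [b hb [y ey]] := loc_form w.
  have /loc_eq0 [a' ha' hx] : loc (cdiff C (dsucc j) x) = 0.
    by rewrite -tens_map_loc -ex linearZ /= (hz : tens_map _ _ z = 0) scaler0.
  have e1 : loc (b *: (a' *: cmapf f (dsucc j) x)) =
      loc (cdiff C' j ((a' * a) *: y)).
    rewrite !locZ -tens_map_loc -ex [in RHS]linearZ /= locZ -tens_map_loc -ey.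
    rewrite !linearZ /= -[tens_map B (cmapf f (dsucc j)) z]hw /= !scalerA -!rmorphM.
    by congr (h _ *: _); rewrite -mulrA (denC hb) //; exact: denM.
  have /loc_eq0 [e he] : loc (b *: (a' *: cmapf f (dsucc j) x) -
      cdiff C' j ((a' * a) *: y)) = 0 by rewrite locB e1 subrr.
  rewrite scalerBr => /eqP; rewrite subr_eq0 => /eqP e2.
  have [||g hg /boundaryE [u eu]] := inj (e *: (b *: (a' *: x))).
  - by rewrite /is_cycle !linearZ /= hx !scaler0.
  - by rewrite !linearZ /= e2 -linearZ; exact: IsBoundary.
  have hs : den (g * (e * (b * (a' * a)))) by do !apply: denM.
  have [s es] := den_cancel z hs.
  apply/boundaryE; exists (s *: loc u); rewrite /= linearZ /= tens_map_loc eu.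
  by rewrite !locZ -ex !scalerA -!rmorphM -!mulrA -[RHS]es scalerA.
move=> hz; have [a ha [x ex]] := loc_form z.
have /loc_eq0 [a' ha' hx] : loc (cdiff C' (dsucc j) x) = 0.
  by rewrite -tens_map_loc -ex linearZ /= (hz : tens_map _ _ z = 0) scaler0.
have [|e [y [he hy /boundaryE [u eu]]]] := surj (a' *: x).
  by rewrite /is_cycle linearZ.
have hs : den (e * (a' * a)) by do !apply: denM.
have [s es] := den_cancel z hs.
exists (s *: loc y).
  by rewrite /is_cycle /= linearZ /= tens_map_loc (hy : cdiff _ _ y = 0) /loc tmk0r scaler0.
apply/boundaryE; exists (s *: loc u); rewrite /= !linearZ /= !tens_map_loc eu locB.
rewrite !locZ -ex scalerBr scalerN; congr (_ - _).
by rewrite !scalerA -!rmorphM -!mulrA -[RHS]es scalerA.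
Qed.
End ComplexMap.
End OreLocalization.

Lemma bounded_above_tens R S (B : bimodule R S) (C : complex S) :
  bounded_above C -> bounded_above (tens_complex B C).
Proof.
move=> [N hN]; exists N => k Nk x.
elim/tens_ind: x => [|x y -> ->|b x] //; first by rewrite addr0.
by rewrite (hN k Nk x) tmk0r.
Qed.

Lemma bounded_above_trunc R l (C : complex R) :
  bounded_above C -> bounded_above (trunc_ge l C).
Proof.
move=> [N hN]; exists N => k Nk x; rewrite -[x]pim_repr (hN k Nk (repr x)).
exact: raddf0.
Qed.

(** * Polynomials outside p as denominators in D_n *)

Section LocalDenominators.
Context (K : fieldType) (n d : nat) (p : prime_idealr {mpoly K[n]}).
Local Notation Kx := {mpoly K[n]}.
Local Notation Kxt := {mpoly K[n + d]}.
Local Notation Q := {fraction Kxt}.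
Local Notation "f %:F" := (@FracField.tofrac Kxt f).
Implicit Types (f g : Kx) (T : endo Q).

(** The substitution t = 0 is a left inverse. *)
Lemma x_incl_inj : injective (@x_incl K n d).
Proof.
pose lq : (n + d).-tuple Kx :=
  [tuple if split i is inl j then 'X_j else 0 | i < n + d].
suff xK : cancel (@x_incl K n d) (fun h => h \mPo lq) by exact: can_inj xK.
elim/mpoly_ring_ind => [c|i|f g hf hg|f g hf hg].
- by rewrite x_inclC comp_mpolyC.
- by rewrite x_inclX comp_mpolyXU -tnth_nth tnth_mktuple (unsplitK (inl i)).
- by rewrite x_inclD comp_mpolyD hf hg.
- by rewrite x_inclM rmorphM /= hf hg.
Qed.

Definition xdx f : Dx K n d := Gen (or_introl (ex_intro _ f erefl) : Dx_gen (mulop _)).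

Definition den (a : Dx K n d) : Prop := exists2 f, f \notin p & a = xdx f.

Lemma xdx_xop f : Dx_Dxt K n d (xdx f) = xop d f.
Proof. exact: val_inj. Qed.

Lemma xdxM f g : xdx f * xdx g = xdx (f * g).
Proof.
apply/val_inj/endo_eq => a.
by rewrite /= /x_incl rmorphM tofracM mulrA.
Qed.

Lemma xdx1 : xdx 1 = 1.
Proof. by apply/val_inj/endo_eq => a; rewrite /= /x_incl rmorph1 tofrac1 mul1r. Qed.

Lemma den1 : den 1.
Proof. by exists 1; rewrite ?idealr1 ?xdx1. Qed.

Lemma notinM f g : f \notin p -> g \notin p -> f * g \notin p.
Proof. by move=> hf hg; rewrite prime_idealrM negb_or hf. Qed.

Lemma denM a b : den a -> den b -> den (a * b).
Proof.
by move=> [f hf ->] [g hg ->]; exists (f * g); [exact: notinM|exact: xdxM].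
Qed.

Lemma denC a b : den a -> den b -> a * b = b * a.
Proof. by move=> [f _ ->] [g _ ->]; rewrite !xdxM mulrC. Qed.

Lemma x_incl_neq0 f : f \notin p -> (x_incl d f)%:F != 0.
Proof.
move=> hf; apply: tofrac_neq0; apply: contra hf => /eqP e.
by rewrite (x_incl_inj (etrans e (esym (raddf0 _)))) idealr0.
Qed.

Lemma den_inv a : den a -> exists s, s * Dx_Dxp d p a = 1.
Proof.
move=> [f hf ->].
have hg : Dxp_gen p (mulop ((x_incl d 1)%:F / (x_incl d f)%:F)).
  by left; exists 1, f.
exists (Gen hg : Dxp d p); apply/val_inj/endo_eq => a'.
transitivity ((x_incl d 1)%:F / (x_incl d f)%:F * ((x_incl d f)%:F * a')); first by [].
by rewrite /x_incl rmorph1 tofrac1 mul1r mulKf // x_incl_neq0.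
Qed.

Definition x_mulop f : endo Q := mulop (x_incl d f)%:F.

Lemma x_mulopM f g : x_mulop (f * g) = x_mulop f * x_mulop g.
Proof. by apply: endo_eq => a; rewrite /= /x_incl rmorphM tofracM mulrA. Qed.

Lemma x_mulopC f g : x_mulop f * x_mulop g = x_mulop g * x_mulop f.
Proof. by rewrite -!x_mulopM mulrC. Qed.

Lemma x_mulop_gen f : generated (@Dx_gen K n d) (x_mulop f).
Proof. by apply: gen_in; left; exists f. Qed.

Lemma mderiv_lshift i f : mderiv (lshift d i) (x_incl d f) = x_incl d (mderiv i f).
Proof.
elim/mpoly_ring_ind: f => [c|j|f g hf hg|f g hf hg].
- by rewrite x_inclC !mderivC -mpolyC0 x_inclC.
- rewrite x_inclX !mderivX !mnm1E (inj_eq (@lshift_inj _ _)).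
  case: eqP => [->|_]; last by rewrite !scale0r -mpolyC0 x_inclC.
  rewrite -[X in 'X_[X - _]]add0m addmK -[X in 'X_[X - U_(i)]]add0m addmK.
  by rewrite !mpolyX0 !scale1r -mpolyC1 x_inclC.
- by rewrite x_inclD !mderivD x_inclD hf hg.
- by rewrite x_inclM !mderivM x_inclD !x_inclM hf hg.
Qed.

(** The left Ore condition. For a derivation D it is the identity g^2 D = (g D - D(g)) g;
    differences multiply the two denominators and products chain them. *)
Lemma Dx_ore T : generated (@Dx_gen K n d) T -> forall g, g \notin p ->
  exists2 g', g' \notin p & exists2 T', generated (@Dx_gen K n d) T' &
    x_mulop g' * T = T' * x_mulop g.
Proof.
elim=> {T} [T hT||S T _ IS _ IT|S T _ IS _ IT] g hg.
- case: hT => [[f ->]|[i ->]].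
    exists g => //; exists (x_mulop f); [exact: x_mulop_gen|exact: x_mulopC].
  exists (g * g); first exact: notinM.
  exists (x_mulop g * derop K (lshift d i) - x_mulop (mderiv i g)).
    apply: gen_B; last exact: x_mulop_gen.
    by apply: gen_M; [exact: x_mulop_gen|apply: gen_in; right; exists i].
  rewrite x_mulopM; apply: endo_eq => a; set G := (x_incl d g)%:F.
  transitivity (G * fderiv (lshift d i) (G * a) -
    (x_incl d (mderiv i g))%:F * (G * a)); last by [].
  rewrite fderivM fderiv_tofrac mderiv_lshift mulrDr.
  by rewrite [X in X + _ - _]mulrCA addrC addKr.
- exists g => //; exists 1; first exact: gen_1.
  by rewrite mulr1 mul1r.
- have [a ha [S' gS' eS]] := IS g hg; have [b hb [T' gT' eT]] := IT g hg.
  exists (b * a); first exact: notinM.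
  exists (x_mulop b * S' - x_mulop a * T').
    by apply: gen_B; apply: gen_M => //; exact: x_mulop_gen.
  rewrite mulrBl -!mulrA -eS -eT mulrBr x_mulopM -[x_mulop b * x_mulop a * S]mulrA.
  by rewrite (x_mulopC b) -[x_mulop a * x_mulop b * T]mulrA.
- have [b hb [T' gT' eT]] := IT g hg; have [a ha [S' gS' eS]] := IS b hb.
  exists a => //; exists (S' * T'); first exact: gen_M.
  by rewrite mulrA eS -!mulrA eT.
Qed.

(** In a product S T the denominator of T stands between the factors; the Ore condition moves it to
    the left of S. *)
Lemma Dxp_clear T : generated (@Dxp_gen K n d p) T ->
  exists2 g, g \notin p & generated (@Dx_gen K n d) (x_mulop g * T).
Proof.
elim=> {T} [T hT||S T _ IS _ IT|S T _ IS _ IT].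
- case: hT => [[f [g [hg ->]]]|[i ->]].
    exists g => //; rewrite (_ : x_mulop g * _ = x_mulop f); first exact: x_mulop_gen.
    apply: endo_eq => a; rewrite endoME /= mulrA mulrCA mulfV ?mulr1 //.
    exact: x_incl_neq0.
  exists 1; first by rewrite idealr1.
  apply: gen_M; first exact: x_mulop_gen.
  by apply: gen_in; right; exists i.
- exists 1; first by rewrite idealr1.
  by rewrite mulr1; exact: x_mulop_gen.
- have [a ha hS] := IS; have [b hb hT] := IT.
  exists (a * b); first exact: notinM.
  rewrite mulrBr {1}[a * b]mulrC !x_mulopM -!mulrA.
  by apply: gen_B; apply: gen_M => //; exact: x_mulop_gen.
- have [a ha hS] := IS; have [b hb hT] := IT.
  have [c hc [S' gS' eS]] := Dx_ore hS hb.
  exists (c * a); first exact: notinM.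
  by rewrite x_mulopM mulrA -[x_mulop c * x_mulop a * S]mulrA eS -mulrA; exact: gen_M.
Qed.

Lemma den_clear (s : Dxp d p) :
  exists2 a, den a & exists b, Dx_Dxp d p b = Dx_Dxp d p a * s.
Proof.
have [g hg gT] := Dxp_clear (subring_genP s).
exists (xdx g); first by exists g.
exists (exist (fun x => x \in genb (@Dx_gen K n d)) _ (asboolT gT)).
exact: val_inj.
Qed.

Lemma Dx_Dxp_inj : injective (Dx_Dxp d p).
Proof. by move=> a b /(congr1 val) e; exact: val_inj. Qed.

End LocalDenominators.

(** * Restriction to t = 0 *)

Section TensorDYX.
Context (K : fieldType) (n d : nat) (N : lmodType (Dxt K n d)).
Local Notation D := (Dxt K n d).
Local Notation DYX := (DYX K n d).
Local Notation t_op := (t_op K n).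
Implicit Types (x y : N).

Definition tens_unit x : tens DYX N := tmk (DYX_class 1 : DYX) x.

Lemma tmk_class (P : D) x : tmk (DYX_class P : DYX) x = tens_unit (P *: x).
Proof.
rewrite /tens_unit -tmk_bal; congr tmk; apply/esym.
by apply: etrans (DYX_ractE _ _) _; rewrite mul1r.
Qed.

Lemma tens_unitD x y : tens_unit (x + y) = tens_unit x + tens_unit y.
Proof. exact: tmkDr. Qed.

Lemma tens_unitB x y : tens_unit (x - y) = tens_unit x - tens_unit y.
Proof. by apply/eqP; rewrite eq_sym subr_eq -tens_unitD subrK; exact/eqP. Qed.

Lemma tens_unit0 : tens_unit 0 = 0.
Proof. exact: tmk0r. Qed.

Lemma tens_unitZ a x : tens_unit (Dx_Dxt K n d a *: x) = a *: tens_unit x.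
Proof.
rewrite -tmk_class /tens_unit tmkZ; congr tmk.
by rewrite -[Dx_Dxt K n d a]mulr1; exact: DYX_classZ.
Qed.

Lemma tens_unit_surj (z : tens DYX N) : exists x, z = tens_unit x.
Proof.
elim/tens_ind: z => [|z z' [x ->] [y ->]|b x].
- by exists 0; rewrite tens_unit0.
- by exists (x + y); rewrite tens_unitD.
- have [P ->] := DYX_class_surj (b : DYX_left K n d).
  by exists (P *: x); rewrite -tmk_class.
Qed.

Definition tmod_submodule : submodule (restr (Dx_Dxt K n d) N : lmodType _).
Proof.
exists (fun x : restr (Dx_Dxt K n d) N => tmod (x : N));
  [exact: tmod0|exact: tmodD|].
by move=> a x; apply: tmodZ => l; exact: Dx_t_op.
Defined.

(** Any representative of the class may be used: by [tmod_phi_class] the choice does not matter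
    modulo t. *)
Definition tmod_phi (b : DYX) (x : N) : quom tmod_submodule :=
  pim tmod_submodule (repr (b : quom (t_ideal K n d)) *: x : N).

Lemma t_ideal_tmod (P : D) x : t_ideal K n d P -> tmod (P *: x).
Proof.
move=> [R ->]; exists (fun l => R l *: x).
by rewrite scaler_suml; apply: eq_bigr => l _; rewrite scalerA.
Qed.

Lemma repr_class (P : D) : t_ideal K n d ((repr (DYX_class P : quom (t_ideal K n d)) : D) - P).
Proof. by apply/pim_eq; rewrite pim_repr. Qed.

Lemma tmod_phi_class (P : D) x :
  tmod_phi (DYX_class P : DYX) x = pim tmod_submodule (P *: x : N).
Proof.
apply/pim_eq; change (tmod ((repr (DYX_class P : quom (t_ideal K n d)) : D) *: x - P *: x)).
by rewrite -scalerBl; apply: t_ideal_tmod; exact: repr_class.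
Qed.

Lemma tmod_phi_balanced :
  [/\ forall b b' x, tmod_phi (b + b') x = tmod_phi b x + tmod_phi b' x,
    forall b x y, tmod_phi b (x + y) = tmod_phi b x + tmod_phi b y &
    forall b s x, tmod_phi (ract b s) x = tmod_phi b (s *: x)].
Proof.
split=> [b b' y|b y y'|b s y].
- have [P ->] := DYX_class_surj (b : DYX_left K n d).
  have [P' ->] := DYX_class_surj (b' : DYX_left K n d).
  by rewrite -DYX_classD !tmod_phi_class scalerDl; exact: pimD.
- by rewrite /tmod_phi scalerDr; exact: pimD.
- have [P ->] := DYX_class_surj (b : DYX_left K n d).
  rewrite (_ : ract _ s = (DYX_class (P * s) : DYX)); last exact: DYX_ractE.
  by rewrite !tmod_phi_class scalerA.
Qed.

(** Nonvanishing of a tensor is detected by a balanced map, here P (x) y -> P y modulo t N. With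
    surjectivity of [tens_unit] this identifies D_{Y->X} (x) N with N / t N. *)
Lemma tens_unit_eq0 x : tens_unit x = 0 <-> tmod x.
Proof.
split=> [e|[a ->]].
  have [hl hr hb] := tmod_phi_balanced.
  have := tens_elim_mk hl hr hb (DYX_class 1 : DYX) x.
  rewrite -/(tens_unit x) e tens_elim0 // tmod_phi_class scale1r => /esym.
  by rewrite -(raddf0 (pim tmod_submodule)) => /pim_eq; rewrite subr0.
elim/big_rec: _ => [|l y _ h]; first exact: tens_unit0.
rewrite tens_unitD h addr0 -tmk_class (_ : DYX_class _ = 0) ?tmk0l //.
rewrite -(raddf0 (pim (t_ideal K n d))); apply/DYX_classE.
exists (fun i => if i == l then 1 else 0); rewrite subr0 (bigD1 l) //= eqxx mulr1.
by rewrite big1 ?addr0 // => i /negbTE ->; rewrite mulr0.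
Qed.
End TensorDYX.

Lemma tens_map_unit K n d (N N' : lmodType (Dxt K n d)) (f : {linear N -> N'}) x :
  tens_map (DYX K n d) f (tens_unit x) = tens_unit (f x).
Proof. by rewrite /tens_unit /tmk tens_map_pi. Qed.

(** * Vectors over D representing elements of the complex V *)

Section Representatives.
Context (K : fieldType) (n d : nat).
Local Notation D := (Dxt K n d).
Local Notation DYX := (DYX K n d).
Context (r : nat -> nat) (m : forall j, 'I_(r j) -> int).

Definition cls s (v : 'rV[D]_s) : DYXr K n d s := [ffun i => (DYX_class (v 0 i) : DYX)].

Lemma clsB s (v w : 'rV[D]_s) : cls (v - w) = cls v - cls w.
Proof.
apply/ffunP => i; rewrite !(ffunE, mxE).
exact: (raddfB (pim (t_ideal K n d))).
Qed.

Lemma clsZ s a (v : 'rV[D]_s) : cls (Dx_Dxt K n d a *: v) = a *: cls v.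
Proof. by apply/ffunP => i; rewrite !(ffunE, mxE); exact: DYX_classZ. Qed.

Lemma cls_eq0 s (v : 'rV[D]_s) : cls v = 0 <-> tmod v.
Proof.
split=> [e|[a ->]].
  have /fin_all_exists [c ec] : forall i, exists a : 'I_d -> D,
      v 0 i = \sum_l t_op K n l * a l.
    move=> i; have := congr1 (fun q : DYXr K n d s => q i) e; rewrite !ffunE.
    rewrite -(raddf0 (pim (t_ideal K n d))) => /DYX_classE [R].
    by rewrite subr0 => ->; exists R.
  exists (fun l => \row_i c i l).
  by apply/rowP => i; rewrite ec summxE; apply: eq_bigr => l _; rewrite !mxE.
apply/ffunP => i; rewrite !ffunE summxE -(raddf0 (pim (t_ideal K n d))).
apply/DYX_classE; exists (fun l => a l 0 i); rewrite subr0.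
by apply: eq_bigr => l _; rewrite mxE.
Qed.

Lemma VDYX_cls s (m' : 'I_s -> int) k q :
  VDYX K n d m' k q <-> exists2 v, inVr m' k v & q = cls v.
Proof.
split=> [[v hv e]|[v hv ->]]; exists v => //; last by move=> i; rewrite ffunE.
by apply/ffunP => i; rewrite ffunE e.
Qed.

Context (psi : forall j, {linear 'rV[D]_(r j.+1) -> 'rV[D]_(r j)}).
Context (psiV : forall j, (j <= d)%N -> forall k v,
  inVr (@m j.+1) k v -> inVr (@m j) k (psi j v)).
Local Notation Vterm := (Vterm K n d m).

Lemma psibar_cls j (v : 'rV[D]_(r j.+1)) : psibar (psi j) (cls v) = cls (psi j v).
Proof.
apply/ffunP => i; rewrite [RHS]ffunE; apply: psibar_class => c; by rewrite ffunE.
Qed.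

Definition kills (k0 : option int) j (v : 'rV[D]_(r j)) : Prop :=
  if k0 is Some k then exists2 w, inVr (@m j) k w & tmod (v - w) else tmod v.

Lemma Vterm_cls k0 j (v : 'rV[D]_(r j)) : (j <= d.+1)%N ->
  Vterm k0 j (cls v) <-> kills k0 v.
Proof.
rewrite /Defs.Vterm; case: k0 => [k|] jd; last exact: cls_eq0.
rewrite jd /=; split=> [/VDYX_cls [w hw e]|[w hw e]].
  by exists w => //; apply/cls_eq0; rewrite clsB e subrr.
apply/VDYX_cls; exists w => //; apply/eqP; rewrite -subr_eq0 -clsB; apply/eqP.
exact/cls_eq0.
Qed.

Section Fixed.
Context (k0 : option int) (k1 : int).
Local Notation V_term := (V_term K n d m k0 k1).

(** Elements of the nested subquotient are handled through vectors over D, so that equations in the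
    complex become congruences modulo t and V^k0. *)
Definition represents j (x : V_term j) (v : 'rV[D]_(r j)) : Prop :=
  exists y : subm (Vterm (Some k1) j),
    x = pim (sm_trace (Vterm (Some k1) j) (Vterm k0 j)) y /\ val y = cls v.

Lemma rep_ex j (x : V_term j) : (j <= d.+1)%N ->
  exists2 v, inVr (@m j) k1 v & represents x v.
Proof.
move=> jd; set y := repr (x : quom (sm_trace (Vterm (Some k1) j) (Vterm k0 j))).
have /asboolP := valP y; rewrite {1}/Defs.Vterm jd => /VDYX_cls [v hv e].
by exists v => //; exists y; split=> //; rewrite pim_repr.
Qed.

Lemma ex_rep j (v : 'rV[D]_(r j)) : (j <= d.+1)%N -> inVr (@m j) k1 v ->
  exists x : V_term j, represents x v.
Proof.
move=> jd hv; have h : Vterm (Some k1) j (cls v).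
  by rewrite /Defs.Vterm jd; apply/VDYX_cls; exists v.
by exists (pim _ (Subm h)), (Subm h).
Qed.

Lemma rep_eq0 j (x : V_term j) v : (j <= d.+1)%N -> represents x v -> x = 0 <-> kills k0 v.
Proof.
move=> jd [y [-> e]]; rewrite -Vterm_cls // -e.
set S := sm_trace _ _; split=> [h|h]; last first.
  by rewrite -(raddf0 (pim S)); apply/pim_eq; rewrite subr0.
have : pim S y = pim S 0 by rewrite raddf0.
by move=> /pim_eq; rewrite subr0.
Qed.

Lemma repB j (x x' : V_term j) v v' :
  represents x v -> represents x' v' -> represents (x - x') (v - v').
Proof.
move=> [y [-> e]] [y' [-> e']]; exists (y - y'); split; first by rewrite raddfB.
by rewrite raddfB /= e e' clsB.
Qed.

Lemma repZ j a (x : V_term j) v : represents x v -> represents (a *: x) (Dx_Dxt K n d a *: v).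
Proof.
move=> [y [-> e]]; exists (a *: y); split; first by rewrite linearZ.
by rewrite linearZ /= e clsZ.
Qed.

Lemma rep_diff j (x : V_term j.+1) v : represents x v ->
  represents (V_diff psiV k0 k1 j x) (psi j v).
Proof.
move=> [y [-> e]].
exists (subm_map (@Vterm_psibar K n d r m psi psiV (Some k1) j) y); split.
  exact: quom_mapE.
by rewrite /= e psibar_cls.
Qed.
End Fixed.

Section ToQuotient.
Context (k0 : option int) (k1 : int).

Lemma Vquot_subproof j (x : subm (Vterm (Some k1) j)) :
  sm_trace (Vterm (Some k1) j) (Vterm None j) x ->
  sm_trace (Vterm (Some k1) j) (Vterm k0 j) (idfun x).
Proof. by move=> /= ->; exact: sm0. Qed.

Definition Vquot j : {linear V_term K n d m None k1 j -> V_term K n d m k0 k1 j} :=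
  quom_map (@Vquot_subproof j).

Lemma rep_Vquot j (x : V_term K n d m None k1 j) v : represents x v -> represents (Vquot j x) v.
Proof. by move=> [y [-> e]]; exists y; split=> //; exact: quom_mapE. Qed.
End ToQuotient.

Section ToTensor.
Context (k1 : int) (j : nat) (N : lmodType D) (f : {linear 'rV[D]_(r j) -> N}).
Local Notation S := (sm_trace (Vterm (Some k1) j) (Vterm None j)).

(** Given by a formula in the classes q i, because a lift of q to a vector over D is not unique. *)
Definition Vtens_row (q : DYXr K n d (r j)) : tens DYX N :=
  \sum_i tmk (q i) (f (delta_mx 0 i)).

Lemma Vtens_row_linear : linear Vtens_row.
Proof.
move=> a q q'; rewrite /Vtens_row scaler_sumr -big_split; apply: eq_bigr => i _ /=.
by rewrite !ffunE tmkDl tmkZ.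
Qed.
HB.instance Definition _ :=
  GRing.isLinear.Build (Dx K n d) (DYXr K n d (r j)) (tens DYX N) *:%R
    Vtens_row Vtens_row_linear.

Lemma Vtens_row_cls v : Vtens_row (cls v) = tens_unit (f v).
Proof.
rewrite /Vtens_row [in RHS](row_sum_delta v) linear_sum.
rewrite (big_morph _ (@tens_unitD K n d N) (tens_unit0 N)); apply: eq_bigr => i _.
by rewrite ffunE tmk_class linearZ.
Qed.

(** With k0 = -oo the submodule divided out is zero, so the representative carries no choice. *)
Definition Vtens (x : V_term K n d m None k1 j) : tens DYX N :=
  Vtens_row (val (repr (x : quom S))).

Lemma Vtens_pim y : Vtens (pim S y) = Vtens_row (val y).
Proof.
rewrite /Vtens; have h : S (repr (pim S y) - y) by apply/pim_eq; rewrite pim_repr.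
have e : val (repr (pim S y)) - val y = 0 by exact: h.
by move/eqP: e; rewrite subr_eq0 => /eqP ->.
Qed.

Lemma Vtens_linear : linear Vtens.
Proof.
move=> a x x'.
have [y ->] : exists y, x = pim S y by exists (repr (x : quom S)); rewrite pim_repr.
have [y' ->] : exists y, x' = pim S y by exists (repr (x' : quom S)); rewrite pim_repr.
have -> : a *: pim S y + pim S y' = pim S (a *: y + y') by rewrite linearP.
by rewrite !Vtens_pim; exact: (Vtens_row_linear a (val y) (val y')).
Qed.
HB.instance Definition _ :=
  GRing.isLinear.Build (Dx K n d) (V_term K n d m None k1 j) (tens DYX N) *:%R
    Vtens Vtens_linear.

Lemma rep_Vtens x v : represents x v -> Vtens x = tens_unit (f v).
Proof. by move=> [y [-> e]]; rewrite Vtens_pim e Vtens_row_cls. Qed.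
End ToTensor.
End Representatives.

(** * Proof of the theorem *)

Section Assembly.
Context (K : fieldType) (charK : [pchar K] =i pred0) (n d : nat).
Local Notation Kx := {mpoly K[n]}.
Local Notation D := (Dxt K n d).
Local Notation DYX := (DYX K n d).
Local Notation xop := (@xop K n d).
Local Notation xdx := (@xdx K n d).
Context (M : lmodType D) (r : nat -> nat) (m : forall j, 'I_(r j) -> int).
Context (psi : forall j, {linear 'rV[D]_(r j.+1) -> 'rV[D]_(r j)}).
Context (phi : {linear 'rV[D]_(r 0) -> M}).
Context (m0 : forall i, @m 0 i = 0).
Context (phi_surj : forall y, exists v, phi v = y).
Context (phi_exact : forall v, phi v = 0 <-> exists w, v = psi 0 w).
Context (psi_exact : forall j, (j < d)%N -> forall v,
       psi j v = 0 <-> exists w, v = psi j.+1 w).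
Context (psiV : forall j, (j <= d)%N -> forall k v,
       inVr (@m j.+1) k v -> inVr (@m j) k (psi j v)).
Context (phiV_exact : forall k v, inVr (@m 0) k v ->
       (phi v = 0 <-> exists2 w, inVr (@m 1) k w & v = psi 0 w)).
Context (psiV_exact : forall j, (j < d)%N -> forall k v, inVr (@m j.+1) k v ->
       (psi j v = 0 <-> exists2 w, inVr (@m j.+2) k w & v = psi j.+1 w)).
Context (p : prime_idealr Kx) (f : 'I_(r 0) -> {poly Kx}).
Context (f_J : forall i, J_Y (phi (delta_mx 0 i)) (f i)).
Context (T : nat -> lmodType D) (dT : forall j, {linear T j.+1 -> T j}).
Context (eps : {linear T 0 -> M}).
Context (T_regular : forall j, tregular (T j)).
Context (T_ddK : forall j (x : T j.+2), dT j (dT j.+1 x) = 0).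
Context (T_eps : forall x, eps x = 0 <-> exists w, x = dT 0 w).
Context (T_exact : forall j (x : T j.+1), dT j x = 0 -> exists w, x = dT j.+1 w).
Context (lam : forall j, {linear 'rV[D]_(r j) -> T j}).
Context (lam0 : forall v, eps (lam 0 v) = phi v).
Context (lamE : forall j, (j <= d)%N ->
  forall v, dT j (lam j.+1 v) = lam j (psi j v)).
Context (k0 : option int) (k1 : int).
Context (k01 : if k0 is Some k then k <= k1 else true).
Context (good_low : forall k, (if k0 is Some k' then k <= k' else false) -> nonvanishing p f k).
Context (good_high : forall k, k1 < k -> nonvanishing p f k).

Local Notation W k0 j := (V_term K n d m k0 k1 j).

Definition Vcyc k j : W k j -> Prop :=
  if j is j'.+1 then fun x => V_diff psiV k k1 j' x = 0 else fun=> True.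

Definition Tcyc j : tens DYX (T j) -> Prop :=
  if j is j'.+1 then fun y => tens_map DYX (dT j') y = 0 else fun=> True.

Definition pcyc k j : 'rV[D]_(r j) -> Prop :=
  if j is j'.+1 then fun v => kills m k (psi j' v) else fun=> True.

Lemma Vcyc_pcyc k j (x : W k j) v : (j <= d.+1)%N -> represents x v ->
  Vcyc x <-> pcyc k v.
Proof.
case: j x v => [//|j] x v jd /(rep_diff psiV) h.
by apply: rep_eq0 h; exact: ltnW.
Qed.

Lemma bd_t_pcyc j (v : 'rV[D]_(r j)) : bd_t psi (v : freeD K n d r j) <-> pcyc None v.
Proof. by case: j v. Qed.

Lemma Vterm_zero k j q : (d.+1 < j)%N -> Vterm K n d m (Some k) j q -> q = 0.
Proof. by move=> jd; rewrite /Vterm leqNgt jd. Qed.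

Lemma W_zero k j (x : W k j) : (d.+1 < j)%N -> x = 0.
Proof.
move=> jd; rewrite -[x]pim_repr; set y := repr _.
have e : val y = 0 by have /asboolP /(Vterm_zero jd) := valP y.
by rewrite (_ : y = 0) ?raddf0 //; apply: val_inj.
Qed.

Lemma Vtens_diff j (x : W None j.+1) :
  Vtens (lam j) (V_diff psiV None k1 j x) = tens_map DYX (dT j) (Vtens (lam j.+1) x).
Proof.
(* [lamE] stops at j = d; for larger j the source is zero. *)
have [jd|jd] := leqP j d; last by rewrite (@W_zero _ _ x) // !raddf0.
have [v _ hv] := rep_ex x (jd : (j.+1 <= d.+1)%N).
rewrite (rep_Vtens (lam j) (rep_diff psiV hv)) (rep_Vtens (lam j.+1) hv).
by rewrite tens_map_unit lamE.
Qed.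

Lemma Vquot_diff j (x : W None j.+1) :
  Vquot K n d m k0 k1 j (V_diff psiV None k1 j x) =
  V_diff psiV k0 k1 j (Vquot K n d m k0 k1 j.+1 x).
Proof.
have [jd|jd] := leqP j d; last by rewrite (@W_zero _ _ x) // !raddf0.
have [v _ hv] := rep_ex x (jd : (j.+1 <= d.+1)%N).
have h1 : represents (Vquot K n d m k0 k1 j (V_diff psiV None k1 j x)) (psi j v).
  by apply: rep_Vquot; exact: rep_diff.
have h2 : represents (V_diff psiV k0 k1 j (Vquot K n d m k0 k1 j.+1 x)) (psi j v).
  by apply: rep_diff; exact: rep_Vquot.
apply/eqP; rewrite -subr_eq0; apply/eqP/(rep_eq0 (leqW jd) (repB h1 h2)).
rewrite subrr /kills; case: (k0) => [k|]; last exact: tmod0.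
by exists 0; [exact: inVr0|rewrite subrr; exact: tmod0].
Qed.

Lemma rep_xdx k j h (x : W k j) v : represents x v -> represents (xdx h *: x) (xop h *: v).
Proof. by move=> /(repZ (xdx h)); rewrite xdx_xop. Qed.

(** The comparison with F yields a preimage of unknown order; [V_boundary_lift] moves it into V^k1
    at the cost of a denominator. *)
Lemma Vtens_inj j (x : W None j) y : (j <= d)%N -> Vcyc x ->
  Vtens (lam j) x = tens_map DYX (dT j) y ->
  exists2 h, h \notin p & exists x', xdx h *: x = V_diff psiV None k1 j x'.
Proof.
move=> jd hx hy.
have [v hv rv] := rep_ex x (leqW jd); have [y0 ey] := tens_unit_surj y.
have hc := (Vcyc_pcyc (leqW jd) rv).1 hx.
have ht : tmod (lam j v - dT j y0).
  by apply/tens_unit_eq0; rewrite tens_unitB -tens_map_unit -ey -hy (rep_Vtens (lam j) rv) subrr.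
have [|w hw] := comparison_inj charK T_regular T_ddK T_eps T_exact phi_exact psi_exact
  lam0 lamE phi_surj jd _ ht.
  by case: (j) v hc {hv rv ht}.
have [h [w' [hh hw' ht']]] := V_boundary_lift charK m0 psi_exact psiV phiV_exact
  psiV_exact f_J good_high jd hv hw.
exists h => //; have [x' rx'] := ex_rep None (jd : (j.+1 <= d.+1)%N) hw'.
exists x'; apply/eqP; rewrite -subr_eq0; apply/eqP.
apply/(rep_eq0 (leqW jd) (repB (rep_xdx h rv) (rep_diff psiV rx'))).
exact: ht'.
Qed.

Lemma scale_sub_split (R : pzRingType) (N : lmodType R) (c : R) (v w v' u : N) :
  c *: v - (c *: w + u) = c *: (v - w - v') + (c *: v' - u).
Proof. by rewrite !scalerBr opprD !addrA subrK. Qed.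

Lemma zmod_subA (Z : zmodType) (a b c u v : Z) :
  a - b - (c + u) = a - v - c + (v - u - b).
Proof.
rewrite -[v - u - b]addrA -opprD [a - v - c]addrAC subrKA -!addrA -!opprD.
by congr (_ - _); rewrite addrC addrA.
Qed.

(** The class comes from a vector v of unknown order, which [V_cycles_lift] moves into V^k1 up to a
    cycle psi w; that cycle only contributes the boundary dT (lam w). *)
Lemma Vtens_surj j (y : tens DYX (T j)) : (j <= d)%N -> Tcyc y ->
  exists2 h, h \notin p & exists x : W None j, Vcyc x /\
    exists y', xdx h *: y - Vtens (lam j) x = tens_map DYX (dT j) y'.
Proof.
move=> jd; have [y0 ->] := tens_unit_surj y => hy.
have [|v [u [hv ht]]] := comparison_surj charK T_regular T_ddK T_eps T_exact phi_exact
  psi_exact lam0 lamE phi_surj (y := y0) jd.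
  by case: (j) y0 hy => [//|j'] y0 /=; rewrite tens_map_unit => /tens_unit_eq0.
have hv' : bd_t psi (v : freeD K n d r j) by case: (j) v hv {ht}.
have [h [x [b [hh hx hb ht']]]] := V_cycles_lift charK m0 psi_exact psiV phiV_exact
  psiV_exact f_J good_high (leqW jd) hv'.
have [w ew] : exists w, x = psi j w.
  case: (j) jd x hx {ht'} => [|j'] jd' x /=; first by move/phi_exact.
  by move/(psi_exact jd').
have [x' rx'] := ex_rep None (leqW jd) hb.
exists h => //; exists x'; split.
  by apply/(Vcyc_pcyc (leqW jd) rx')/bd_t_pcyc; exact: bd_t_rest hv' hx ht'.
exists (tens_unit (xop h *: u + lam j.+1 w)).
rewrite tens_map_unit (rep_Vtens (lam j) rx') -tens_unitZ xdx_xop -tens_unitB.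
apply/eqP; rewrite -subr_eq0 -tens_unitB; apply/eqP/tens_unit_eq0.
rewrite linearD linearZ lamE //= -ew (zmod_subA _ _ _ _ (xop h *: lam j v)).
apply: tmodD; first by rewrite -!scalerBr; exact: tmod_xop.
by rewrite -linearZ -!raddfB; exact: tmod_linear.
Qed.

(** The error v' in V^k0 between v and psi w is a cycle modulo t, and [V_acyclic] makes a multiple
    of it a boundary within V^k0. *)
Lemma Vquot_inj j (x : W None j) (x'' : W k0 j.+1) : (j <= d)%N -> Vcyc x ->
  Vquot K n d m k0 k1 j x = V_diff psiV k0 k1 j x'' ->
  exists2 h, h \notin p & exists x', xdx h *: x = V_diff psiV None k1 j x'.
Proof.
move=> jd hx hq.
have [v hv rv] := rep_ex x (leqW jd).
have [w hw rw] := rep_ex x'' (jd : (j.+1 <= d.+1)%N).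
have hc := (Vcyc_pcyc (leqW jd) rv).1 hx.
have hk : kills m k0 (v - psi j w).
  apply/(rep_eq0 (leqW jd) (repB (rep_Vquot k0 rv) (rep_diff psiV rw))).
  by rewrite hq subrr.
suff [h hh [u hu ht]] : exists2 h, h \notin p & exists2 u, inVr (@m j.+1) k1 u &
    tmod (xop h *: v - psi j u).
  exists h => //; have [x' rx'] := ex_rep None (jd : (j.+1 <= d.+1)%N) hu.
  exists x'; apply/eqP; rewrite -subr_eq0; apply/eqP.
  exact/(rep_eq0 (leqW jd) (repB (rep_xdx h rv) (rep_diff psiV rx'))).
(* For k0 = -oo nothing was divided out, and h = 1 works. *)
move: hk; rewrite /kills; case: (k0) k01 good_low => [k|] kk1 glow; last first.
  move=> ht; exists 1; first by rewrite idealr1.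
  by exists w => //; rewrite xop1 scale1r.
move=> [v' hv' ht].
have hc' : bd_t psi (v' : freeD K n d r j).
  apply/bd_t_pcyc; case: (j) jd v w v' hc ht {hv rv hw rw hv' x hx x'' hq}.
    by [].
  move=> j' jd' v w v' /= hc /(tmod_linear (psi j')).
  rewrite !raddfB /= (_ : psi j' (psi j'.+1 w) = 0).
    by rewrite subr0 => ht; rewrite -[psi j' v'](subKr (psi j' v)); exact: tmodB.
  by apply/(psi_exact jd'); exists w.
have [h [u [hh hu ht']]] := V_acyclic charK m0 psi_exact psiV phiV_exact psiV_exact
  f_J glow jd (lexx k) hv' hc'.
exists h => //; exists (xop h *: w + u).
  apply: inVrD; last by apply: inVr_leq hu.
  by apply: inVrZ => //; exact: inV_polyop.
have -> : xop h *: v - psi j (xop h *: w + u) =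
    xop h *: (v - psi j w - v') + (xop h *: v' - psi j u).
  by rewrite linearP; exact: scale_sub_split.
by apply: tmodD => //; exact: tmod_xop.
Qed.

(** psi v lies in V^k0 modulo t and is a cycle there, so a multiple h psi v is corrected by psi w
    with w in V^k0; then h v - w is a cycle modulo t with the class of h v. *)
Lemma Vquot_surj j (x : W k0 j) : (j <= d)%N -> Vcyc x ->
  exists2 h, h \notin p & exists x' : W None j, Vcyc x' /\
    xdx h *: x = Vquot K n d m k0 k1 j x'.
Proof.
move=> jd hx; have [v hv rv] := rep_ex x (leqW jd).
have := (Vcyc_pcyc (leqW jd) rv).1 hx.
suff h0 : pcyc k0 v -> exists2 h, h \notin p & exists v',
    [/\ inVr (@m j) k1 v', pcyc None v' & kills m k0 (xop h *: v - v')].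
  move=> /h0 [h hh [v' [hv' hc hk]]]; exists h => //.
  have [x' rx'] := ex_rep None (leqW jd) hv'.
  exists x'; split; first exact/(Vcyc_pcyc (leqW jd) rx').
  apply/eqP; rewrite -subr_eq0; apply/eqP.
  exact/(rep_eq0 (leqW jd) (repB (rep_xdx h rv) (rep_Vquot k0 rx'))).
have triv : pcyc None v -> exists2 h, h \notin p & exists v',
    [/\ inVr (@m j) k1 v', pcyc None v' & kills m k0 (xop h *: v - v')].
  move=> hc; exists 1; first by rewrite idealr1.
  exists v; split=> //; rewrite xop1 scale1r subrr /kills.
  case: (k0) => [k|]; last exact: tmod0.
  by exists 0; [exact: inVr0|rewrite subrr; exact: tmod0].
case: (k0) k01 good_low triv => [k|] kk1 glow triv; last exact: triv.
case: (j) jd v hv {rv x hx} triv => [|j'] jd' v hv triv; first by move=> _; exact: triv.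
move=> /= [u hu ht].
have hc' : bd_t psi (u : freeD K n d r j').
  case: (j') jd' v u hu ht {hv triv} => [//|i] jd' v u hu /= /(tmod_linear (psi i)).
  rewrite raddfB /= (_ : psi i (psi i.+1 v) = 0).
    by rewrite sub0r => /tmodN; rewrite opprK.
  by apply/(psi_exact (ltnW jd')); exists v.
have [h [w [hh hw ht']]] := V_acyclic charK m0 psi_exact psiV phiV_exact psiV_exact
  f_J glow (ltnW jd') (lexx k) hu hc'.
exists h => //; exists (xop h *: v - w); split.
- apply: inVrB; last by apply: inVr_leq hw.
  by apply: inVrZ => //; exact: inV_polyop.
- change (tmod (psi j' (xop h *: v - w))); rewrite raddfB /= linearZ /=.
  have -> : xop h *: psi j' v - psi j' w =
      xop h *: (psi j' v - u) + (xop h *: u - psi j' w).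
    by rewrite scalerBr addrA subrK.
  by apply: tmodD => //; exact: tmod_xop.
by exists w => //; rewrite subKr subrr; exact: tmod0.
Qed.
End Assembly.

Lemma tens_zero R S (B : bimodule R S) (N : lmodType S) :
  (forall x : N, x = 0) -> forall z : tens B N, z = 0.
Proof.
move=> N0; elim/tens_ind => [|x y -> ->|b x] //; first by rewrite addr0.
by rewrite (N0 x) tmk0r.
Qed.

Lemma zero_module_eq0 (R : pzRingType) (x : zero_module R) : x = 0.
Proof. by apply/rowP => -[]. Qed.

(** * The two maps out of the complex V^k1 *)

Section ChainMaps.
Context (K : fieldType) (n d : nat).
Local Notation D := (Dxt K n d).
Local Notation DYX := (DYX K n d).
Context (F : complex D).

(** The resolution reindexed by position. The split at j = 0 lets [cdiff] have the required type by
    computation of [dsucc]. *)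
Definition res_term (j : nat) : lmodType D :=
  if j is j'.+1 then F (Negz j') else F 0.

Definition res_diff (j : nat) : {linear res_term j.+1 -> res_term j} :=
  match j with 0 => cdiff F (Negz 0) | j'.+1 => cdiff F (Negz j'.+1) end.

Context (F_pos : forall k : int, 0 < k -> forall x : F k, x = 0).
Context (r : nat -> nat) (m : forall j, 'I_(r j) -> int).
Context (psi : forall j, {linear 'rV[D]_(r j.+1) -> 'rV[D]_(r j)}).
Context (psi_exact : forall j, (j < d)%N -> forall v,
       psi j v = 0 <-> exists w, v = psi j.+1 w).
Context (psiV : forall j, (j <= d)%N -> forall k v,
       inVr (@m j.+1) k v -> inVr (@m j) k (psi j v)).
Context (k0 : option int) (k1 : int).
Local Notation W k := (V_complex psiV psi_exact k k1).

Definition Vquot_fun (k : int) : {linear W None k -> W k0 k} :=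
  match k with
  | Posz 0 => Vquot K n d m k0 k1 0
  | Posz _.+1 => \0 : {linear zero_module _ -> zero_module _}
  | Negz j => Vquot K n d m k0 k1 j.+1
  end.

Lemma Vquot_funE k x :
  Vquot_fun (dsucc k) (cdiff (W None) k x) = cdiff (W k0) k (Vquot_fun k x).
Proof. by case: k x => [[|k]|[|j]] x //; exact: Vquot_diff. Qed.

Definition Vquot_map : cmap (W None) (W k0) := CMap Vquot_funE.

Section ToLiota.
Context (lam : forall j, {linear 'rV[D]_(r j) -> res_term j}).
Context (lamE : forall j, (j <= d)%N ->
  forall v, res_diff j (lam j.+1 v) = lam j (psi j v)).

Definition Vtens_fun (k : int) : {linear W None k -> Liota F k} :=
  match k with
  | Posz 0 => @Vtens K n d r m k1 0 _ (lam 0)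
  | Posz k'.+1 => \0 : {linear zero_module _ -> tens DYX (F (Posz k'.+1))}
  | Negz j => @Vtens K n d r m k1 j.+1 _ (lam j.+1)
  end.

Lemma Vtens_funE k x :
  Vtens_fun (dsucc k) (cdiff (W None) k x) = cdiff (Liota F) k (Vtens_fun k x).
Proof.
case: k x => [k|[|j]] x; last 2 first.
- exact: (Vtens_diff psiV lamE (x : V_term K n d m None k1 1)).
- exact: (Vtens_diff psiV lamE (x : V_term K n d m None k1 j.+2)).
(* A differential out of a nonnegative degree ends in a positive one, where F and hence the tensor
   product vanish. *)
have F0 : forall y : F (dsucc (Posz k)), y = 0 by exact: F_pos.
by rewrite [LHS](tens_zero F0) [RHS](tens_zero F0).
Qed.

Definition Vtens_map : cmap (W None) (Liota F) := CMap Vtens_funE.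
End ToLiota.
End ChainMaps.

Section Bounded.
Context (K : fieldType) (n d : nat).
Local Notation D := (Dxt K n d).

Lemma V_complex_bounded r m psi psiV psi_exact k0 k1 :
  bounded_above (@V_complex K n d r m psi psiV psi_exact k0 k1).
Proof. by exists 1 => -[[|k]|k] // _ x; exact: zero_module_eq0. Qed.

Lemma Liota_bounded (F : complex D) :
  (forall k : int, 0 < k -> forall x : F k, x = 0) -> bounded_above (Liota F).
Proof.
move=> h; apply: bounded_above_tens; exists 1 => k k1; apply: h.
exact: lt_le_trans k1.
Qed.
End Bounded.

(** Write b = f / g with g outside p: if f(j) were in p, then b(j) would specialize to 0. Hence the
    numerator f in J_Y(u) can replace b. *)
Lemma indicial_good K n d (M : lmodType (Dxt K n d)) (u : M) p b :
  indicial_poly u p b -> exists f : {poly {mpoly K[n]}}, J_Y u f /\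
  forall j : int, ~ specializes_to_0 p b.[j%:~R] -> f.[j%:~R] \notin p.
Proof.
move=> [[f [g [hf hg eb]]] _ _]; exists f; split=> // j hb.
apply/negP => hp; apply: hb; exists f.[j%:~R], g; split=> //.
rewrite eb hornerZ mulrC -(rmorph_int (@FracField.tofrac {mpoly K[n]})).
by rewrite horner_map.
Qed.

Lemma Dminus_iso_zero (R : pzRingType) (C C' : complex R) :
  (forall k (x : C k), x = 0) -> (forall k (x : C' k), x = 0) -> Dminus_iso C C'.
Proof.
move=> h h'.
pose f : cmap C C' := @CMap R C C' (fun k => \0) (fun k x => esym (raddf0 _)).
apply: (@Diso_qis R C C' f); [by exists 0|by exists 0|move=> k; split=> x].
  by move=> _ _; rewrite (h k x); exact: is_boundary0.
move=> _; exists 0; first by rewrite /is_cycle raddf0.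
by rewrite (h' k (x - _)); exact: is_boundary0.
Qed.

(** * The zigzag of quasi-isomorphisms *)

Section MainTheorem.
Context (K : fieldType) (charK : [pchar K] =i pred0) (n d : nat).
Local Notation D := (Dxt K n d).
Local Notation DYX := (DYX K n d).
Context (M : lmodType D) (r : nat -> nat) (m : forall j, 'I_(r j) -> int).
Context (psi : forall j, {linear 'rV[D]_(r j.+1) -> 'rV[D]_(r j)}).
Context (phi : {linear 'rV[D]_(r 0) -> M}).
Context (m0 : forall i, @m 0 i = 0).
Context (phi_surj : forall y, exists v, phi v = y).
Context (phi_exact : forall v, phi v = 0 <-> exists w, v = psi 0 w).
Context (psi_exact : forall j, (j < d)%N -> forall v,
       psi j v = 0 <-> exists w, v = psi j.+1 w).
Context (psiV : forall j, (j <= d)%N -> forall k v,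
       inVr (@m j.+1) k v -> inVr (@m j) k (psi j v)).
Context (phiV_exact : forall k v, inVr (@m 0) k v ->
       (phi v = 0 <-> exists2 w, inVr (@m 1) k w & v = psi 0 w)).
Context (psiV_exact : forall j, (j < d)%N -> forall k v, inVr (@m j.+1) k v ->
       (psi j v = 0 <-> exists2 w, inVr (@m j.+2) k w & v = psi j.+1 w)).
Context (p : prime_idealr {mpoly K[n]}) (f : 'I_(r 0) -> {poly {mpoly K[n]}}).
Context (f_J : forall i, J_Y (phi (delta_mx 0 i)) (f i)).
Context (F : complex D) (eps : {linear F 0 -> M}).
Context (F_res : projective_resolution eps).
Context (k0 : option int) (k1 : int).
Context (k01 : if k0 is Some k then k <= k1 else true).
Context (good_low : forall k, (if k0 is Some k' then k <= k' else false) -> nonvanishing p f k).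
Context (good_high : forall k, k1 < k -> nonvanishing p f k).
Local Notation W k := (V_complex psiV psi_exact k k1).
Local Notation l := (- (d%:Z)).
Local Notation den := (@den K n d p).

Lemma F_pos k : 0 < k -> forall x : F k, x = 0.
Proof. by case: F_res => _ h _ _ _; exact: h. Qed.

Lemma res_regular j : tregular (res_term F j).
Proof.
case: F_res => h _ _ _ _; apply: (tregular_projective charK).
by case: j => [|j]; exact: h.
Qed.

Lemma res_ddK j (x : res_term F j.+2) : res_diff F j (res_diff F j.+1 x) = 0.
Proof.
case: j x => [|j] x; first exact: (@cdiffK _ F (Negz 1) x).
exact: (@cdiffK _ F (Negz j.+2) x).
Qed.

Lemma res_eps (x : res_term F 0) : eps x = 0 <-> exists w, x = res_diff F 0 w.
Proof.
case: F_res => _ _ _ h _; split=> [/(h x) /(@boundaryE _ F (Negz 0)) [w hw]|[w ->]].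
  by exists w.
by apply/(h _); exact: (@IsBoundary _ F (Negz 0)).
Qed.

Lemma res_exact j (x : res_term F j.+1) : res_diff F j x = 0 ->
  exists w, x = res_diff F j.+1 w.
Proof.
case: F_res => _ _ h _ _ hx.
have : is_boundary (x : F (Negz j)).
  by apply: h => //; case: j x hx => [|j] x hx; exact: hx.
by move=> /(@boundaryE _ F (Negz j.+1)) [w <-]; exists w.
Qed.

Lemma Liota_acyclic k : k < l -> forall x : Liota F k, is_cycle x -> is_boundary x.
Proof.
case: k => [k|j] kl x hx.
  by move: kl; rewrite ltNge (le_trans _ (_ : 0 <= k%:Z)) // oppr_le0.
have jd : (d < j.+1)%N by move: kl; rewrite NegzE ltrN2.
have [x0 ex] := tens_unit_surj x; subst x.
have ht : tmod (res_diff F j (x0 : res_term F j.+1)).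
  by apply/tens_unit_eq0; rewrite -tens_map_unit; case: j x0 {kl jd} hx.
have [w hw] := T_acyclic res_regular res_ddK res_exact jd ht.
apply/(@boundaryE _ (Liota F) (Negz j.+1)); exists (tens_unit w).
rewrite /= tens_map_unit; apply/eqP; rewrite eq_sym -subr_eq0 -tens_unitB; apply/eqP.
exact/tens_unit_eq0.
Qed.

Lemma den_xdx h : h \notin p -> den (xdx d h).
Proof. by exists h. Qed.

(** Degrees at least -d are the positions up to d, and [Negz j] is position j + 1; hence the strict
    bound j < d. *)
Lemma V_degree (Q : int -> Prop) : Q 0 -> (forall k : nat, Q k.+1) ->
  (forall j : nat, (j < d)%N -> Q (Negz j)) -> forall k, l <= k -> Q k.
Proof.
move=> Q0 Qp Qn [[|k]|j] //= lk; apply: Qn.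
by move: lk; rewrite NegzE lerN2.
Qed.

Lemma Vquot_iso : den_iso den (trunc_map l (Vquot_map psi_exact psiV k0 k1)).
Proof.
apply: trunc_map_iso; first exact: den1.
apply: V_degree => [|k|j jd].
- split=> x _.
    move=> /(@boundaryE _ (W k0) (Negz 0)) [y ey].
    have [h hh [x' ex']] := Vquot_inj charK m0 psi_exact phiV_exact psiV_exact f_J
      k01 good_low (leq0n d) (I : Vcyc psiV (x : V_term K n d m None k1 0)) (esym ey).
    exists (xdx d h); first exact: den_xdx.
    by apply/(@boundaryE _ (W None) (Negz 0)); exists x'.
  have [h hh [x' [_ ex']]] := Vquot_surj charK m0 psi_exact phiV_exact psiV_exact f_J
    k01 good_low (leq0n d) (I : Vcyc psiV (x : V_term K n d m k0 k1 0)).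
  exists (xdx d h), x'; split=> //; first exact: den_xdx.
  by rewrite /= -ex' subrr; exact: is_boundary0.
- by apply: den_iso_at0 => [|x|x]; [exact: den1|exact: zero_module_eq0..].
split=> x hx.
  move=> /(@boundaryE _ (W k0) (Negz j.+1)) [y ey].
  have hx' : Vcyc psiV (x : V_term K n d m None k1 j.+1) by case: j x hx {jd y ey}.
  have [h hh [x' ex']] := Vquot_inj charK m0 psi_exact phiV_exact psiV_exact f_J
    k01 good_low jd hx' (esym ey).
  exists (xdx d h); first exact: den_xdx.
  by apply/(@boundaryE _ (W None) (Negz j.+1)); exists x'.
have hx' : Vcyc psiV (x : V_term K n d m k0 k1 j.+1) by case: j x hx {jd}.
have [h hh [x' [hc ex']]] := Vquot_surj charK m0 psi_exact phiV_exact psiV_exact f_J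
  k01 good_low jd hx'.
exists (xdx d h), x'; split; [exact: den_xdx|by case: j x' hc {x hx hx' jd ex'}|].
by rewrite /= -ex' subrr; exact: is_boundary0.
Qed.

Context (lam : forall j, {linear 'rV[D]_(r j) -> res_term F j}).
Context (lam0 : forall v, eps (lam 0 v) = phi v).
Context (lamE : forall j, (j <= d)%N ->
  forall v, res_diff F j (lam j.+1 v) = lam j (psi j v)).

Lemma Vtens_iso : den_iso den (trunc_map l (Vtens_map F_pos psi_exact psiV k1 lamE)).
Proof.
apply: trunc_map_iso; first exact: den1.
apply: V_degree => [|k|j jd].
- split=> x _.
    move=> /(@boundaryE _ (Liota F) (Negz 0)) [y ey].
    have [h hh [x' ex']] := Vtens_inj charK m0 phi_surj phi_exact psi_exact phiV_exact
      psiV_exact f_J res_regular res_ddK res_eps res_exact lam0 lamE good_high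
      (leq0n d) (I : Vcyc psiV (x : V_term K n d m None k1 0)) (esym ey).
    exists (xdx d h); first exact: den_xdx.
    by apply/(@boundaryE _ (W None) (Negz 0)); exists x'.
  have [h hh [x' [_ [y ey]]]] := Vtens_surj charK m0 phi_surj phi_exact psi_exact
    psiV phiV_exact psiV_exact f_J res_regular res_ddK res_eps res_exact lam0 lamE
    good_high (leq0n d) (I : Tcyc (res_diff F) (x : tens DYX (res_term F 0))).
  exists (xdx d h), x'; split=> //; first exact: den_xdx.
  by apply/(@boundaryE _ (Liota F) (Negz 0)); exists y.
- apply: den_iso_at0 => [|x|x]; [exact: den1|exact: zero_module_eq0|].
  by apply: tens_zero; exact: F_pos.
split=> x hx.
  move=> /(@boundaryE _ (Liota F) (Negz j.+1)) [y ey].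
  have hx' : Vcyc psiV (x : V_term K n d m None k1 j.+1) by case: j x hx {jd y ey}.
  have [h hh [x' ex']] := Vtens_inj charK m0 phi_surj phi_exact psi_exact phiV_exact
    psiV_exact f_J res_regular res_ddK res_eps res_exact lam0 lamE good_high
    jd hx' (esym ey).
  exists (xdx d h); first exact: den_xdx.
  by apply/(@boundaryE _ (W None) (Negz j.+1)); exists x'.
have hx' : Tcyc (res_diff F) (x : tens DYX (res_term F j.+1)).
  by case: j x hx {jd}.
have [h hh [x' [hc [y ey]]]] := Vtens_surj charK m0 phi_surj phi_exact psi_exact
  psiV phiV_exact psiV_exact f_J res_regular res_ddK res_eps res_exact lam0 lamE
  good_high jd hx'.
exists (xdx d h), x'; split; [exact: den_xdx|by case: j x' hc {x hx hx' jd y ey}|].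
by apply/(@boundaryE _ (Liota F) (Negz j.+1)); exists y.
Qed.

Lemma localized_iso (C C' : complex (Dx K n d)) (g : cmap C C') :
  bounded_above C -> bounded_above C' -> den_iso den g ->
  Dminus_iso (localize p C) (localize p C').
Proof.
move=> hC hC' hg; apply: Diso_qis; [exact: bounded_above_tens..|].
apply: (loc_quasi_iso (@Dx_Dxp_inj K n d p) (den1 d p)) hg.
- exact: denM.
- exact: denC.
- exact: den_inv.
- exact: den_clear.
Qed.

(** V^k1 / V^k0 <- V^k1 -> L iota^* M in truncated form; the last arrow, from L iota^* M to its
    truncation, is an isomorphism because no cohomology lies below -d. *)
Lemma V_Liota_iso :
  Dminus_iso (localize p (trunc_ge l (W k0))) (localize p (Liota F)).
Proof.
have hW k : bounded_above (trunc_ge l (W k)).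
  by apply: bounded_above_trunc; exact: V_complex_bounded.
have hL := Liota_bounded F_pos; have hT := bounded_above_trunc l hL.
apply: Diso_trans (Diso_sym (localized_iso (hW None) (hW k0) Vquot_iso)) _.
apply: Diso_trans (localized_iso (hW None) hT Vtens_iso) _.
apply: Diso_sym; apply: (localized_iso hL hT).
apply: trunc_proj_iso; [exact: den1|exact: Liota_acyclic].
Qed.
End MainTheorem.

Theorem theorem6 (K : fieldType) (charK : [pchar K] =i pred0) (n d : nat)
    (M : lmodType (Dxt K n d)) (M_fg : finitely_generated M)
    (r : nat -> nat) (m : forall j, 'I_(r j) -> int)
    (psi : forall j, {linear 'rV[Dxt K n d]_(r j.+1) -> 'rV[Dxt K n d]_(r j)})
    (phi : {linear 'rV[Dxt K n d]_(r 0%N) -> M})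
    (m0 : forall i, m 0%N i = 0)
    (phi_surj : forall y, exists v, phi v = y)
    (phi_exact : forall v, phi v = 0 <-> exists w, v = psi 0%N w)
    (psi_exact : forall j, (j < d)%N -> forall v,
       psi j v = 0 <-> exists w, v = psi j.+1 w)
    (psiV : forall j, (j <= d)%N -> forall k v,
       inVr (@m j.+1) k v -> inVr (@m j) k (psi j v))
    (phiV_exact : forall k v, inVr (@m 0%N) k v ->
       (phi v = 0 <-> exists2 w, inVr (@m 1%N) k w & v = psi 0%N w))
    (psiV_exact : forall j, (j < d)%N -> forall k v, inVr (@m j.+1) k v ->
       (psi j v = 0 <-> exists2 w, inVr (@m j.+2) k w & v = psi j.+1 w))
    (p : prime_idealr {mpoly K[n]})
    (b : 'I_(r 0%N) -> {poly {fraction {mpoly K[n]}}})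
    (b_indicial : forall i, indicial_poly (phi (delta_mx 0 i)) p (b i))
    (F : complex (Dxt K n d)) (eps : {linear F 0 -> M})
    (F_res : projective_resolution eps) :
  (forall (k0 : option int) (k1 : int),
     (if k0 is Some k then k <= k1 else true) ->
     (forall (j : int) i, (if k0 is Some k then j <= k else false) || (k1 < j) ->
        ~ specializes_to_0 p (b i).[j%:~R]) ->
     Dminus_iso
       (localize p (trunc_ge (- (d%:Z)) (V_complex psiV psi_exact k0 k1)))
       (localize p (Liota F)))
  /\
  ((forall (j : int) i, ~ specializes_to_0 p (b i).[j%:~R]) ->
     Dminus_iso (localize p (Liota F)) (zero_complex (Dxp d p))).
Proof.
have /fin_all_exists [f hf] i := indicial_good (b_indicial i).
have f_J i := (hf i).1.
have [F_proj _ _ _ eps_surj] := F_res.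
have [lam [lam0 lamE]] := lift_chain (dT := res_diff F) (res_eps F_res)
  (res_exact F_res) eps_surj phi_exact psi_exact.
have main k0 k1 : (if k0 is Some k then k <= k1 else true) ->
    (forall (j : int) i, (if k0 is Some k then j <= k else false) || (k1 < j) ->
        ~ specializes_to_0 p (b i).[j%:~R]) ->
    Dminus_iso
      (localize p (trunc_ge (- (d%:Z)) (V_complex psiV psi_exact k0 k1)))
      (localize p (Liota F)).
  move=> k01 hb; apply: (V_Liota_iso charK m0 phi_surj phi_exact psi_exact psiV phiV_exact
    psiV_exact f_J F_res k01 _ _ lam0 lamE) => j hj i; apply: (hf i).2; apply: hb.
    by rewrite hj.
  by rewrite hj orbT.
(* With no excluded integer any k0 = k1 is admissible; at 0 every term of the complex is zero or V^0
   / V^0, which is zero too. *)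
split=> // hb; apply: Diso_trans (Diso_sym (main (Some 0) 0 _ _)) _ => //.
apply: Dminus_iso_zero => k x; last exact: zero_module_eq0.
apply: tens_zero => {}x; rewrite -[x]pim_repr.
suff -> : repr x = 0 by exact: raddf0.
case: k x => [[|k]|j] x; [|exact: zero_module_eq0|].
all: by rewrite -[repr x]pim_repr -(raddf0 (pim _)); apply/pim_eq; rewrite subr0;
  apply/asboolP; exact: (valP (repr (repr x))).
Qed.
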